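(* There exists an $O(n^4)$-time certifying algorithm for recognition of circular-arc graphs, where $n$ is the number of vertices of the input graph.
   Context: A circular-arc graph is the intersection graph of a family of arcs of a circle. A certifying recognition algorithm decides whether the input graph $G$ is a circular-arc graph and, along with its answer, outputs a certificate that can be used to easily verify the answer: in the positive case a circular-arc representation of $G$; in the negative case a structural obstruction (here: after deleting universal vertices and true twins, which does not affect representability, a vertex $z$ of the circular completion $H$ of the resulting graph together with two vertices $x,y$ and an $xy$-walk and a $yx$-walk in $H$ that avoid each other and both avoid $z$, i.e. an anchored invertible pair in $H$). Definitions: graphs have a loop at every vertex; $N[u]$ is the closed neighbourhood; an edge $uv$ is an inclusion edge if $N[u],N[v]$ are comparable under inclusion, otherwise an overlap edge, and $x$ overlaps $y$ if $xy$ is an overlap edge; $\{u,v\}$ is a spanning pair if every $x\notin N[v]$ has $N[x]\subseteq N[u]$ and every $y\notin N[u]$ has $N[y]\subseteq N[v]$; an overlap edge is 2-overlap if its ends form a spanning pair, 1-overlap otherwise; a circular pair is a non-adjacent spanning pair; the circular completion is a smallest graph in which every vertex lies in a circular pair, containing $G$ as an induced subgraph with all edge types of $G$ preserved. A vertex $z$ avoids a walk $P$ if every neighbour of $z$ on $P$ overlaps $z$ and whenever $z$ overlaps both ends of an edge $xy$ of $P$, $x$ and $y$ do not overlap; walks $x_1-\cdots-x_k$ and $y_1-\cdots-y_k$ avoid each other if for all $i<k$, $x_i$ avoids edge $y_iy_{i+1}$ and $y_{i+1}$ avoids edge $x_ix_{i+1}$. *)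

(* Defs.v *)
From mathcomp Require Import all_boot all_order all_algebra reals.

Set Implicit Arguments.
Unset Strict Implicit.
Unset Printing Implicit Defensive.

(* Graphs have a loop at every vertex. *)
Definition graph (T : finType) (e : rel T) : Prop := reflexive e /\ symmetric e.

Section Edges.

Variables (T : finType) (e : rel T).

Definition nbhd (u : T) : {set T} := [set v | e u v].

Definition inclusion_edge (u v : T) : bool :=
  e u v && ((nbhd u \subset nbhd v) || (nbhd v \subset nbhd u)).

Definition overlap (u v : T) : bool := e u v && ~~ inclusion_edge u v.

Definition spanning_pair (u v : T) : bool :=
  [forall x, (x \notin nbhd v) ==> (nbhd x \subset nbhd u)] &&
  [forall y, (y \notin nbhd u) ==> (nbhd y \subset nbhd v)].

Definition two_overlap (u v : T) : bool := overlap u v && spanning_pair u v.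
Definition one_overlap (u v : T) : bool := overlap u v && ~~ spanning_pair u v.

Definition circular_pair (u v : T) : bool := ~~ e u v && spanning_pair u v.

Definition universal (u : T) : bool := [forall v, e u v].
Definition true_twins (u v : T) : bool := nbhd u == nbhd v.

Definition walk (x y : T) (P : seq T) : bool :=
  if P is x' :: p then [&& x' == x, path e x p & last x p == y] else false.

(* [sorted] ranges over the pairs of consecutive vertices of [P]. *)
Definition avoids (z : T) (P : seq T) : bool :=
  all (fun w => e z w ==> overlap z w) P &&
  sorted (fun x y => overlap z x && overlap z y ==> ~~ overlap x y) P.

Definition walks_avoid (P Q : seq T) : Prop :=
  size P = size Q /\
  forall (x0 : T) (i : nat), i.+1 < size P ->
    avoids (nth x0 P i) [:: nth x0 Q i; nth x0 Q i.+1] /\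
    avoids (nth x0 Q i.+1) [:: nth x0 P i; nth x0 P i.+1].

(* [x != y] rules out the trivial pair of one-vertex walks. *)
Definition anchored_invertible_pair (z x y : T) (P Q : seq T) : Prop :=
  [/\ x != y, walk x y P, walk y x Q, walks_avoid P Q
    & avoids z P /\ avoids z Q].

End Edges.

Section Completion.

Variables (T : finType) (G : rel T).

(* [f] embeds [G] in [H] as an induced subgraph. *)
Definition completes (U : finType) (H : rel U) (f : T -> U) : Prop :=
  [/\ graph H,
      forall u, exists v, circular_pair H u v,
      injective f,
      forall u v, H (f u) (f v) = G u v
    & forall u v, [/\ inclusion_edge H (f u) (f v) = inclusion_edge G u v,
                      one_overlap H (f u) (f v) = one_overlap G u v
                    & two_overlap H (f u) (f v) = two_overlap G u v]].

Definition circular_completion (U : finType) (H : rel U) (f : T -> U) : Prop :=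
  completes H f /\
  forall (U' : finType) (H' : rel U') (f' : T -> U'),
    completes H' f' -> #|U| <= #|U'|.

(* [k] enumerates the vertices that survive the deletion of the universal
   vertices and of all but one vertex of each class of true twins. *)
Definition reduction (S : finType) (k : S -> T) : Prop :=
  [/\ forall i, ~~ universal G (k i),
      forall i j, true_twins G (k i) (k j) -> i = j
    & forall u, ~~ universal G u -> exists i, true_twins G u (k i)].

End Completion.

Section CircularArc.

Import GRing.Theory Num.Theory.
Local Open Scope ring_scope.

Variable R : realType.

(* The circle is R/Z, its points being given by real representatives; [arc a b]
   is the closed arc from [a] to [b], in the positive direction. *)
Definition arc (a b p : R) : Prop := exists k : int, a <= p + k%:~R <= b.

(* [a u < b u < a u + 1]: arcs are neither a point nor the whole circle. *)
Definition represents (T : finType) (G : rel T) (a b : T -> R) : Prop :=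
  (forall u, a u < b u < a u + 1) /\
  (forall u v, G u v <-> exists p : R, arc (a u) (b u) p /\ arc (a v) (b v) p).

Definition circular_arc_graph (T : finType) (G : rel T) : Prop :=
  exists a b : T -> R, represents G a b.

End CircularArc.

(* [Arcs L s t]: vertex [u] is given the arc from [s u / L] to [t u / L].
   [Obstruction k f H z x y P Q]: the reduced graph [relpre k G] embedded by [f]
   in [H], and an invertible pair [x, y] of [H] anchored at [z]. *)
Inductive certificate (n : nat) : Type :=
| Arcs (L : nat) (s t : 'I_n -> nat)
| Obstruction (r m : nat) (k : 'I_r -> 'I_n) (f : 'I_r -> 'I_m) (H : rel 'I_m)
    (z x y : 'I_m) (P Q : seq 'I_m).

Definition answer (n : nat) (w : certificate n) : bool :=
  if w is Arcs _ _ _ then true else false.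

Definition valid (R : realType) (n : nat) (G : rel 'I_n) (w : certificate n) :
    Prop :=
  match w with
  | Arcs L s t =>
      0 < L /\
      represents G (fun u => (s u)%:R / L%:R : R)%R
                   (fun u => (t u)%:R / L%:R : R)%R
  | Obstruction r m k f H z x y P Q =>
      [/\ reduction G k, circular_completion (relpre k G) H f
        & anchored_invertible_pair H z x y P Q]
  end.

(* Row-major order. *)
Definition adjacency_matrix (n : nat) (e : rel 'I_n) : seq nat :=
  [seq nat_of_bool (e i j) | i <- enum 'I_n, j <- enum 'I_n].

Definition encode (n : nat) (w : certificate n) : seq nat :=
  match w with
  | Arcs L s t =>
      [:: 1; L] ++ [seq s u | u <- enum 'I_n] ++ [seq t u | u <- enum 'I_n]
  | Obstruction r m k f H z x y P Q =>
      [:: 0; r; m] ++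
      [seq nat_of_ord (k i) | i <- enum 'I_r] ++
      [seq nat_of_ord (f i) | i <- enum 'I_r] ++
      adjacency_matrix H ++
      [:: nat_of_ord z; nat_of_ord x; nat_of_ord y; size P; size Q] ++
      [seq nat_of_ord v | v <- P] ++ [seq nat_of_ord v | v <- Q]
  end.

(* A structured, unit-cost, word RAM: finitely many registers (those named in
   the program), an indirectly addressed memory and a write-only output tape.
   Every arithmetic operation, register access, memory access and test costs 1.
   [Sub] is truncated, [Div] is the Euclidean quotient. *)

Inductive binop : Type := Add | Sub | Mul | Div.

Inductive expr : Type :=
| Lit of nat
| Reg of nat
| Fetch of expr
| Bin of binop & expr & expr.

Inductive program : Type :=
| Skip
| Assign of nat & expr
| Store of expr & expr
| Output of expr
| Seq of program & program
| If of expr & program & program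
| While of expr & program.

Record state : Type := State {
  regs : nat -> nat;
  mem : nat -> nat;
  out : seq nat
}.

Definition eval_binop (o : binop) (a b : nat) : nat :=
  match o with
  | Add => a + b
  | Sub => a - b
  | Mul => a * b
  | Div => a %/ b
  end.

(* Words are the numbers below [W]; overflow is an error. *)
Definition word (W v : nat) : option nat := if v < W then Some v else None.

Fixpoint eval (W : nat) (s : state) (e : expr) : option nat :=
  match e with
  | Lit v => word W v
  | Reg r => word W (regs s r)
  | Fetch e1 => if eval W s e1 is Some a then word W (mem s a) else None
  | Bin o e1 e2 =>
      if eval W s e1 is Some a then
        if eval W s e2 is Some b then word W (eval_binop o a b) else None
      else None
  end.

Fixpoint cost (e : expr) : nat :=
  match e with
  | Lit _ | Reg _ => 1
  | Fetch e1 => (cost e1).+1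
  | Bin _ e1 e2 => (cost e1 + cost e2).+1
  end.

(* [exec W p s t s']: with words below [W], [p] started in [s] halts in [s']
   after [t] steps. *)
Inductive exec (W : nat) : program -> state -> nat -> state -> Prop :=
| exec_skip s :
    exec W Skip s 1 s
| exec_assign s r e v :
    eval W s e = Some v ->
    exec W (Assign r e) s (cost e).+1
      (State [eta regs s with r |-> v] (mem s) (out s))
| exec_store s ea a ev v :
    eval W s ea = Some a -> eval W s ev = Some v ->
    exec W (Store ea ev) s (cost ea + cost ev).+1
      (State (regs s) [eta mem s with a |-> v] (out s))
| exec_output s e v :
    eval W s e = Some v ->
    exec W (Output e) s (cost e).+1
      (State (regs s) (mem s) (rcons (out s) v))
| exec_seq p q s t1 s1 t2 s2 :
    exec W p s t1 s1 -> exec W q s1 t2 s2 ->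
    exec W (Seq p q) s (t1 + t2).+1 s2
| exec_if e p q s v t s1 :
    eval W s e = Some v -> exec W (if v == 0 then q else p) s t s1 ->
    exec W (If e p q) s (cost e + t).+1 s1
| exec_while_stop e p s :
    eval W s e = Some 0 ->
    exec W (While e p) s (cost e).+1 s
| exec_while_step e p s v t1 s1 t2 s2 :
    eval W s e = Some v.+1 ->
    exec W p s t1 s1 -> exec W (While e p) s1 t2 s2 ->
    exec W (While e p) s (cost e + t1 + t2).+1 s2.

(* Cell 0 holds the number of vertices, the next ones the adjacency matrix. *)
Definition input (n : nat) (G : rel 'I_n) : state :=
  State (fun=> 0) (nth 0 (n :: adjacency_matrix G)) [::].

Definition big_O (f g : nat -> nat) : Prop :=
  exists c n0 : nat, forall n, n0 <= n -> f n <= c * g n.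

(* [n.+2 ^ d]: the word size is logarithmic in the number of vertices. *)
Definition certifying_recognition (R : realType) (A : program)
    (time : nat -> nat) : Prop :=
  exists d : nat, forall (n : nat) (G : rel 'I_n), graph G ->
    exists (t : nat) (s : state) (w : certificate n),
      [/\ exec (n.+2 ^ d) A (input G) t s,
          t <= time n,
          out s = encode w,
          answer w <-> circular_arc_graph R G
        & valid R G w].

(* Main.v *)
(** Passing to complementary vertices turns the circular completion H into a poset
    (closed neighbourhoods under inclusion) with an order-reversing involution
    bar, in which x and y are non-adjacent iff x <= bar y.  Fix a minimal z and
    call (x, y) free if x, y and z are pairwise incomparable.  A representation
    can be cut inside z, and then orders the two left ends of every free pair;
    this order does not change along a step of two walks that avoid each other
    and z.  So a component of free pairs containing both (x, y) and (y, x), that is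
    an anchored invertible pair, excludes a representation.

    If no component is its own reversal, orient the free pairs by comparing the
    least key of a component with that of its reversal, for a lexicographic key
    that ranks bar z first.  As in Gallai's theory of comparability graphs, a
    cyclic triangle could be pushed towards the leading pair, so the
    orientation is transitive on a set with exactly one vertex of each pair x, bar x.
    It yields interval endpoints for those, and the complementary arcs represent the
    others.

    With vertices numbered below N = 2n + 2 there are at most N^2 free pairs; each is
    scanned once, by a pass over all N^2 pairs, which gives O(n^4). *)

Require Import Defs.
From mathcomp Require Import all_boot all_order all_algebra reals.
From mathcomp Require Import lra zify boolp.

Set Implicit Arguments.
Unset Strict Implicit.
Unset Printing Implicit Defensive.

(** * The triangle lemma for lexicographically led orientations *)

(** The obstacle is the anchor. A step of [moveZ] between incomparable vertices requires one of them
    to be disjoint from [z], so its components are finer than those the triangle argument handles.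
    On [side] the anchor can be relaxed: a component of the coarser relation [move0], oriented by
    [before], either agrees with an anchored one or contains a pair of a vertex disjoint from [z]
    and a vertex crossing it. In the latter case it also contains a pair headed by [bar z], and this
    is why [bar z] gets the least rank: the triangle argument only asks that the first entry of some
    pair have least rank among all entries of the component. Both walks come from one climb in a
    forest. If a root [(a, b)] shares its label with [(b, a)], following parents from [(b, a)] ends
    in [(a, b)], and the two coordinates trace the two walks. Time and word size are established for
    a small table language with a verified compiler; there the exponent of the running time is the
    nesting depth of loops, which is computed. *)

Inductive star (A : Type) (F : A -> A -> Prop) : A -> A -> Prop :=
| star_refl p : star F p p
| star_step p q r : star F p q -> F q r -> star F p r.

Lemma star_trans (A : Type) (F : A -> A -> Prop) p q r :
  star F p q -> star F q r -> star F p r.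
Proof. by move=> pq qr; elim: qr pq => // q' q1 q2 _ IH F12 pq; apply: star_step F12; apply: IH. Qed.

Lemma star_sym (A : Type) (F : A -> A -> Prop) p q :
  (forall a b, F a b -> F b a) -> star F p q -> star F q p.
Proof.
move=> sF; elim=> [*|a b c _ IH /sF Fcb]; first exact: star_refl.
by apply: star_trans IH; apply: star_step Fcb; apply: star_refl.
Qed.

Section Lexicographic.

Variables (U : finType) (W : pred U) (le dj o : rel U).

Definition incomparable (x y : U) := ~~ le x y && ~~ le y x.
Local Notation ni := incomparable.

Lemma ni_sym x y : ni x y = ni y x.
Proof. by rewrite /ni andbC. Qed.

Hypothesis lexx : reflexive le.
Hypothesis le_adj : forall x y, le x y -> ~~ dj x y.
Hypothesis dj_sym : symmetric dj.

(** Forcing as for the left ends of intervals: if [x] comes after [y] and before [y'] although these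
    two meet, then [y] and [y'] overlap and [x] meets both. *)
Definition oriented (p : rel U) : Prop :=
  (forall x y, W x -> W y -> ni x y -> p y x = ~~ p x y) /\
  (forall x y y', W x -> W y -> W y' -> ni x y -> ni x y' -> ~~ dj y y' ->
     (ni y y' -> dj x y || dj x y') -> p x y = p x y').

Lemma oriented_rev p : oriented p -> oriented (fun x y => p y x).
Proof.
move=> [p1 p2]; split=> [x y Wx Wy nxy|x y y' Wx Wy Wy' n1 n2 d h].
  by rewrite (p1 x y) // negbK.
by rewrite (p1 x y) // (p1 x y') // (p2 x y y').
Qed.

(* Pairs that every orientation in the sense of [oriented] must orient alike. *)
Definition move0 (p q : U * U) : Prop :=
  [/\ W p.1, W p.2 & ni p.1 p.2] /\ [/\ W q.1, W q.2 & ni q.1 q.2] /\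
  ((p.1 = q.1 /\ ~~ dj p.2 q.2 /\ (ni p.2 q.2 -> dj p.1 p.2 || dj p.1 q.2)) \/
   (p.2 = q.2 /\ ~~ dj p.1 q.1 /\ (ni p.1 q.1 -> dj p.2 p.1 || dj p.2 q.1))).

(** If [a] were comparable to [c'], or met both [c] and [c'] while these are incomparable, then
    forcing at [b] would order [b] to [a] as it does to [c] or [c'], against the cycle. So a move of
    [(b, c)] moves [(a, c)] along with it. *)
Lemma triangle_step p a b c c' : oriented p ->
  [/\ W a, W b, W c & W c'] -> ni a b -> ni b c -> ni a c -> ni b c' ->
  ~~ dj c c' -> (ni c c' -> dj b c || dj b c') ->
  p a b -> p b c -> p c a ->
  [/\ ni a c', p b c' & p c' a] /\ (ni c c' -> dj a c || dj a c').
Proof.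
move=> [pa pc] [Wa Wb Wc Wc'] nab nbc nac nbc' dcc' hcc' ab bc ca.
have bc' : p b c' by rewrite -(pc b c c').
have nba : p b a = false by rewrite pa ?ab.
have nac' : ni a c'.
  apply/negPn/negP => nn; move: nba.
  have d : ~~ dj a c'.
    move: nn; rewrite /ni negb_and !negbK => /orP[/le_adj //|/le_adj].
    by rewrite dj_sym.
  rewrite (pc b a c') // ?bc' // => [|nn']; first by rewrite ni_sym.
  by rewrite nn' in nn.
have hac' : ni c c' -> dj a c || dj a c'.
  move=> ncc'; apply/negPn/negP; rewrite negb_or => /andP[d1 d2].
  case/orP: (hcc' ncc') => h; move: nba.
    by rewrite (pc b a c) ?bc // ?h ?orbT // ni_sym.
  by rewrite (pc b a c') ?bc' // ?h ?orbT // ni_sym.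
by split=> //; split=> //; rewrite (pa a c') // -(pc a c c') // -(pa a c).
Qed.

(** A cyclic triangle is pushed along the component of its edge [p] with the apex [a] fixed;
    [triangle_step] keeps the other two edges inside their own components. Moves of the first entry
    are moves of the second entry for the reversed orientation. *)
Lemma triangle_apex a p q : oriented o -> star move0 p q -> W a ->
  [/\ W p.1, W p.2 & ni p.1 p.2] ->
  [/\ ni a p.1, ni a p.2, o a p.1, o p.1 p.2 & o p.2 a] ->
  [/\ W q.1, W q.2, ni q.1 q.2, ni a q.1 & ni a q.2] /\
  [/\ o a q.1, o q.1 q.2, o q.2 a, star move0 (a, p.1) (a, q.1)
    & star move0 (p.2, a) (q.2, a)].
Proof.
move=> oo st Wa [Wp1 Wp2 np] [n1 n2 o1 o2 o3].
elim: st Wp1 Wp2 np n1 n2 o1 o2 o3 => [{}p|{}p [b c] [b' c'] _ IH mv].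
  by move=> *; do !split=> //; apply: star_refl.
move=> Wp1 Wp2 np n1 n2 o1 o2 o3.
have [[/= Wb Wc nbc nab nac] [/= ab bc ca s1 s2]] := IH Wp1 Wp2 np n1 n2 o1 o2 o3.
case: mv => _ /= [[Wb' Wc' nb'c'] mv].
case: mv => [[e [d h]]|[e [d h]]]; subst.
  have [//|//|//|//|//|//|//|//|//|//|[nac' bc' ca'] h'] := @triangle_step o a b' c c' oo.
  split=> //; split=> //; apply: star_step s2 _.
  by split; [|split; [|right]]; rewrite //= ni_sym.
have nc'b' : ni c' b' by rewrite ni_sym.
have nc'b : ni c' b by rewrite ni_sym.
have [//|//|//|//|//|//|//|//|//|//|[nab' cb' ba'] h'] :=
  @triangle_step _ a c' b b' (oriented_rev oo).
split=> //; split=> //; apply: star_step s1 _.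
by split; [|split; [|left]]; rewrite //= ni_sym.
Qed.

Variable rk : U -> nat.
Hypothesis rk_inj : injective rk.
Hypothesis oo : oriented o.
Hypothesis leader : forall x y, W x -> W y -> ni x y -> o x y ->
  exists i j, star move0 (x, y) (i, j) /\
    forall u v, star move0 (x, y) (u, v) -> rk i <= rk u /\ rk i <= rk v.

Lemma move0_sym p q : move0 p q -> move0 q p.
Proof.
rewrite /move0 => -[hp [hq h]]; split=> //; split=> //.
by case: h => -[-> [d h]]; [left|right]; split=> //; rewrite dj_sym ni_sym orbC.
Qed.

(** Pushing an edge to its leader puts the first entry of that leader into the component of another
    edge, so the three least ranks bound each other cyclically and the first entries coincide. One
    more push, from the apex [jA], then orients [iA] and [jA] both ways. *)
Lemma no_cyclic_triangle a b c : W a -> W b -> W c ->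
  ni a b -> ni b c -> ni a c -> o a b -> o b c -> o c a -> False.
Proof.
move=> Wa Wb Wc nab nbc nac ab bc ca.
have nba : ni b a by rewrite ni_sym.
have ncb : ni c b by rewrite ni_sym.
have nca : ni c a by rewrite ni_sym.
have [iA [jA [sA mA]]] := leader Wb Wc nbc bc.
have [iB [jB [sB mB]]] := leader Wc Wa nca ca.
have [iC [jC [sC mC]]] := leader Wa Wb nab ab.
have [[/= WiA WjA nA naiA najA] [/= oaiA oA ojAa saiA sjAa]] :=
  @triangle_apex a _ _ oo sA Wa (And3 Wb Wc nbc) (And5 nab nac ab bc ca).
have [_ [/= _ _ _ sbiB _]] :=
  @triangle_apex b _ _ oo sB Wb (And3 Wc Wa nca) (And5 nbc nba bc ca ab).
have [_ [/= _ _ _ sciC _]] :=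
  @triangle_apex c _ _ oo sC Wc (And3 Wa Wb nab) (And5 nca ncb ca ab bc).
have [_ CA] := mC _ _ saiA.
have [_ AB] := mA _ _ sbiB.
have [_ BC] := mB _ _ sciC.
have e : iC = iA by apply: rk_inj; apply/eqP; rewrite eqn_leq CA (leq_trans AB BC).
have s' : star move0 (a, iA) (iC, jC).
  by apply: star_trans sC; apply: star_sym saiA; apply: move0_sym.
have niAjA : ni jA iA by rewrite ni_sym.
have najA' : ni jA a by rewrite ni_sym.
have [_ [/= h _ _ _ _]] := @triangle_apex jA _ _ oo s' WjA (And3 Wa WiA naiA)
  (And5 najA' niAjA ojAa oaiA oA).
by move: h; rewrite e (proj1 oo iA jA) // oA.
Qed.

End Lexicographic.

(** * Posets with an order-reversing involution, anchored at a minimal element *)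

Section Anchored.

Variables (U : finType) (le : rel U) (bar : U -> U) (z : U).
Hypothesis lexx : reflexive le.
Hypothesis le_anti : forall x y, le x y -> le y x -> x = y.
Hypothesis le_trans : forall x y w, le x y -> le y w -> le x w.
Hypothesis barK : involutive bar.
Hypothesis le_bar : forall x y, le (bar x) (bar y) = le y x.
Hypothesis le_barF : forall x, le x (bar x) = false.
Hypothesis z_min : forall x, le x z -> x = z.

Definition apart (x y : U) := le x (bar y).
Local Notation dj := apart.
Local Notation ni := (incomparable le).
Local Notation zb := (bar z).

Definition free_pair (x y : U) := [&& ni z x, ni z y & ni x y].

(* One step of two walks avoiding each other and [z], either walk pausing. *)
Definition moveZ (p q : U * U) : Prop :=
  free_pair p.1 p.2 /\ free_pair q.1 q.2 /\
  ((p.1 = q.1 /\ ~~ dj p.2 q.2 /\ (ni p.2 q.2 ->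
      (dj p.1 p.2 || dj p.1 q.2) && (dj z p.2 || dj z q.2))) \/
   (p.2 = q.2 /\ ~~ dj p.1 q.1 /\ (ni p.1 q.1 ->
      (dj p.2 p.1 || dj p.2 q.1) && (dj z p.1 || dj z q.1)))).

Lemma dj_sym : symmetric dj.
Proof. by move=> x y; rewrite /apart -le_bar barK. Qed.

Lemma dj_le x y w : le x y -> dj y w -> dj x w.
Proof. exact: le_trans. Qed.

Lemma dj_barr x y : dj x (bar y) = le x y.
Proof. by rewrite /apart barK. Qed.

Lemma le_adj x y : le x y -> ~~ dj x y.
Proof.
move=> xy; apply/negP; rewrite dj_sym => /(le_trans xy).
by rewrite le_barF.
Qed.

Lemma bar_leF x : le (bar x) x = false.
Proof. by rewrite -{2}(barK x) le_barF. Qed.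

Lemma dj_ni x y : dj x y -> ni x y.
Proof.
move=> xy; apply/andP; split; apply/negP => /le_adj; first by rewrite xy.
by rewrite dj_sym xy.
Qed.

Lemma free_pair_sym x y : free_pair x y = free_pair y x.
Proof. by rewrite /free_pair andbCA [ni x y]ni_sym. Qed.

Lemma moveZ_sym p q : moveZ p q -> moveZ q p.
Proof.
rewrite /moveZ => -[hp [hq h]]; split=> //; split=> //.
case: h => -[-> [d h]]; [left|right]; split=> //.
  by rewrite dj_sym ni_sym orbC (orbC (dj z _)).
by rewrite dj_sym ni_sym orbC (orbC (dj z _)).
Qed.

Lemma moveZ_swap x y x' y' : moveZ (x, y) (x', y') -> moveZ (y, x) (y', x').
Proof.
rewrite /moveZ /= (free_pair_sym x y) (free_pair_sym x' y') => -[hp [hq h]].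
by split=> //; split=> //; case: h; [right|left].
Qed.

Variables (rk : U -> nat) (N : nat) (lead : U -> U -> nat).
Hypothesis rk_inj : injective rk.
Hypothesis rk_lt : forall x, rk x < N.
Hypothesis rk_zb : rk zb = 0.
Hypothesis lead_move : forall p q, moveZ p q -> lead p.1 p.2 = lead q.1 q.2.
Hypothesis lead_ex : forall x y, free_pair x y -> exists i j,
  star moveZ (x, y) (i, j) /\ lead x y = rk i * N + rk j.
Hypothesis lead_le : forall x y, free_pair x y -> lead x y <= rk x * N + rk y.
Hypothesis lead_neq : forall x y, free_pair x y -> lead x y != lead y x.

(* [lead x y] is the least key in the component of [(x, y)]. *)
Definition before (x y : U) := free_pair x y && (lead x y < lead y x).
Local Notation o := before.
(* The vertices drawn as intervals; each other vertex has its partner among them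
   and gets the complementary arc. *)
Definition side (x : U) := ni z x && (dj z x || o zb x).
Definition crossing (x : U) := ni z x && ~~ dj z x.

Lemma before_anti x y : free_pair x y -> o y x = ~~ o x y.
Proof.
move=> h; rewrite /before h free_pair_sym h /=.
by have := lead_neq h; lia.
Qed.

Lemma before_move p q : moveZ p q -> o p.1 p.2 = o q.1 q.2.
Proof.
case: p q => [x y] [x' y'] m; have m' := moveZ_swap m.
have [/= h1 [/= h2 _]] := m; rewrite /before h1 h2 /=.
by have := lead_move m; have := lead_move m' => /= -> ->.
Qed.

Lemma before_snd x y y' : free_pair x y -> free_pair x y' -> ~~ dj y y' ->
  (ni y y' -> (dj x y || dj x y') && (dj z y || dj z y')) -> o x y = o x y'.
Proof. by move=> h1 h2 h3 h4; apply: (@before_move (x, y) (x, y')); do !split=> //; left. Qed.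

Lemma before_fst x x' y : free_pair x y -> free_pair x' y -> ~~ dj x x' ->
  (ni x x' -> (dj y x || dj y x') && (dj z x || dj z x')) -> o x y = o x' y.
Proof. by move=> h1 h2 h3 h4; apply: (@before_move (x, y) (x', y)); do !split=> //; right. Qed.

Lemma ni_zb : ni z zb.
Proof. by rewrite /incomparable le_barF bar_leF. Qed.

Lemma dj_zzb : dj z zb.
Proof. by rewrite dj_barr. Qed.

Lemma dj_zE x : dj z x = le x zb.
Proof. by rewrite dj_sym. Qed.

Lemma dj_zbF x : ni z x -> dj x zb = false.
Proof. by rewrite dj_barr => /andP[_ /negbTE]. Qed.

Lemma crossingP x : crossing x ->
  [/\ ni z x, dj z x = false, dj x zb = false & ni zb x].
Proof.
case/andP=> h1 h2; split=> //; [exact/negbTE|exact: dj_zbF|].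
apply/andP; split; last by rewrite -dj_zE.
apply/negP; rewrite -le_bar barK => /z_min e; case/negP: h2.
by rewrite -[x]barK e; apply: dj_zzb.
Qed.

Lemma crossing_bar x : crossing x -> crossing (bar x).
Proof.
case/andP => /andP[h1 h2] h3; rewrite /crossing dj_barr h1 andbT.
apply/andP; split=> //; apply/negP => /z_min e; case/negP: h3.
by rewrite -[x]barK e; apply: dj_zzb.
Qed.

Lemma free_crossing x : crossing x -> free_pair zb x /\ free_pair x zb.
Proof.
by move=> /crossingP[h1 h2 h3 h4]; rewrite /free_pair h1 ni_zb h4 ni_sym h4.
Qed.

(** A vertex disjoint from [z] lies below [bar z], and a step between comparable vertices carries no
    further condition. *)
Lemma before_disjoint d x : crossing x -> ni z d -> dj z d -> ni d x ->
  o d x = o zb x.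
Proof.
move=> cx zd djd dx; have [h1 h2 h3 h4] := crossingP cx.
have [f1 f2] := free_crossing cx.
apply: before_fst; rewrite ?(dj_zbF zd) //; first by rewrite /free_pair zd h1 dx.
by rewrite /incomparable -dj_zE djd.
Qed.

(** The pair [(x, bar x)] is one step away both from [(x, bar z)] and from [(bar z, bar x)]. In a
    representation, [x] and its complement contain different ends of [z]. *)
Lemma before_crossing_bar x : crossing x -> o zb (bar x) = ~~ o zb x.
Proof.
move=> cx; have cb := crossing_bar cx.
have [h1 h2 h3 h4] := crossingP cx; have [b1 b2 b3 b4] := crossingP cb.
have [f1 f2] := free_crossing cx; have [f3 f4] := free_crossing cb.
have nb : free_pair x (bar x) by rewrite /free_pair h1 b1 /incomparable le_barF bar_leF.
rewrite -(before_anti f1) -(@before_snd x (bar x) zb) // ?b3 //; last first.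
  by rewrite dj_barr lexx dj_zzb orbT.
apply/esym/before_fst => //; first by rewrite h3.
by rewrite dj_zzb orbT dj_sym dj_barr lexx.
Qed.

(** Again by single steps to [(x, bar z)] and [(bar z, y)]. Disjoint arcs that cross [z] contain
    different ends of it, so [side], which takes the arcs over one fixed end, has at most one of
    them. *)
Lemma before_noncrossing x y : crossing x -> crossing y -> dj x y ->
  o x y = ~~ o zb x /\ o x y = o zb y.
Proof.
move=> cx cy xy; have [h1 h2 h3 h4] := crossingP cx.
have [b1 b2 b3 b4] := crossingP cy.
have [f1 f2] := free_crossing cx; have [f3 f4] := free_crossing cy.
have f : free_pair x y by rewrite /free_pair h1 b1 dj_ni.
split.
  rewrite -(before_anti f1); apply: before_snd; rewrite ?b3 //.
  by rewrite xy dj_zzb orbT.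
apply: before_fst; rewrite ?h3 //.
by rewrite dj_sym xy dj_zzb orbT.
Qed.

Lemma sideP x : side x -> ni z x /\ (dj z x \/ (crossing x /\ o zb x)).
Proof.
case/andP=> h; rewrite /crossing h; case: (dj z x) => /= h2; split=> //; first by left.
by right.
Qed.

Lemma side_crossing x y : side x -> side y -> crossing x -> crossing y -> 
  dj x y = false.
Proof.
case/sideP=> _ hx /sideP[_ hy] cx cy; apply/negP => xy.
have [e1 e2] := before_noncrossing cx cy xy.
case: hx hy => [|[_ hx]]; first by case/andP: cx => _ /negbTE ->.
case => [|[_ hy]]; first by case/andP: cy => _ /negbTE ->.
by move: e2; rewrite e1 hx hy.
Qed.

(** No two vertices of the side cover the circle, as must be for intervals of a line. A vertex
    disjoint from [z] would force the other one to contain [z]; two crossing ones would have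
    disjoint crossing complements, both on the wrong side. *)
Lemma side_cover x y : side x -> side y -> le (bar x) y = false.
Proof.
move=> sx sy; apply/negP => xy.
have [zx hx] := sideP sx; have [zy hy] := sideP sy.
case: hx => [|[cx ox]].
  rewrite dj_zE => h; move: zy; rewrite /incomparable (@le_trans _ (bar x)) //.
  by rewrite -le_bar barK.
case: hy => [|[cy oy]].
  rewrite dj_zE => h; move: zx; rewrite /incomparable (@le_trans _ (bar y)) //.
    by rewrite -le_bar barK.
  by rewrite -le_bar barK.
have cbx := crossing_bar cx; have cby := crossing_bar cy.
have bxy : dj (bar x) (bar y) by rewrite dj_barr.
have [e1 e2] := before_noncrossing cbx cby bxy.
by move: e2; rewrite e1 !before_crossing_bar // ox oy.
Qed.

Lemma free_side x y : side x -> side y -> ni x y -> free_pair x y.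
Proof. by move=> /andP[h1 _] /andP[h2 _] h; rewrite /free_pair h1 h2. Qed.

(** The condition on [z], absent from [oriented], matters only if [y] and [y'] both cross [z]. Then
    a crossing [x] of the side meets both, and an [x] disjoint from [z] precedes both, because
    [bar z] does. *)
Lemma side_oriented : oriented side le dj o.
Proof.
split=> [x y sx sy n|x y y' sx sy sy' n n' d h].
  by apply: before_anti; apply: free_side.
have [h1|h1] := boolP ((ni y y') && ~~ (dj z y || dj z y')); last first.
  apply: before_snd; rewrite ?free_side // => nn; move: h1.
  by rewrite nn /= negbK => ->; rewrite h.
case/andP: h1 => nn; rewrite negb_or => /andP[h1 h2].
have cy : crossing y by rewrite /crossing h1 andbT; case/andP: sy.
have cy' : crossing y' by rewrite /crossing h2 andbT; case/andP: sy'.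
have [zx [dx|[cx _]]] := sideP sx; last first.
  by have := h nn; rewrite !side_crossing.
rewrite !before_disjoint //.
have [_ []] := sideP sy; first by rewrite (negbTE h1).
have [_ []] := sideP sy'; first by rewrite (negbTE h2).
by move=> [_ ->] [_ ->].
Qed.

Local Notation move0 := (move0 side le dj).

(** The component contains a pair of mixed kind, and hence, by raising [u] to [bar z], a pair headed
    by the vertex of least rank. *)
Definition typed (p : U * U) : Prop := exists u v, star move0 p (u, v) /\
  [/\ side u, side v, dj z u, crossing v & ni u v].

Lemma crossingN x : side x -> crossing x = ~~ dj z x.
Proof. by case/andP=> h _; rewrite /crossing h. Qed.

Lemma side_disjoint x : ni z x -> dj z x -> side x.
Proof. by rewrite /side => -> ->. Qed.

Lemma before_move0 p q : move0 p q -> o p.1 p.2 = o q.1 q.2.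
Proof.
case: p q => [x y] [x' y'] [/= [Wx Wy n] [/= [Wx' Wy' n'] m]].
case: m => [[e [d h]]|[e [d h]]]; subst; first exact: (proj2 side_oriented).
have := proj2 (oriented_rev side_oriented) y' x x'; rewrite /= => -> //.
- by rewrite ni_sym.
- by rewrite ni_sym.
Qed.

Lemma before_star0 p q : star move0 p q -> o p.1 p.2 = o q.1 q.2.
Proof. by elim=> // {}p q1 q2 _ -> /before_move0. Qed.

Lemma step_disjoint u v u' v' : side u -> side v -> dj z u -> dj z v ->
  o u v -> moveZ (u, v) (u', v') ->
  typed (u, v) \/
  (move0 (u, v) (u', v') /\ [/\ side u', side v', dj z u' & dj z v']).
Proof.
move=> su sv du dv ouv m; have ou'v' : o u' v' by rewrite -(before_move m).
case: m => /= [/and3P[zu zv n] [/and3P[zu' zv' n'] m]].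
case: m => [[e [d h]]|[e [d h]]]; subst.
  have m0 : side v' -> move0 (u', v) (u', v').
    move=> sv'; split=> //; split=> //; left; split=> //; split=> //= nn.
    by case/andP: (h nn).
  have [dv'|dv'] := boolP (dj z v').
    have sv' := side_disjoint zv' dv'.
    by right; split; [exact: m0|split].
  have cv' : crossing v' by apply/andP.
  have sv' : side v'.
    by rewrite /side zv' -(before_disjoint cv' zu' du n') ou'v' orbT.
  left; exists u', v'; split; last by split.
  by apply: star_step (m0 sv'); apply: star_refl.
have [du'|du'] := boolP (dj z u').
  have su' := side_disjoint zu' du'.
  right; split; last by split.
  split=> //; split=> //; right; split=> //; split=> //= nn.
  by case/andP: (h nn).
have cu' : crossing u' by apply/andP.
(* [u'] comes before a vertex disjoint from [z], so it lies off the side. Its complement is on the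
   side, and [(u, bar u')] is a mixed pair one relaxed step from [(u, v)]. *)
have cw := crossing_bar cu'; have [w1 w2 w3 w4] := crossingP cw.
have fu' : free_pair u' v' by rewrite /free_pair zu' zv' n'.
have n's : ni v' u' by rewrite ni_sym.
have ow : o zb (bar u').
  rewrite before_crossing_bar // -(before_disjoint cu' zv' dv n's).
  by rewrite (before_anti fu') ou'v'.
have sw : side (bar u') by rewrite /side w1 ow orbT.
have nuw : ni u (bar u').
  apply/andP; split; first by [].
  by apply/negP => /le_trans; move: du; rewrite dj_zE => duz /(_ _ duz); rewrite -dj_zE w2.
left; exists u, (bar u'); split; last by split.
apply: star_step (star_refl _ _) _; split=> //; split=> //; left; split=> //=.
split; first by rewrite dj_barr; case/andP: n's.
case/andP=> n1 n2; rewrite dj_barr.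
have [uu'|uu'] := boolP (le u u'); first by rewrite orbT.
have u'u : ~~ le u' u.
  apply/negP => /le_trans; move: du; rewrite dj_zE => duz /(_ _ duz).
  by rewrite -dj_zE (negbTE du').
have nuu' : ni u u' by apply/andP.
by case/andP: (h nuu') => + _; rewrite {2}/dj (negbTE n1) orbF dj_sym => ->.
Qed.

(** Between crossing vertices the condition at [z] admits comparable steps only, and these do not
    leave the side. The second entry cannot become disjoint from [z]: it would come before [u], as
    [bar z] does. *)
Lemma step_crossing u v u' v' : side u -> side v -> crossing u -> crossing v ->
  o u v -> moveZ (u, v) (u', v') ->
  typed (u, v) \/
  (move0 (u, v) (u', v') /\ [/\ side u', side v', crossing u' & crossing v']).
Proof.
move=> su sv cu cv ouv m; have ou'v' : o u' v' by rewrite -(before_move m).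
have oz x : side x -> crossing x -> o zb x.
  by move=> /sideP[_ []]; [move=> h1 /andP[_]; rewrite h1|case].
have zbx x x' : side x -> crossing x -> crossing x' -> ~~ dj x x' ->
    (ni x x' -> (dj z x || dj z x')) -> side x' /\ ~~ ni x x'.
  move=> sx cx cx' d h; have nn : ~~ ni x x'.
    apply/negP => /h; case/andP: cx cx' => _ /negbTE-> /andP[_ /negbTE->] //.
  split=> //; have [x1 x2 x3 x4] := crossingP cx'.
  rewrite /side x1 -(@before_snd zb x x') ?oz ?orbT //.
  - by case: (free_crossing cx).
  - by case: (free_crossing cx').
  - by move=> h'; rewrite h' in nn.
case: m => /= [/and3P[zu zv n] [/and3P[zu' zv' n'] m]].
case: m => [[e [d h]]|[e [d h]]]; subst.
  have [dv'|dv'] := boolP (dj z v').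
    have n's : ni v' u' by rewrite ni_sym.
    have := before_disjoint cu zv' dv' n's.
    have fp : free_pair u' v' by rewrite /free_pair zu zv' n'.
    by rewrite (before_anti fp) ou'v' oz.
  have cv' : crossing v' by apply/andP.
  have [|sv' nn] := zbx v v' sv cv cv' d; first by move=> /h /andP[].
  right; split; last by split.
  split=> //; split=> //; left; split=> //; split=> //= n1.
  by rewrite n1 in nn.
have [du'|du'] := boolP (dj z u').
  left; exists u', v'; split.
    apply: star_step (star_refl _ _) _.
    split=> //; split; first by split=> //; apply: side_disjoint.
    by right; split=> //; split=> //= /h /andP[].
  by split=> //; apply: side_disjoint.
have cu' : crossing u' by apply/andP.
have [|su' nn] := zbx u u' su cu cu' d; first by move=> /h /andP[].
right; split; last by split.
split=> //; split=> //; right; split=> //; split=> //= n1.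
by rewrite n1 in nn.
Qed.

Lemma typed_star p q : star move0 p q -> typed q -> typed p.
Proof.
by move=> s [u [v [s' h]]]; exists u, v; split=> //; apply: star_trans s'.
Qed.

Lemma before_ni x y : o x y -> ni x y.
Proof. by case/andP=> /and3P[]. Qed.

Lemma typedN p : ~ typed p -> side p.1 -> side p.2 -> o p.1 p.2 ->
  dj z p.1 = dj z p.2.
Proof.
case: p => x y /= nt sx sy oxy; have n := before_ni oxy.
have [dx|dx] := boolP (dj z x); have [dy|dy] := boolP (dj z y) => //.
  by case: nt; exists x, y; split; [exact: star_refl|split; rewrite // crossingN].
have cx : crossing x by rewrite crossingN.
have [zy _] := sideP sy; have := before_disjoint cx zy dy.
have fp : free_pair x y by case/andP: oxy.
rewrite ni_sym => /(_ n); rewrite (before_anti fp) oxy.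
by case/sideP: sx => _ [|[_ ->]] //; rewrite (negbTE dx).
Qed.

(** Without mixed pairs both entries stay of one kind, and for each kind the step lemmas keep an
    anchored walk on the side. *)
Lemma star_moveZ_0 p q : ~ typed p -> side p.1 -> side p.2 -> o p.1 p.2 ->
  star moveZ p q -> star move0 p q /\ side q.1 /\ side q.2.
Proof.
move=> nt s1 s2 op st.
elim: st nt s1 s2 op => [*|{}p [x y] [x' y'] _ IH m nt s1 s2 op].
  by split=> //; apply: star_refl.
have [s [/= sx sy]] := IH nt s1 s2 op.
have ntq : ~ typed (x, y) by move/(typed_star s).
have oxy : o x y by rewrite -(before_star0 s).
have := typedN ntq sx sy oxy => /=.
case: (boolP (dj z x)) => dx e; symmetry in e.
  case: (step_disjoint sx sy dx e oxy m) => // -[m0 [sx' sy' _ _]].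
  by split=> //; apply: star_step m0.
have cx : crossing x by rewrite crossingN.
have cy : crossing y by rewrite crossingN ?e.
case: (step_crossing sx sy cx cy oxy m) => // -[m0 [sx' sy' _ _]].
by split=> //; apply: star_step m0.
Qed.

(** The condition at [z] could fail only for a step between two crossing vertices. Then the fixed
    entry crosses too, and meets both by [side_crossing], which a relaxed step between incomparable
    vertices forbids. *)
Lemma star_move0_Z p q : ~ typed p -> o p.1 p.2 ->
  star move0 p q -> star moveZ p q.
Proof.
move=> nt op st; elim: st nt op => [*|{}p [x y] [x' y'] st IH m nt op].
  exact: star_refl.
apply: star_step (IH nt op) _; have {IH}ntq : ~ typed (x, y) by move/(typed_star st).
have oxy : o x y by rewrite -(before_star0 st).
have := before_move0 m; rewrite /= oxy => /esym oxy'.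
case: m => /= [[sx sy n] [/= [sx' sy' n'] m]].
have fz a b : side a -> side b -> ni a b -> (ni a b -> dj z a || dj z b) \/ (crossing a /\ crossing b).
  by move=> sa sb nab; rewrite !crossingN //; case: (dj z a); case: (dj z b); [left|left|left|right].
split; first exact: free_side.
split; first exact: free_side.
case: m => [[e [d h]]|[e [d h]]]; subst; [left|right].
  split=> //; split=> //= nn; rewrite (h nn) /=.
  have := typedN ntq sx sy oxy => /= e.
  case: (fz y y' sy sy' nn) => [->//|[cy cy']].
  case/orP: (h nn); last by rewrite side_crossing // crossingN // e -crossingN.
  by rewrite side_crossing // crossingN // e -crossingN.
split=> //; split=> //= nn; rewrite (h nn) /=.
have := typedN ntq sx sy oxy => /= e.
case: (fz x x' sx sx' nn) => [->//|[cx cx']].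
case/orP: (h nn); last by rewrite side_crossing // crossingN // -e -crossingN.
by rewrite side_crossing // crossingN // -e -crossingN.
Qed.

Lemma lead_star p q : star moveZ p q -> lead p.1 p.2 = lead q.1 q.2.
Proof. by elim=> // {}p q1 q2 _ -> /lead_move. Qed.

(** A mixed pair steps to one headed by [bar z], of rank 0. Otherwise the leading pair of the
    anchored component serves: its key is at most that of [(u, v)], and also at most that of
    [(v, u)], because [before] points from the smaller label to the larger. Comparing first digits
    bounds both ranks. *)
Lemma side_leader x y : side x -> side y -> ni x y -> o x y ->
  exists i j, star move0 (x, y) (i, j) /\
    forall u v, star move0 (x, y) (u, v) -> rk i <= rk u /\ rk i <= rk v.
Proof.
move=> sx sy n oxy; case: (EM (typed (x, y))) => [[u [v [s [su sv du cv nuv]]]]|nt].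
  exists zb, v; split; last by move=> *; rewrite rk_zb.
  have [h1 h2 h3 h4] := crossingP cv; have [zu _] := sideP su.
  apply: star_step s _; split=> //; split=> /=.
    by split=> //; apply: side_disjoint; rewrite ?ni_zb ?dj_zzb.
  right; split=> //=; split; first by rewrite dj_zbF.
  by rewrite /incomparable -dj_zE du.
have [i [j [s e]]] := lead_ex (free_side sx sy n).
have [s0 [/= si sj]] := star_moveZ_0 nt sx sy oxy s.
exists i, j; split=> // u v suv.
have ouv : o u v by rewrite -(before_star0 suv).
have e' := lead_star (star_move0_Z nt oxy suv); rewrite /= in e'.
have f1 : free_pair u v by case/andP: ouv.
have f2 : free_pair v u by rewrite free_pair_sym.
have := lead_le f1; have := lead_le f2; move: ouv => /andP[_].
move: (rk_lt j) (rk_lt u) (rk_lt v) => b1 b2 b3.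
rewrite -e' e => l1 l2 l3.
have aux a b c d : b < N -> d < N -> a * N + b <= c * N + d -> a <= c.
  move=> hb hd hl; rewrite leqNgt; apply/negP => ca.
  have : c.+1 * N <= a * N by rewrite leq_mul2r ca orbT.
  by rewrite mulSn; move: hl hd; clear; lia.
split; first exact: aux b1 b3 l3.
by apply: aux b1 b2 (leq_trans (ltnW l1) l2).
Qed.

Lemma before_trans x y w : side x -> side y -> side w -> o x y -> o y w -> o x w.
Proof.
move=> sx sy sw xy yw; have nxy := before_ni xy; have nyw := before_ni yw.
have nyx : ni y x by rewrite ni_sym.
have h : le x w || le w x -> False.
  move=> c; have e : o y x = o y w.
    apply: (proj2 side_oriented) => //.
      case/orP: c => /le_adj //; by rewrite dj_sym.
    by case/andP=> n1 n2; move: c; rewrite (negbTE n1) (negbTE n2).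
  by move: e; rewrite yw before_anti ?xy // free_side.
have nxw : ni x w by rewrite /incomparable -negb_or; apply/negP.
apply/negPn/negP => nx; apply: (@no_cyclic_triangle U side le dj o le_adj dj_sym
  rk rk_inj side_oriented side_leader x y w) => //.
by rewrite before_anti ?nx // free_side.
Qed.

End Anchored.

(** * Endpoint orders *)

Section Endpoints.

Variables (U : finType) (W : pred U) (le dj o : rel U).
Hypothesis lexx : reflexive le.
Hypothesis le_anti : forall x y, le x y -> le y x -> x = y.
Hypothesis le_trans : forall x y w, le x y -> le y w -> le x w.
Hypothesis dj_sym : symmetric dj.
Hypothesis dj_le : forall x y w, le x y -> dj y w -> dj x w.
Hypothesis dj_ni : forall x y, dj x y -> incomparable le x y.
Hypothesis o_ni : forall x y, o x y -> incomparable le x y.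
Hypothesis oo : oriented W le dj o.
Hypothesis o_trans : forall x y w, W x -> W y -> W w -> o x y -> o y w -> o x w.
Local Notation ni := (incomparable le).

(* [ll], [rr], [rl], [lr]: the first letter tells the end of [x] and the second the
   end of [y] that it precedes. *)
Definition ll x y := o x y || (le y x && (x != y)).
Definition rr x y := o x y || (le x y && (x != y)).
Definition rl x y := o x y && dj x y.
Definition lr x y := ~~ rl y x.

(** Counting the ends before a given end turns the order of the ends into numbers without sorting,
    and the program can evaluate the same sums. *)
Definition left_pos x := \sum_(y | W y) (ll y x + rl y x).
Definition right_pos x := \sum_(y | W y) (rr y x + lr y x).

Lemma o_asym x y : W x -> W y -> o x y -> o y x = false.
Proof. by move=> Wx Wy h; rewrite (proj1 oo x y) ?h // o_ni. Qed.

Lemma o_le x y y' : W x -> W y -> W y' -> ni x y -> ni x y' ->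
  le y y' || le y' y -> o x y = o x y' /\ o y x = o y' x.
Proof.
move=> Wx Wy Wy' n n' c.
have d : ~~ dj y y'.
  by apply/negP => /dj_ni /andP[h1 h2]; move: c; rewrite (negbTE h1) (negbTE h2).
have e : o x y = o x y'.
  by apply: (proj2 oo) => // /andP[h1 h2]; move: c; rewrite (negbTE h1) (negbTE h2).
by rewrite !(proj1 oo x) ?e.
Qed.

Lemma ll_trans w x y : W w -> W x -> W y -> ll w x -> ll x y -> ll w y.
Proof.
move=> Ww Wx Wy /orP[wx|/andP[wx nwx]] /orP[xy|/andP[xy nxy]].
- by rewrite /ll (o_trans _ _ _ wx).
- have /andP[n1 n2] := o_ni wx.
  have [yw|yw] := boolP (le y w).
    rewrite /ll yw; case: eqP => [e|_]; last by rewrite orbT.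
    by move: n1; rewrite e xy.
  have nwy : ni w y by rewrite /incomparable yw andbT; apply: contra n1 => /le_trans; apply.
  by rewrite /ll; have [<- _] := o_le Ww Wx Wy (o_ni wx) nwy ltac:(by rewrite xy orbT); rewrite wx.
- have /andP[n1 n2] := o_ni xy.
  have [yw|yw] := boolP (le y w).
    rewrite /ll yw; case: eqP => [e|_]; last by rewrite orbT.
    by move: n1; rewrite -e wx.
  have nwy : ni y w by rewrite /incomparable yw; apply: contra n1; apply: le_trans.
  have nyx : ni y x by rewrite ni_sym o_ni.
  by rewrite /ll; have [_ <-] := o_le Wy Wx Ww nyx nwy ltac:(by rewrite wx); rewrite xy.
rewrite /ll (le_trans xy wx); case: eqP => [e|_]; last by rewrite orbT.
by move: nwx; rewrite (le_anti wx) ?eqxx // e.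
Qed.

Lemma rr_trans w x y : W w -> W x -> W y -> rr w x -> rr x y -> rr w y.
Proof.
move=> Ww Wx Wy /orP[wx|/andP[wx nwx]] /orP[xy|/andP[xy nxy]].
- by rewrite /rr (o_trans _ _ _ wx).
- have /andP[n1 n2] := o_ni wx.
  have [wy|wy] := boolP (le w y).
    rewrite /rr wy; case: eqP => [e|_]; last by rewrite orbT.
    by move: n2; rewrite e xy.
  have nwy : ni w y by rewrite /incomparable wy; apply: contra n2; apply: le_trans.
  by rewrite /rr; have [<- _] := o_le Ww Wx Wy (o_ni wx) nwy ltac:(by rewrite xy); rewrite wx.
- have /andP[n1 n2] := o_ni xy.
  have [wy|wy] := boolP (le w y).
    rewrite /rr wy; case: eqP => [e|_]; last by rewrite orbT.
    by move: n2; rewrite -e wx.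
  have nwy : ni y w by rewrite /incomparable wy andbT; apply: contra n2 => /le_trans; apply.
  have nyx : ni y x by rewrite ni_sym o_ni.
  by rewrite /rr; have [_ <-] := o_le Wy Wx Ww nyx nwy ltac:(by rewrite wx orbT); rewrite xy.
rewrite /rr (le_trans wx xy); case: eqP => [e|_]; last by rewrite orbT.
by move: nwx; rewrite (le_anti wx) ?eqxx // e.
Qed.

(** In the case [o x y]: if [w] and [y] met, forcing at [x], which is disjoint from [w], would put
    both on the same side of [x]. *)
Lemma rl_ll w x y : W w -> W x -> W y -> rl w x -> ll x y -> rl w y.
Proof.
move=> Ww Wx Wy /andP[wx d] /orP[xy|/andP[xy nxy]].
  rewrite /rl (o_trans _ _ _ wx) //=; apply/negPn/negP => nd.
  have : o x w = o x y.
    apply: (proj2 oo) => //; last by rewrite dj_sym d.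
      by rewrite ni_sym o_ni.
    by rewrite o_ni.
  by rewrite xy o_asym.
have d' : dj w y by rewrite dj_sym (dj_le xy) // dj_sym.
by rewrite /rl d' -[o w y](proj1 (o_le Ww Wx Wy (o_ni wx) (dj_ni d') ltac:(by rewrite xy orbT))) wx.
Qed.

Lemma rr_rl w x y : W w -> W x -> W y -> rr w x -> rl x y -> rl w y.
Proof.
move=> Ww Wx Wy /orP[wx|/andP[wx nwx]] /andP[xy d].
  rewrite /rl (o_trans _ _ _ wx) //=; apply/negPn/negP => nd.
  have : o x w = o x y.
    apply: (proj2 oo) => //; last by rewrite d orbT.
      by rewrite ni_sym o_ni.
    by rewrite o_ni.
  by rewrite xy o_asym.
have d' : dj w y by apply: dj_le d.
have n : ni y w by rewrite ni_sym dj_ni.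
have n' : ni y x by rewrite ni_sym dj_ni.
by rewrite /rl d' -(proj2 (o_le Wy Wx Ww n' n ltac:(by rewrite wx orbT))) xy.
Qed.

Lemma ll_total x y : W x -> W y -> x != y -> ~~ ll x y -> ll y x.
Proof.
move=> Wx Wy nxy; rewrite /ll negb_or nxy andbT => /andP[nxo nle].
rewrite eq_sym nxy andbT.
have [_|l] := boolP (le x y); first by rewrite orbT.
by rewrite orbF (proj1 oo x y) // /incomparable l nle.
Qed.

Lemma rr_total x y : W x -> W y -> x != y -> ~~ rr x y -> rr y x.
Proof.
move=> Wx Wy nxy; rewrite /rr negb_or nxy andbT => /andP[nxo nle].
rewrite eq_sym nxy andbT.
have [_|l] := boolP (le y x); first by rewrite orbT.
by rewrite orbF (proj1 oo x y) // /incomparable l nle.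
Qed.

Lemma oxx x : o x x = false.
Proof. by apply/negP => /o_ni; rewrite /incomparable lexx. Qed.

(** Since [lr] is the negation of the reversed [rl], this case and the next are contrapositives of
    [rl_ll] and [rr_rl], by totality. *)
Lemma lr_rl_ll w x y : W w -> W x -> W y -> lr w x -> rl x y -> ll w y.
Proof.
move=> Ww Wx Wy wx xy; apply/negPn/negP => h.
have [e|nwy] := eqVneq w y; first by move: wx; rewrite /lr e xy.
by move: wx; rewrite /lr (rl_ll Wx Wy Ww xy) // ll_total.
Qed.

Lemma rl_lr_rr w x y : W w -> W x -> W y -> rl w x -> lr x y -> rr w y.
Proof.
move=> Ww Wx Wy wx xy; apply/negPn/negP => h.
have [e|nwy] := eqVneq w y; first by move: xy; rewrite /lr -e wx.
by move: xy; rewrite /lr (rr_rl Wy Ww Wx _ wx) // rr_total.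
Qed.

Lemma sum_lt (f g : U -> nat) x : W x -> (forall w, W w -> f w <= g w) -> f x < g x ->
  \sum_(y | W y) f y < \sum_(y | W y) g y.
Proof.
move=> Wx fg lt; rewrite (bigD1 x) // [ltnRHS](bigD1 x) //= -addSn leq_add //.
by apply: leq_sum => w /andP[Ww _]; apply: fg.
Qed.

Lemma leq_bool (b1 b2 : bool) : (b1 -> b2) -> b1 <= b2.
Proof. by case: b1; case: b2 => // /(_ isT). Qed.

Lemma pos_ll x y : W x -> W y -> ll x y -> left_pos x < left_pos y.
Proof.
move=> Wx Wy xy; apply: (sum_lt Wx) => [w Ww|].
  by apply: leq_add; apply: leq_bool => h; [apply: ll_trans xy|apply: rl_ll xy].
by rewrite xy /ll /rl oxx lexx eqxx.
Qed.

Lemma pos_rr x y : W x -> W y -> rr x y -> right_pos x < right_pos y.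
Proof.
move=> Wx Wy xy; have h : forall w, W w -> rr w x + lr w x <= rr w y + lr w y.
  move=> w Ww; apply: leq_add; apply: leq_bool => h; first exact: rr_trans xy.
  by apply: contra h => h'; apply: rr_rl h'.
apply: (sum_lt Wx) => //.
have : lr x x <= lr x y.
  by apply: leq_bool => h'; apply: contra h' => h''; apply: rr_rl h''.
by rewrite xy /rr /lr /rl oxx lexx eqxx /=; case: (o y x && dj y x).
Qed.

Lemma pos_rl x y : W x -> W y -> rl x y -> right_pos x < left_pos y.
Proof.
move=> Wx Wy xy; have h : forall w, W w -> rr w x + lr w x <= ll w y + rl w y.
  move=> w Ww; rewrite addnC; apply: leq_add; apply: leq_bool => h; first exact: lr_rl_ll xy.
  exact: rr_rl xy.
apply: (sum_lt Wx) => //.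
rewrite xy /rr /lr /rl oxx lexx eqxx /=.
by case/andP: xy => xy _; rewrite /ll xy.
Qed.

Lemma pos_lr x y : W x -> W y -> lr x y -> left_pos x < right_pos y.
Proof.
move=> Wx Wy xy; have h : forall w, W w -> ll w x + rl w x <= rr w y + lr w y.
  move=> w Ww; rewrite [leqRHS]addnC; apply: leq_add; apply: leq_bool => h.
    by apply: contra xy => h'; apply: rl_ll h.
  exact: rl_lr_rr xy.
apply: (sum_lt Wx) => //.
by rewrite xy /ll /rl oxx lexx eqxx /= addn1.
Qed.

Lemma pos_bound x : left_pos x <= 2 * #|W| /\ right_pos x <= 2 * #|W|.
Proof.
rewrite mulnC -sum_nat_const; split; apply: leq_sum => y _.
  by case: (ll _ _); case: (rl _ _).
by case: (rr _ _); case: (lr _ _).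
Qed.

Lemma interval_order : forall x y, W x -> W y ->
  [/\ left_pos x < right_pos x,
      le x y -> x != y -> left_pos y < left_pos x /\ right_pos x < right_pos y,
      dj x y -> right_pos x < left_pos y \/ right_pos y < left_pos x
    & ni x y -> ~~ dj x y ->
      [/\ left_pos x < left_pos y, left_pos y < right_pos x & right_pos x < right_pos y] \/
      [/\ left_pos y < left_pos x, left_pos x < right_pos y & right_pos y < right_pos x]].
Proof.
move=> x y Wx Wy; split.
- by apply: pos_lr => //; rewrite /lr /rl oxx.
- move=> xy n; split; [apply: pos_ll|apply: pos_rr] => //.
    by rewrite /ll xy eq_sym n orbT.
  by rewrite /rr xy n orbT.
- move=> d; have n := dj_ni d.
  have [h|h] := boolP (o x y); [left|right]; apply: pos_rl; rewrite // /rl.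
    by rewrite h.
  by rewrite (proj1 oo x y) // h dj_sym.
move=> n d; have [h|h] := boolP (o x y); [left|right].
  split; [apply: pos_ll|apply: pos_lr|apply: pos_rr] => //.
  - by rewrite /ll h.
  - by rewrite /lr /rl (negbTE d) andbF.
  - by rewrite /rr h.
have h' : o y x by rewrite (proj1 oo x y) // h.
split; [apply: pos_ll|apply: pos_lr|apply: pos_rr] => //.
- by rewrite /ll h'.
- by rewrite /lr /rl dj_sym (negbTE d) andbF.
- by rewrite /rr h'.
Qed.

End Endpoints.

(** * The intersection relation of a complemented poset *)

Section ComplementedPoset.

Variables (U : finType) (le : rel U) (bar : U -> U).
Hypothesis lexx : reflexive le.
Hypothesis le_anti : forall x y, le x y -> le y x -> x = y.
Hypothesis le_trans : forall x y w, le x y -> le y w -> le x w.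
Hypothesis barK : involutive bar.
Hypothesis le_bar : forall x y, le (bar x) (bar y) = le y x.
Hypothesis le_barF : forall x, le x (bar x) = false.

Definition meets : rel U := fun x y => ~~ apart le bar x y.
Local Notation e := meets.
Local Notation dj := (apart le bar).
Local Notation ni := (incomparable le).

Lemma meets_graph : graph e.
Proof.
split=> [x|x y]; first by rewrite /meets /apart le_barF.
by rewrite /meets dj_sym.
Qed.

(** The separating vertex is [bar y], whose non-neighbours are exactly the vertices below [y]. *)
Lemma nbhd_sub x y : (nbhd e x \subset nbhd e y) = le x y.
Proof.
apply/subsetP/idP => [h|xy w]; last first.
  by rewrite !inE; apply: contra; apply: dj_le.
apply/negPn/negP => nxy; have := h (bar y).
rewrite !inE /meets ![apart _ _ _ (bar y)](dj_barr _ barK) nxy lexx.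
by move=> /(_ isT).
Qed.

Lemma inclusionE x y : inclusion_edge e x y = le x y || le y x.
Proof.
rewrite /inclusion_edge !nbhd_sub; case: orP => [h|]; last by rewrite andbF.
rewrite andbT /meets; case: h => /(le_adj le_trans barK le_bar le_barF) //.
by rewrite (dj_sym barK le_bar).
Qed.

Lemma overlapE x y : overlap e x y = ni x y && ~~ dj x y.
Proof. by rewrite /overlap inclusionE /incomparable negb_or andbC. Qed.

(** Testing the first clause at [bar y], a non-neighbour of [y], already gives the whole condition:
    the two arcs cover the circle. *)
Lemma spanningE x y : spanning_pair e x y = le (bar x) y.
Proof.
apply/andP/idP => [[/forallP h _]|h].
  have := h (bar y); rewrite !inE nbhd_sub /meets dj_sym // /apart negbK lexx /=.
  by rewrite -{1}[x]barK le_bar.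
split; apply/forallP => w; apply/implyP; rewrite inE negbK nbhd_sub dj_sym // /apart.
  by move=> /le_trans; apply; rewrite -[x]barK le_bar.
by move=> /le_trans; apply.
Qed.

Lemma circularE x y : circular_pair e x y = (y == bar x).
Proof.
rewrite /circular_pair spanningE /meets negbK; apply/andP/eqP => [[h1 h2]|->].
  by apply: le_anti => //; rewrite -[y]barK le_bar.
by rewrite dj_barr // lexx.
Qed.

Variable z : U.

Definition lazy_move (p q : U * U) := moveZ le bar z p q \/ (p = q /\ free_pair le z p.1 p.2).

(** At most one entry moves in each step. So of the two edges to be avoided at an index one is a
    loop, and for the other the requirement is the condition on the fixed entry in [moveZ]; the
    condition on [z] makes [z] avoid both walks. *)
Lemma invertible_of_moves (s : nat -> U * U) (K : nat) :
  (forall i, i < K -> lazy_move (s i) (s i.+1)) -> 0 < K ->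
  s K = ((s 0).2, (s 0).1) ->
  anchored_invertible_pair e z (s 0).1 (s 0).2
    [seq (s i).1 | i <- iota 0 K.+1] [seq (s i).2 | i <- iota 0 K.+1].
Proof.
move=> mv K0 sK.
have fp i : i <= K -> free_pair le z (s i).1 (s i).2.
  rewrite leq_eqVlt => /orP[/eqP->|/mv[[h _]|[_ h]]] //.
  by rewrite sK /= free_pair_sym; case: (mv _ K0) => [[]|[]].
have step (a b : U * U) : lazy_move a b ->
    [/\ e a.1 b.1, e a.2 b.2,
        ni a.1 b.1 -> (dj a.2 a.1 || dj a.2 b.1) && (dj z a.1 || dj z b.1)
      & ni a.2 b.2 -> (dj b.1 a.2 || dj b.1 b.2) && (dj z a.2 || dj z b.2)].
  have rf x : e x x by case: meets_graph => h _; apply: h.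
  have nxx x : ni x x = false by rewrite /incomparable lexx.
  case=> [[_ [_ []]]|[-> _]]; last by rewrite !rf !nxx.
    by move=> [-> [d h]]; rewrite rf nxx; split.
  by move=> [-> [d h]]; rewrite rf nxx; split.
have ovN x a b : dj x a || dj x b -> overlap e x a && overlap e x b = false.
  by rewrite !overlapE => /orP[->|->]; rewrite ?andbF.
have ovni a b : overlap e a b -> ni a b by rewrite overlapE => /andP[].
have mvi := mv; have walkP (pr : U * U -> U) : 
    (forall a b, lazy_move a b -> e (pr a) (pr b)) ->
    walk e (pr (s 0)) (pr (s K)) [seq pr (s i) | i <- iota 0 K.+1].
  move=> hpr; rewrite /walk /= eqxx /=; apply/andP; split; last first.
    rewrite (last_map (fun i => pr (s i)) _ 0) (last_nth 0) size_iota.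
    by rewrite -[_ :: _]/(iota 0 K.+1) nth_iota.
  apply/(pathP (pr (s 0))) => i; rewrite size_map size_iota => iK.
  rewrite (nth_map 0) ?size_iota // nth_iota // add1n.
  suff -> : nth (pr (s 0)) (pr (s 0) :: [seq pr (s j) | j <- iota 1 K]) i = pr (s i).
    by apply: hpr; apply: mv.
  by case: i iK => //= i iK; rewrite (nth_map 0) ?size_iota ?nth_iota ?(ltnW iK).
have avoidP (pr : U * U -> U) : 
    (forall i, i <= K -> ni z (pr (s i))) ->
    (forall a b, lazy_move a b -> ni (pr a) (pr b) -> dj z (pr a) || dj z (pr b)) ->
    avoids e z [seq pr (s i) | i <- iota 0 K.+1].
  move=> h1 h2; apply/andP; split.
    apply/allP => w /mapP[i]; rewrite mem_iota add0n ltnS => /andP[_ iK] ->.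
    by apply/implyP; rewrite overlapE h1.
  rewrite [iota _ _]/= /=; apply/(pathP (pr (s 0))) => i; rewrite size_map size_iota => iK.
  rewrite (nth_map 0) ?size_iota // nth_iota // add1n.
  suff -> : nth (pr (s 0)) (pr (s 0) :: [seq pr (s j) | j <- iota 1 K]) i = pr (s i).
    apply/implyP; apply: contraL => /ovni /(h2 _ _ (mv _ iK)) /ovN ->//.
  by case: i iK => //= i iK; rewrite (nth_map 0) ?size_iota ?nth_iota ?(ltnW iK).
split.
- have /and3P[_ _] := fp 0 isT; apply: contraL => /eqP ->.
  by rewrite /incomparable lexx.
- by have := walkP fst; rewrite sK; apply=> a b /step[].
- by have := walkP snd; rewrite sK; apply=> a b /step[].
- split; first by rewrite !size_map.
  move=> x0 i; rewrite size_map size_iota ltnS => iK.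
  rewrite !(nth_map 0) ?size_iota ?ltnS // 1?ltnW //.
  rewrite !nth_iota ?ltnS // 1?ltnW // !add0n.
  have /and3P[f1 f2 f3] := fp i (ltnW iK).
  have /and3P[g1 g2 g3] := fp i.+1 iK.
  have := mvi i iK; set a := s i; set b := s i.+1 => ab.
  have av (w c d : U) : ni w c -> ni w d -> (ni c d -> dj w c || dj w d) ->
      avoids e w [:: c; d].
    move=> n1 n2 h; rewrite /avoids /= !overlapE n1 n2 /= !andbT.
    rewrite !implybb /=; apply/implyP => /andP[d1 d2].
    apply/negP => /andP[/h]; by rewrite (negbTE d1) (negbTE d2).
  have nxx x : ni x x = false by rewrite /incomparable lexx.
  have f3' : ni a.2 a.1 by rewrite ni_sym.
  have g3' : ni b.2 b.1 by rewrite ni_sym.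
  case: ab => [[_ [_ []]]|[e0 _]].
  - move=> [e0 [d h]]; split; apply: av => //; try by rewrite e0.
      by move=> /h/andP[].
    by rewrite e0 nxx.
  - move=> [e0 [d h]]; split; apply: av => //; try by rewrite -e0.
      by rewrite e0 nxx.
    by rewrite -e0 => /h/andP[].
  by rewrite -e0; split; apply: av; rewrite ?nxx.
- split.
    by apply: (avoidP fst) => [i iK|a b /step[_ _ h _] /h /andP[]//]; case/and3P: (fp i iK).
  by apply: (avoidP snd) => [i iK|a b /step[_ _ _ h] /h /andP[]//]; case/and3P: (fp i iK).
Qed.

End ComplementedPoset.

(** * The circular completion *)

Section SpanningFacts.

Variables (S : finType) (g : rel S).
Hypothesis gG : graph g.

Lemma spanningP u v : spanning_pair g u v <->
  (forall x, ~~ g v x -> nbhd g x \subset nbhd g u) /\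
  (forall x, ~~ g u x -> nbhd g x \subset nbhd g v).
Proof.
rewrite /spanning_pair; split=> [/andP[/forallP h1 /forallP h2]|[h1 h2]].
  by split=> x hx; [have := h1 x|have := h2 x]; rewrite inE hx.
by apply/andP; split; apply/forallP => x; apply/implyP; rewrite inE; [apply: h1|apply: h2].
Qed.

Lemma spanning_sym u v : spanning_pair g u v = spanning_pair g v u.
Proof. by rewrite /spanning_pair andbC. Qed.

Lemma spanning_mono u v w : spanning_pair g u v -> nbhd g v \subset nbhd g w ->
  spanning_pair g u w.
Proof.
move=> /spanningP[h1 h2] /subsetP vw; apply/spanningP; split=> x hx.
  by apply: h1; apply: contra hx => vx; have := vw x; rewrite !inE; apply.
by apply: subset_trans (h2 _ hx) _; apply/subsetP.
Qed.

Lemma nonadj_sub u v w : ~~ g u v -> nbhd g w \subset nbhd g v -> ~~ g u w.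
Proof.
case: gG => _ gs uv /subsetP h; apply: contra uv => uw.
by have := h u; rewrite !inE [g w u]gs uw [g v u]gs; apply.
Qed.

End SpanningFacts.

Section Completion.

Variables (S : finType) (g : rel S).
Hypothesis gG : graph g.
Hypothesis no_universal : forall u, ~~ universal g u.
Hypothesis twin_free : forall u v, true_twins g u v -> u = v.

(* [(u, false)] is [u] and [(u, true)] a circular partner of [u]; [ple] is the
   inclusion of closed neighbourhoods in the completion. *)
Definition ple (x y : S * bool) : bool :=
  match x.2, y.2 with
  | false, false => nbhd g x.1 \subset nbhd g y.1
  | false, true => ~~ g x.1 y.1
  | true, false => spanning_pair g x.1 y.1
  | true, true => nbhd g y.1 \subset nbhd g x.1
  end.

Definition pbar (x : S * bool) := (x.1, ~~ x.2).

Lemma pbarK : involutive pbar.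
Proof. by case=> u b; rewrite /pbar /= negbK. Qed.

Lemma ple_refl : reflexive ple.
Proof. by case=> u []; rewrite /ple /=. Qed.

Lemma ple_bar x y : ple (pbar x) (pbar y) = ple y x.
Proof.
case: gG => _ gs; case: x y => u [] [v []] //=; rewrite /ple /=.
  by rewrite gs.
by rewrite spanning_sym.
Qed.

(** A vertex that spans with itself is universal: a non-neighbour lies in its own neighbourhood,
    which would be contained in that of [u]. *)
Lemma ple_barF x : ple x (pbar x) = false.
Proof.
case: gG => gr _; case: x => u []; rewrite /ple /=; last by rewrite gr.
apply/negP => /spanningP[h _]; case/negP: (no_universal u).
apply/forallP => v; apply/negPn/negP => uv.
have := h _ uv; move/subsetP/(_ v); rewrite !inE gr (negbTE uv).
by move=> /(_ isT).
Qed.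

Lemma ple_trans x y w : ple x y -> ple y w -> ple x w.
Proof.
case: gG => gr gs; case: x y w => u b [v b'] [w b'']; rewrite /ple /=.
case: b; case: b'; case: b''.
- by move=> h1 h2; apply: subset_trans h1.
- by move=> h1; rewrite ![spanning_pair _ _ w]spanning_sym => h2; apply: spanning_mono h1.
- by move=> /spanningP[h1 _] /h1.
- exact: spanning_mono.
- by move=> h1 h2; apply: nonadj_sub h2.
- by rewrite gs => h1 /spanningP[_ /(_ _ h1)].
- by move=> h1; rewrite ![g _ w]gs => h2; apply: nonadj_sub h1.
- exact: subset_trans.
Qed.

Variables (U : finType) (c : U -> S * bool).
Hypothesis c_inj : injective c.
Hypothesis c_false : forall u, exists x, c x = (u, false).
Hypothesis c_true : forall u,
  (exists x, c x = (u, true)) <-> ~ exists v, circular_pair g u v.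

(** [U] keeps every vertex, and a formal partner only where [g] has none. It stays abstract so that
    the vertex numbers of the program can instantiate it. *)
Definition leU : rel U := fun x y => ple (c x) (c y).

Lemma leU_refl : reflexive leU.
Proof. by move=> x; apply: ple_refl. Qed.

Lemma leU_trans x y w : leU x y -> leU y w -> leU x w.
Proof. exact: ple_trans. Qed.

(** Equivalent vertices of the same kind come from true twins. A formal partner equivalent to a
    vertex of [g] would make that vertex a partner in [g], so it was not kept. *)
Lemma leU_anti x y : leU x y -> leU y x -> x = y.
Proof.
case: gG => _ gs.
have tf u v : circular_pair g u v -> forall y, c y = (u, true) -> False.
  by move=> uv w cw; have /(_ (ex_intro _ w cw)) := proj1 (c_true u); apply; exists v.
rewrite /leU /ple; case cx: (c x) => [u b]; case cy: (c y) => [v b'] /=.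
case: b cx => cx; case: b' cy => cy.
- by move=> h1 h2; apply: c_inj; rewrite cx cy (@twin_free u v) //; rewrite /true_twins eqEsubset h1 h2.
- by move=> h1 h2; case: (tf u v _ x cx); rewrite /circular_pair h1 gs h2.
- by rewrite gs spanning_sym => h1 h2; case: (tf v u _ y cy); rewrite /circular_pair h1 spanning_sym h2.
- by move=> h1 h2; apply: c_inj; rewrite cx cy (@twin_free u v) //; rewrite /true_twins eqEsubset h1 h2.
Qed.

(** A formal partner that was dropped is equivalent to the partner in [g] because of which it was
    dropped. This makes complements available inside [U]. *)
Lemma repr_ex p : exists x, ple p (c x) && ple (c x) p.
Proof.
case: gG => _ gs; case: p => u []; last first.
  by have [x e] := c_false u; exists x; rewrite e ple_refl.
have [[v /andP[n h]]|nv] := EM (exists v, circular_pair g u v).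
  by have [x e] := c_false v; exists x; rewrite e /ple /= h gs n.
by have [x e] := proj2 (c_true u) nv; exists x; rewrite e ple_refl.
Qed.

Definition barU (x : U) : U := xchoose (repr_ex (pbar (c x))).

Lemma barUP x : ple (pbar (c x)) (c (barU x)) /\ ple (c (barU x)) (pbar (c x)).
Proof. by apply/andP; apply: (xchooseP (repr_ex (pbar (c x)))). Qed.

Lemma leU_barr x y : leU x (barU y) = ple (c x) (pbar (c y)).
Proof. by have [h1 h2] := barUP y; apply/idP/idP => h; apply: ple_trans h _. Qed.

Lemma leU_barl x y : leU (barU x) y = ple (pbar (c x)) (c y).
Proof. by have [h1 h2] := barUP x; apply/idP/idP => h; apply: ple_trans h. Qed.

Lemma leU_bar x y : leU (barU x) (barU y) = leU y x.
Proof.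
rewrite leU_barl; have [h1 h2] := barUP y; rewrite /leU -[ple (c y) _]ple_bar.
by apply/idP/idP => h; apply: ple_trans h _.
Qed.

Lemma leU_barF x : leU x (barU x) = false.
Proof. by rewrite leU_barr ple_barF. Qed.

Lemma barUK : involutive barU.
Proof.
move=> x; apply: leU_anti; first by rewrite leU_barl -ple_bar pbarK; case: (barUP x).
by rewrite leU_barr -ple_bar pbarK; case: (barUP x).
Qed.

Definition completion : rel U := fun x y => ~~ ple (c x) (pbar (c y)).

Lemma completionE : completion =2 meets leU barU.
Proof. by move=> x y; rewrite /completion /meets /apart leU_barr. Qed.

Lemma completion_rel : completion = meets leU barU.
Proof. by apply/funext => x; apply/funext => y; apply: completionE. Qed.

Variable f : S -> U.
Hypothesis cf : forall u, c (f u) = (u, false).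

Lemma completion_completes : completes g completion f.
Proof.
have lef u v : leU (f u) (f v) = (nbhd g u \subset nbhd g v).
  by rewrite /leU !cf.
have adj u v : meets leU barU (f u) (f v) = g u v.
  by rewrite -completionE /completion !cf /ple /= negbK.
have incl u v : inclusion_edge (meets leU barU) (f u) (f v) = inclusion_edge g u v.
  rewrite (inclusionE leU_refl leU_trans barUK leU_bar leU_barF) !lef /inclusion_edge.
  case: gG => gr gs; apply/idP/andP => [h|[]//]; split=> //.
  case/orP: h => /subsetP h; first by have := h u; rewrite !inE gr gs; apply.
  by have := h v; rewrite !inE gr; apply.
have span u v : spanning_pair (meets leU barU) (f u) (f v) = spanning_pair g u v.
  by rewrite (spanningE leU_refl leU_trans barUK leU_bar) leU_barl !cf.
have ov u v : overlap (meets leU barU) (f u) (f v) = overlap g u v.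
  by rewrite /overlap adj incl.
rewrite completion_rel; split.
- exact: (meets_graph barUK leU_bar leU_barF).
- move=> x; exists (barU x).
  by rewrite (circularE leU_refl leU_anti leU_trans barUK leU_bar).
- by move=> u v e; have := cf u; rewrite e cf => -[].
- exact: adj.
- by move=> u v; rewrite /one_overlap /two_overlap !ov !span incl.
Qed.

(** [U] injects into any completion by choosing partners there. A vertex without partner in [g] has
    its chosen partner outside the image of [f'], and vertices with a common partner are twins, by
    the spanning condition at that partner. *)
Lemma completion_minimal (U' : finType) (H' : rel U') (f' : S -> U') :
  completes g H' f' -> #|U| <= #|U'|.
Proof.
case=> -[Hr Hs] Hc f'_inj fH _.
have sub u v : nbhd H' (f' u) \subset nbhd H' (f' v) -> nbhd g u \subset nbhd g v.
  by move=> /subsetP h; apply/subsetP => w; have := h (f' w); rewrite !inE !fH.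
have circ u v : circular_pair H' (f' u) (f' v) -> circular_pair g u v.
  rewrite /circular_pair fH => /andP[-> /spanningP[h1 h2]] /=.
  by apply/spanningP; split=> x hx; apply: sub; [apply: h1|apply: h2]; rewrite fH.
pose p u := xchoose (Hc (f' u)).
have pP u : circular_pair H' (f' u) (p u) := xchooseP (Hc (f' u)).
pose h x := if (c x).2 then p (c x).1 else f' (c x).1.
suff h_inj : injective h by rewrite -(card_codom h_inj) max_card.
have pf x v : (c x).2 -> p (c x).1 != f' v.
  move=> cx; apply/eqP => e; have [ct _] := c_true (c x).1; apply: ct.
    by exists x; case: (c x) cx => u [].
  by exists v; apply: circ; rewrite -e.
have half u v : p u = p v -> nbhd H' (f' u) \subset nbhd H' (f' v).
  move=> e; have /andP[n _] := pP u; have /andP[_ /spanningP[h1 h2]] := pP v.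
  by apply: h1; rewrite -e Hs.
move=> x y; rewrite /h; case: ifPn => hx; case: ifPn => hy e.
- apply: c_inj; suff : (c x).1 = (c y).1 by case: (c x) (c y) hx hy => u [] [v []] //= _ _ ->.
  by apply: twin_free; rewrite /true_twins eqEsubset !sub // half.
- by move: (pf x (c y).1 hx); rewrite e eqxx.
- by move: (pf y (c x).1 hy); rewrite e eqxx.
apply: c_inj; case: (c x) (c y) hx hy e => u [] // [v []] //= _ _ /f'_inj -> //.
Qed.

Lemma completion_circular : circular_completion g completion f.
Proof. by split; [apply: completion_completes|apply: completion_minimal]. Qed.

End Completion.

(** * Tight representations *)

Section Tight.

Import Order.TTheory GRing.Theory Num.Theory.
Local Open Scope ring_scope.

Variable R : realType.

Lemma represents_adj (T : finType) (G : rel T) (a b : T -> R) u v :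
  represents G a b ->
  (G u v <-> exists k : int, a u <= b v + k%:~R /\ a v + k%:~R <= b u).
Proof.
move=> [ab h]; rewrite h; have [au _] := andP (ab u); have [av _] := andP (ab v); split.
  move=> [p [[i /andP[i1 i2]] [j /andP[j1 j2]]]]; exists (i - j).
  by rewrite intrB; split; lra.
move=> [k [k1 k2]]; case: (lerP (a u) (a v + k%:~R)) => c.
  by exists (a v + k%:~R); split; [exists 0|exists (- k)]; rewrite ?mulrNz; apply/andP; split; lra.
by exists (a u); split; [exists 0|exists (- k)]; rewrite ?mulrNz; apply/andP; split; lra.
Qed.

Lemma ex_max (T : finType) (P : pred T) (F : T -> R) :
  (exists x, P x) -> exists2 x, P x & forall y, P y -> F y <= F x.
Proof.
move=> [x0 Px0]; case: (@Order.TotalTheory.arg_maxP _ _ _ x0 P F Px0) => x Px h.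
by exists x.
Qed.

Lemma ex_below (x y : R) : exists k : int, x + k%:~R < y <= x + k%:~R + 1.
Proof.
exists (Num.ceil (y - x) - 1); have := ceil_itv (y - x).
rewrite intrB => /andP[h1 h2]; apply/andP; split; lra.
Qed.

(* Open arcs in which every end is an end of a non-neighbour: this makes
   neighbourhood inclusion coincide with inclusion of arcs. *)
Record tight (T : finType) (G : rel T) (beta rho : T -> R) : Prop := Tight {
  tight_len : forall u, beta u < rho u < beta u + 1;
  tight_adj : forall u v, G u v <->
    exists k : int, beta u < rho v + k%:~R /\ beta v + k%:~R < rho u;
  tight_left : forall u, exists w (k : int), ~~ G u w /\ rho w + k%:~R = beta u;
  tight_right : forall u, exists w (k : int), ~~ G u w /\ beta w + k%:~R = rho u }.

Lemma int_shift (k : int) : k%:~R <= -1 :> R \/ k = 0 \/ 1 <= k%:~R :> R.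
Proof.
have [h|[h|h]] : (k <= -1 \/ k = 0 \/ 1 <= k)%R by lia.
- by left; rewrite -(mulrN1z 1) ler_int.
- by right; left.
- by right; right; rewrite -(mulr1z 1) ler_int.
Qed.

(** Left ends are pulled back to the last right end of a non-neighbour; afterwards right ends are
    pushed forward to the first new left end of a non-neighbour. Done in this order, the second
    change does not spoil the first. *)
Lemma represents_tight (T : finType) (G : rel T) (a b : T -> R) :
  graph G -> (forall u, ~~ universal G u) -> represents G a b ->
  exists beta rho, tight G beta rho.
Proof.
move=> [Gr Gs] nu rep; have adj u v := represents_adj u v rep.
have [ab _] := rep.
have nadj u v (k : int) : ~~ G u v -> b v + k%:~R < a u \/ b u < a v + k%:~R.
  move=> n; case: (ltrP (b v + k%:~R) (a u)) => h1; first by left.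
  case: (ltrP (b u) (a v + k%:~R)) => h2; first by right.
  by case/negP: n; apply/adj; exists k.
have nuE u : exists w, ~~ G u w.
  by have := nu u; rewrite /universal negb_forall => /existsP.
have P1 u : exists p : T * int, [/\ ~~ G u p.1, b p.1 + p.2%:~R < a u &
    forall w (k : int), ~~ G u w -> b w + k%:~R < a u -> b w + k%:~R <= b p.1 + p.2%:~R].
  have [kap kapP] := choice (fun w => ex_below (b w) (a u)).
  have [w nw wm] := ex_max (fun w => b w + (kap w)%:~R) (nuE u).
  exists (w, kap w); split=> //=; first by case/andP: (kapP w).
  move=> w' k nw' h; apply: le_trans (wm _ nw'); have /andP[h1 h2] := kapP w'.
  have [h3|h3] : k <= kap w' \/ kap w' + 1 <= k by lia.
    by rewrite lerD2l ler_int.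
  have : (kap w' + 1)%:~R <= k%:~R :> R by rewrite ler_int.
  by rewrite intrD; lra.
have [pre preP] := choice P1.
pose beta u := b (pre u).1 + (pre u).2%:~R.
have beta_lt u : beta u < a u by case: (preP u).
(* One turn later, the non-neighbour at which [u] stops would either be a nearer stop or begin only
   after [u] has ended. *)
have beta_gt u : b u < beta u + 1.
  have [n h _] := preP u; rewrite /beta; case: (nadj _ _ ((pre u).2 + 1) n).
    rewrite intrD => h'; have /andP[h1 h2] := ab u.
    have /andP[h3 h4] := ab (pre u).1.
    case: (nadj _ _ ((pre u).2 + 1) n); rewrite intrD => h5; last by lra.
    have [_ _ /(_ _ ((pre u).2 + 1) n)] := preP u; rewrite intrD => /(_ h5).
    by rewrite /=; lra.
  by rewrite intrD; have /andP[] := ab (pre u).1; lra.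
have beta_max u w (k : int) : ~~ G u w -> b w + k%:~R < a u -> b w + k%:~R <= beta u.
  by move=> n h; case: (preP u) => _ _; apply.
have P2 u : exists p : T * int, [/\ ~~ G u p.1, b u <= beta p.1 + p.2%:~R &
    forall w (k : int), ~~ G u w -> b u <= beta w + k%:~R -> beta p.1 + p.2%:~R <= beta w + k%:~R].
  have [kap kapP] := choice (fun w => ex_below (beta w) (b u)).
  have [w nw wm] := ex_max (fun w => - (beta w + (kap w)%:~R)) (nuE u).
  exists (w, kap w + 1); split=> //=; first by rewrite intrD; have /andP[] := kapP w; lra.
  move=> w' k nw' h; have := wm _ nw'; have /andP[h1 h2] := kapP w'.
  have [h3|h3] : k <= kap w' \/ kap w' + 1 <= k by lia.
    have : k%:~R <= (kap w')%:~R :> R by rewrite ler_int.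
    by lra.
  have : (kap w' + 1)%:~R <= k%:~R :> R by rewrite ler_int.
  by rewrite !intrD; lra.
have [nxt nxtP] := choice P2.
pose rho u := beta (nxt u).1 + (nxt u).2%:~R.
have rho_ge u : b u <= rho u by case: (nxtP u).
have rho_min u w (k : int) : ~~ G u w -> b u <= beta w + k%:~R -> rho u <= beta w + k%:~R.
  by move=> n h; case: (nxtP u) => _ _; apply.
have sep u w (k : int) : ~~ G u w -> rho u <= beta w + k%:~R \/ rho w + k%:~R <= beta u.
  move=> n; have n' : ~~ G w u by rewrite Gs.
  have aux x y (j : int) : ~~ G x y -> ~~ G y x -> b x < a y + j%:~R -> rho x <= beta y + j%:~R.
    move=> nxy nyx h; apply: rho_min => //.
    have := beta_max y x (- j) nyx; rewrite mulrNz => hm; have := hm ltac:(lra); lra.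
  case: (nadj _ _ k n) => h; last by left; apply: aux.
  right; have := aux w u (- k) n' n; rewrite mulrNz => hm; have := hm ltac:(lra); lra.
(* The non-neighbour that stops [u] on the left already ended there, and its right end cannot be
   pushed beyond the new left end of [u]. *)
have left_tight u : rho (pre u).1 + (pre u).2%:~R = beta u.
  have [n h _] := preP u; apply/eqP; rewrite eq_le; apply/andP; split.
    have n' : ~~ G (pre u).1 u by rewrite Gs.
    have := rho_min _ u (- (pre u).2) n'; rewrite mulrNz => hm.
    by have := hm ltac:(rewrite /beta; lra); lra.
  by have := rho_ge (pre u).1; rewrite /beta; lra.
exists beta, rho; split.
- move=> u; apply/andP; split; first by have := beta_lt u; have := rho_ge u; have /andP[] := ab u; lra.
  have [n h _] := preP u; have n' : ~~ G (pre u).1 u by rewrite Gs.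
  have := sep u (pre u).1 ((pre u).2 + 1) n; have := left_tight u.
  have := beta_lt (pre u).1; have /andP[] := ab (pre u).1.
  have := beta_gt u; have := rho_ge u; have := beta_lt u.
  rewrite intrD /beta => h1 h2 h3 h4 h5 h6 h7 [] h8; last by lra.
  by lra.
- move=> u v; split.
    move=> /adj[k [k1 k2]]; exists k; have := rho_ge u; have := rho_ge v.
    by have := beta_lt u; have := beta_lt v; lra.
  by move=> [k [k1 k2]]; apply/negPn/negP => n; case: (sep u v k n); lra.
- by move=> u; exists (pre u).1, (pre u).2; split; [case: (preP u)|apply: left_tight].
by move=> u; exists (nxt u).1, (nxt u).2; split; [case: (nxtP u)|].
Qed.

Section TightOrder.

Variables (S : finType) (g : rel S) (beta rho : S -> R).
Hypothesis gG : graph g.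
Hypothesis gT : tight g beta rho.

(* [(u, true)] gets the complementary arc of [u]. *)
Definition lend (x : S * bool) : R := if x.2 then rho x.1 else beta x.1.
Definition rend (x : S * bool) : R := if x.2 then beta x.1 + 1 else rho x.1.
Definition cle (x y : S * bool) : Prop :=
  exists k : int, lend y <= lend x + k%:~R /\ rend x + k%:~R <= rend y.

Lemma ends_len x : lend x < rend x < lend x + 1.
Proof.
by case: x => u [] /=; rewrite /lend /rend /=; have /andP[h1 h2] := tight_len gT u;
  apply/andP; split; lra.
Qed.

Lemma cle_trans x y w : cle x y -> cle y w -> cle x w.
Proof.
by move=> [i [i1 i2]] [j [j1 j2]]; exists (i + j); rewrite intrD; split; lra.
Qed.

Lemma cle_bar x y : cle x y -> cle (pbar y) (pbar x).
Proof.
case: x y => u b [v b']; rewrite /cle /lend /rend /pbar /=.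
case: b; case: b' => /= -[k [k1 k2]].
- by exists (- k); rewrite mulrNz; split; lra.
- by exists (- k - 1); rewrite intrB mulrNz; split; lra.
- by exists (1 - k); rewrite intrB; split; lra.
- by exists (- k); rewrite mulrNz; split; lra.
Qed.

Lemma cle_adj u v : cle (u, false) (v, true) <-> ~~ g u v.
Proof.
rewrite /cle /lend /rend /=; split=> [[k [k1 k2]]|n].
  apply/negP => /(tight_adj gT)[j [j1 j2]].
  have [h|h] : j + 1 <= - k + 1 \/ - k + 1 <= j by lia.
    have : (j + 1)%:~R <= (- k + 1)%:~R :> R by rewrite ler_int.
    by rewrite !intrD mulrNz; lra.
  have : (- k + 1)%:~R <= j%:~R :> R by rewrite ler_int.
  by rewrite intrD mulrNz; lra.
have [k /andP[h1 h2]] := ex_below (beta u) (rho v).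
exists (k + 1); rewrite intrD; split; first by lra.
rewrite leNgt; apply/negP => h3; case/negP: n; apply/(tight_adj gT).
by exists (- k); rewrite mulrNz; split; lra.
Qed.

(** If the arc of [u] stuck out of that of [v] at one end, the non-neighbour of [v] whose arc stops
    there, given by tightness, would meet [u]. *)
Lemma cle_sub u v : cle (u, false) (v, false) <-> nbhd g u \subset nbhd g v.
Proof.
case: gG => gr gs; split=> [h|/subsetP h].
  apply/subsetP => w; rewrite !inE; apply: contraTT.
  by move=> /cle_adj h'; apply/cle_adj; apply: cle_trans h'.
have /(tight_adj gT)[k [k1 k2]] : g u v by have := h u; rewrite !inE gr gs; apply.
exists (- k); rewrite /lend /rend /= mulrNz; split; rewrite leNgt; apply/negP => hk.
  have [w [j [n e]]] := tight_left gT v.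
  have := h w; rewrite !inE (negbTE n) => /(_ _)/notF; apply.
  apply/(tight_adj gT); exists (j + k); rewrite intrD.
  by have /andP[] := tight_len gT w; split; lra.
have [w [j [n e]]] := tight_right gT v.
have := h w; rewrite !inE (negbTE n) => /(_ _)/notF; apply.
apply/(tight_adj gT); exists (j + k); rewrite intrD.
by have /andP[] := tight_len gT w; split; lra.
Qed.

(** The arc that stops [u] on the right is contained in [v], so [v] starts in time. If [v] ended
    before the next left end of [u], the arc stopping [v] would be contained in [u], and no whole
    number of turns is compatible with these positions. *)
Lemma cle_spanning u v : cle (u, true) (v, false) <-> spanning_pair g u v.
Proof.
case: gG => gr gs; split=> [h|/spanningP[h1 h2]].
  apply/spanningP; split=> w hw; apply/cle_sub.
    rewrite gs in hw; move/cle_adj: hw => hw; apply: cle_trans hw _.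
    by have := cle_bar h.
  by rewrite gs in hw; move/cle_adj: hw => hw; apply: cle_trans hw _.
have [w [k [n e]]] := tight_right gT u.
have /cle_sub[j [j1 j2]] := h2 w n; rewrite /lend /rend /= in j1 j2.
exists (j - k); rewrite /lend /rend /= intrB; split; first by lra.
rewrite leNgt; apply/negP => lt.
have [y [i [ny ey]]] := tight_right gT v.
have /cle_sub[m [m1 m2]] := h1 y ny; rewrite /lend /rend /= in m1 m2.
have /andP[w1 w2] := tight_len gT w.
have /andP[y1 y2] := tight_len gT y.
have /andP[u1 u2] := tight_len gT u.
case: (int_shift (m - i + j - k)) => [|[]] hm.
- by move: hm; rewrite !(intrD, intrB); lra.
- have : (m - i + j - k)%:~R = 0 :> R by rewrite hm.
  by rewrite !(intrD, intrB); lra.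
- by move: hm; rewrite !(intrD, intrB); lra.
Qed.

Lemma cleP x y : ple g x y <-> cle x y.
Proof.
case: x y => u [] [v []]; rewrite /ple /=.
- by rewrite -cle_sub; split=> /cle_bar.
- by rewrite cle_spanning.
- by rewrite cle_adj.
- by rewrite cle_sub.
Qed.

End TightOrder.

End Tight.

(** * Invertible pairs obstruct representations *)

Section Soundness.

Import Order.TTheory GRing.Theory Num.Theory.
Local Open Scope ring_scope.

Variables (R : realType) (U : finType) (le : rel U) (bar : U -> U) (z : U).
Variables (L E : U -> R).
Hypothesis len : forall x, L x < E x < L x + 1.
Hypothesis leP : forall x y, le x y <->
  exists k : int, L y <= L x + k%:~R /\ E x + k%:~R <= E y.
Hypothesis djP : forall x y, apart le bar x y <->
  exists k : int, E y <= L x + k%:~R /\ E x + k%:~R <= L y + 1.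
Hypothesis barK : involutive bar.
Hypothesis le_bar : forall x y, le (bar x) (bar y) = le y x.

Local Notation ni := (incomparable le).
Local Notation dj := (apart le bar).

(** This is the cut of the circle at [z]. Shift the left end of [x] into the turn that starts at the
    left end of [z]: a right end outside the corresponding turn would make [x] comparable to a
    translate of [z]. *)
Lemma lift_ex x : exists k : int, ni z x ->
  [/\ L z < L x + k%:~R, L x + k%:~R < L z + 1, E z < E x + k%:~R & E x + k%:~R < E z + 1].
Proof.
have [k /andP[k1 k2]] := ex_below (- L x) (- L z).
have /andP[z1 z2] := len z; have /andP[x1 x2] := len x.
have [k' /andP[k'1 k'2]] := ex_below (L z) (L x).
exists (- k') => /andP[n1 n2]; rewrite mulrNz.
have nle (j : int) : L x <= L z + j%:~R -> E z + j%:~R <= E x -> False.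
  by move=> h1 h2; case/negP: n1; apply/leP; exists j.
have nge (j : int) : L z <= L x + j%:~R -> E x + j%:~R <= E z -> False.
  by move=> h1 h2; case/negP: n2; apply/leP; exists j.
have h1 : L x != L z + k'%:~R + 1.
  apply/eqP => e; case: (lerP (E x) (E z + k'%:~R + 1)) => h.
    by apply: (nge (- k' - 1)); rewrite intrB mulrNz; lra.
  by apply: (nle (k' + 1)); rewrite intrD; lra.
move: h1; rewrite neq_lt => /orP[] h1; last by lra.
split; [lra|lra| |]; rewrite ltNge; apply/negP => h.
  by apply: (nge (- k')); rewrite mulrNz; lra.
by apply: (nle (k' + 1)); rewrite intrD; lra.
Qed.

Lemma no_invertible x y : star (moveZ le bar z) (x, y) (y, x) -> free_pair le z x y -> False.
Proof.
have [kap kapP] := choice lift_ex.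
pose l x := L x + (kap x)%:~R; pose r x := E x + (kap x)%:~R.
have lr x' : ni z x' -> [/\ L z < l x', l x' < L z + 1, E z < r x' & r x' < E z + 1].
  by move/kapP.
have /andP[z1 z2] := len z.
have lenl x' : l x' < r x' < l x' + 1.
  by have /andP[h1 h2] := len x'; rewrite /l /r; apply/andP; split; lra.
have lel x' y' : ni z x' -> ni z y' -> le x' y' <-> l y' <= l x' /\ r x' <= r y'.
  move=> /lr[a1 a2 a3 a4] /lr[b1 b2 b3 b4]; rewrite leP; split; last first.
    by move=> [h1 h2]; exists (kap x' - kap y'); move: h1 h2; rewrite /l /r intrB; split; lra.
  move=> [k [k1 k2]]; have := int_shift R (k - kap x' + kap y').
  rewrite !(intrD, intrB) mulrNz => -[h|[h|h]].
  - by exfalso; move: a1 a2 a3 a4 b1 b2 b3 b4; rewrite /l /r; lra.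
  - have : (k - kap x' + kap y')%:~R = 0 :> R by rewrite h.
    by rewrite !(intrD, intrB) mulrNz /l /r; lra.
  - by exfalso; move: a1 a2 a3 a4 b1 b2 b3 b4; rewrite /l /r; lra.
(* Both lifts start within one turn after the left end of [z], so only the shifts by 0 and by 1 turn
   are left. *)
have djl x' y' : ni z x' -> ni z y' -> dj x' y' <->
    (r y' <= l x' /\ r x' <= l y' + 1) \/ (r x' <= l y' /\ r y' <= l x' + 1).
  move=> /lr[a1 a2 a3 a4] /lr[b1 b2 b3 b4].
  have /andP[c1 c2] := lenl x'; have /andP[d1 d2] := lenl y'.
  rewrite djP; split; last first.
    case=> -[h1 h2].
      by exists (kap x' - kap y'); move: h1 h2; rewrite /l /r intrB; split; lra.
    by exists (kap x' - kap y' + 1); move: h1 h2; rewrite /l /r intrD intrB; split; lra.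
  move=> [k [k1 k2]]; have [h|[h|h]] := int_shift R (k - kap x' + kap y').
  - exfalso; move: h a1 a2 a3 a4 b1 b2 b3 b4 c1 c2 d1 d2.
    by rewrite !(intrD, intrB) mulrNz /l /r; lra.
  - left; have : (k - kap x' + kap y')%:~R = 0 :> R by rewrite h.
    by rewrite !(intrD, intrB) mulrNz /l /r; lra.
  have [h'|[h'|h']] := int_shift R (k - kap x' + kap y' - 1).
  - have : (1 : R) <= 0.
      by move: h h'; rewrite !(intrD, intrB) mulrNz; lra.
    by rewrite ler10.
  - right; have : (k - kap x' + kap y' - 1)%:~R = 0 :> R by rewrite h'.
    by rewrite !(intrD, intrB) mulrNz /l /r; lra.
  exfalso; move: h h' a1 a2 a3 a4 b1 b2 b3 b4 c1 c2 d1 d2.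
  by rewrite !(intrD, intrB) mulrNz /l /r; lra.
have djz x' : ni z x' -> dj z x' -> E z <= l x' /\ r x' <= L z + 1.
  move=> /lr[a1 a2 a3 a4]; rewrite djP => -[k [k1 k2]].
  have [h|[h|h]] := int_shift R (k + kap x').
  - by exfalso; move: h a1 a2 a3 a4; rewrite intrD /l /r; have /andP[] := len x'; lra.
  - exfalso; have : (k + kap x')%:~R = 0 :> R by rewrite h.
    by move: a1 a2 a3 a4; rewrite intrD /l /r; have /andP[] := len x'; lra.
  have [h'|[h'|h']] := int_shift R (k + kap x' - 1).
  - have : (1 : R) <= 0.
      by move: h h'; rewrite !(intrD, intrB); lra.
    by rewrite ler10.
  - have : (k + kap x' - 1)%:~R = 0 :> R by rewrite h'.
    by rewrite !(intrD, intrB) /l /r; lra.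
  by exfalso; move: h' a1 a2 a3 a4; rewrite !(intrD, intrB) /l /r; have /andP[] := len x'; lra.
have nil x' y' : ni z x' -> ni z y' -> ni x' y' -> l x' <= l y' -> l x' < l y' /\ r x' < r y'.
  move=> vx vy /andP[n1 n2] h.
  have h1 : ~~ (r y' <= r x') by apply: contra n2 => h2; apply/lel.
  split; last by rewrite ltNge.
  rewrite lt_neqAle h andbT; apply: contra n1 => /eqP e; apply/lel => //.
  by rewrite e lexx; split=> //; move: h1; rewrite -ltNge => /ltW.
(* With [y2] before [x'] before [y1], the condition at [x'] makes [y2] end before [y1] begins, and
   the condition at [z] makes [y1] end before the next turn of [y2]. So the two are disjoint,
   against [nd]. *)
have stepm x' y1 y2 : free_pair le z x' y1 -> free_pair le z x' y2 ->
    ~~ dj y1 y2 -> (ni y1 y2 -> (dj x' y1 || dj x' y2) && (dj z y1 || dj z y2)) ->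
    l x' <= l y1 -> l y2 <= l x' -> False.
  move=> /and3P[vx v1 n1] /and3P[_ v2 n2] nd h h1 h2.
  have [p1 p2] := nil _ _ vx v1 n1 h1.
  have n2' : ni y2 x' by rewrite ni_sym.
  have [q1 q2] := nil _ _ v2 vx n2' h2.
  have nn : ni y1 y2.
    apply/andP; split; apply/negP => /lel; move=> /(_ _ _)[]//; lra.
  have /andP[hx hz] := h nn; have [a1 a2 a3 a4] := lr _ v1; have [b1 b2 b3 b4] := lr _ v2.
  have hx' : l y2 < r y1 /\ (r y1 <= l x' + 1 /\ r x' <= l y1 \/ r y2 <= l x' /\ r x' <= l y2 + 1).
    have /andP[c1 c2] := lenl y1; split; first by lra.
    have /andP[d1 d2] := lenl x'; have /andP[e1 e2] := lenl y2.
    by case/orP: hx => /djl; move=> /(_ vx)[] // []; [left|left|right|right]; lra.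
  have hz' : r y1 <= l y2 + 1.
    by case/orP: hz => /djz; [move=> /(_ v1)[]|move=> /(_ v2)[]]; lra.
  case/negP: nd; apply/djl => //; left; split; last by lra.
  by case: hx' => _ []; lra.
have inv p q : moveZ le bar z p q -> l p.1 <= l p.2 -> l q.1 <= l q.2.
  case: p q => [x1 y1] [x2 y2] /= [/= f1 [/= f2 m]] h1.
  rewrite leNgt; apply/negP => /ltW h2.
  case: m => [[e [d h]]|[e [d h]]]; subst; first exact: (stepm x2 y1 y2).
  apply: (stepm y2 x2 x1); rewrite 1?free_pair_sym //; first by rewrite (dj_sym barK le_bar).
  by move=> nn; rewrite orbC (orbC (dj z _)) h // ni_sym.
have invs p q : star (moveZ le bar z) p q -> l p.1 <= l p.2 -> l q.1 <= l q.2.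
  by elim=> // {}p q1 q2 _ IH m /IH; apply: inv.
move=> s /and3P[vx vy n].
have s' := star_sym (@moveZ_sym _ _ _ z barK le_bar) s.
have i1 := invs _ _ s; have i2 := invs _ _ s'; rewrite /= in i1 i2.
have h : l x <= l y by rewrite leNgt; apply/negP => c; have := i2 (ltW c); rewrite leNgt c.
by have [h' _] := nil _ _ vx vy n h; have := i1 h; rewrite leNgt h'.
Qed.

End Soundness.

(** * Building arcs from endpoint orders *)

(** All ends will be below [2 * L], which excludes shifts by two turns or more. *)
Definition arcs_meet (L : nat) (p q : nat * nat) : bool :=
  [|| (p.1 <= q.2) && (q.1 <= p.2), (p.1 <= q.2 + L) && (q.1 + L <= p.2)
    | (p.1 + L <= q.2) && (q.1 <= p.2 + L)].

Section Discrete.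

Import Order.TTheory GRing.Theory Num.Theory.

Variables (R : realType) (T : finType) (G : rel T) (L : nat) (s t : T -> nat).
Hypothesis L0 : 0 < L.
Hypothesis arcs : forall u, s u < t u < s u + L.
Hypothesis small : forall u, t u < 2 * L.
Hypothesis adj : forall u v, G u v = arcs_meet L (s u, t u) (s v, t v).

Lemma discrete_represents :
  represents G (fun u => (s u)%:R / L%:R : R)%R (fun u => (t u)%:R / L%:R : R)%R.
Proof.
have Lp : (0 < L%:R :> R)%R by rewrite ltr0n.
split=> [u|u v].
  have /andP[h1 h2] := arcs u; rewrite ltr_pM2r ?invr_gt0 // ltr_nat h1 /=.
  by rewrite -[X in (_ < _ + X)%R](divff (lt0r_neq0 Lp)) -mulrDl ltr_pM2r ?invr_gt0 // -natrD ltr_nat.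
rewrite adj; split.
  have aux (k : int) : ((s u)%:R <= (t v)%:R + k%:~R * L%:R :> R)%R ->
      ((s v)%:R + k%:~R * L%:R <= (t u)%:R :> R)%R ->
      exists p : R, Defs.arc ((s u)%:R / L%:R)%R ((t u)%:R / L%:R)%R p /\
                Defs.arc ((s v)%:R / L%:R)%R ((t v)%:R / L%:R)%R p.
    move=> h1 h2; have [hu1 hu2] := andP (arcs u); have [hv1 hv2] := andP (arcs v).
    have e w (j : int) : (w / L%:R + j%:~R = (w + j%:~R * L%:R) / L%:R :> R)%R.
      by rewrite mulrDl mulfK // lt0r_neq0.
    have [c|c] := lerP ((s u)%:R : R)%R ((s v)%:R + k%:~R * L%:R)%R.
      exists (((s v)%:R + k%:~R * L%:R) / L%:R)%R; split; [exists 0%R|exists (- k)%R].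
        by rewrite addr0 !ler_pM2r ?invr_gt0 // c h2.
      rewrite e mulrNz mulNr addrK !ler_pM2r ?invr_gt0 // lexx /=.
      by rewrite ler_nat ltnW.
    exists ((s u)%:R / L%:R)%R; split; [exists 0%R|exists (- k)%R].
      by rewrite addr0 !ler_pM2r ?invr_gt0 // lexx ler_nat ltnW.
    rewrite e mulrNz mulNr !ler_pM2r ?invr_gt0 //.
    by apply/andP; split; move: c h1; lra.
  case/or3P=> /andP[h1 h2].
  - by apply: (aux 0%R); rewrite mul0r addr0 ler_nat.
  - by apply: (aux 1%R); rewrite mul1r -natrD ler_nat.
  - by apply: (aux (- 1)%R); rewrite mulN1r ?lerBrDr ?lerBlDr -?natrD ler_nat // addnC.
move=> [p [[i /andP[i1 i2]] [j /andP[j1 j2]]]].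
have mo x y : (x / L%:R <= y -> x <= y * L%:R :> R)%R by rewrite ler_pdivrMr.
have om x y : (y <= x / L%:R -> y * L%:R <= x :> R)%R by rewrite ler_pdivlMr.
move: i1 i2 j1 j2 => /mo i1 /om i2 /mo j1 /om j2.
have Z n : (n%:R = (n%:Z)%:~R :> R)%R by [].
have h1 : ((s u)%:Z <= (t v)%:Z + (i - j) * L%:Z)%R.
  by rewrite -(ler_int R) intrD intrM intrB -!Z; lra.
have h2 : ((s v)%:Z + (i - j) * L%:Z <= (t u)%:Z)%R.
  by rewrite -(ler_int R) intrD intrM intrB -!Z; lra.
have hu := small u; have hv := small v; rewrite /arcs_meet /=.
have [c|[c|[c|[c|c]]]] : (i - j <= -2 \/ i - j = -1 \/ i - j = 0 \/ i - j = 1 \/ 2 <= i - j)%R by lia.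
- have : ((i - j) * L%:Z <= - 2 * L%:Z)%R by rewrite ler_wpM2r.
  by clear -h1 hv; lia.
- by move: h1 h2; rewrite c; clear; lia.
- by move: h1 h2; rewrite c; clear; lia.
- by move: h1 h2; rewrite c; clear; lia.
have : (2 * L%:Z <= (i - j) * L%:Z)%R by rewrite ler_wpM2r.
by clear -h2 hu; lia.
Qed.

End Discrete.

Section FlippedIntervals.

Variables (U : finType) (le : rel U) (bar : U -> U) (W : pred U) (l r : U -> nat) (L : nat).
Hypothesis lexx : reflexive le.
Hypothesis barK : involutive bar.
Hypothesis le_bar : forall x y, le (bar x) (bar y) = le y x.
Hypothesis le_barF : forall x, le x (bar x) = false.
Hypothesis W_bar : forall x, ~~ W x -> W (bar x).
Hypothesis W_cover : forall x y, W x -> W y -> le (bar x) y = false.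
Hypothesis bound : forall x, 2 * r x + 2 < L.
Hypothesis order : forall x y, W x -> W y ->
  [/\ l x < r x,
      le x y -> x != y -> l y < l x /\ r x < r y,
      apart le bar x y -> r x < l y \/ r y < l x
    & incomparable le x y -> ~~ apart le bar x y ->
      [/\ l x < l y, l y < r x & r x < r y] \/
      [/\ l y < l x, l x < r y & r y < r x]].

(* Even ends for [W], odd ends for the complements: no new contact arises. *)
Definition flipped_arc (x : U) : nat * nat :=
  if W x then (2 * l x, 2 * r x) else (2 * r (bar x) + 1, 2 * l (bar x) + L - 1).

Lemma flipped_arc_len x :
  (flipped_arc x).1 < (flipped_arc x).2 < (flipped_arc x).1 + L /\
  (flipped_arc x).2 < 2 * L.
Proof.
rewrite /flipped_arc; case: ifPn => [Wx|/W_bar Wx] /=.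
  by have [h _ _ _] := order Wx Wx; have := bound x; clear -h; lia.
by have [h _ _ _] := order Wx Wx; have := bound (bar x); clear -h; lia.
Qed.

Lemma arcs_meet_sym p q : arcs_meet L p q = arcs_meet L q p.
Proof. by rewrite /arcs_meet; clear; lia. Qed.

(** Two complements share the points beyond the last end of an interval, and [W_cover] says that the
    corresponding vertices meet. *)
Lemma flipped_arc_meets x y :
  meets le bar x y = arcs_meet L (flipped_arc x) (flipped_arc y).
Proof.
(* An interval misses the complement of another exactly when it is contained in that other one; the
   odd ends open a gap where the ends of a vertex and its partner would touch. *)
have mixed a w : W a -> W w -> meets le bar a (bar w) =
    arcs_meet L (2 * l a, 2 * r a) (2 * r w + 1, 2 * l w + L - 1).
  move=> Wa Ww; rewrite /meets dj_barr // /arcs_meet /=.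
  have [h1 h2 h3 h4] := order Wa Ww; have [g1 g2 _ _] := order Ww Wa.
  have b1 := bound a; have b2 := bound w.
  have [e|ne] := eqVneq a w; first by subst w; rewrite lexx; clear -h1 b1; lia.
  have [aw|aw] := boolP (le a w); first by have [i1 i2] := h2 aw ne; clear -h1 g1 i1 i2 b1 b2; lia.
  have [wa|wa] := boolP (le w a).
    by rewrite eq_sym in ne; have [i1 i2] := g2 wa ne; clear -h1 g1 i1 i2 b1 b2; lia.
  have n : incomparable le a w by rewrite /incomparable aw wa.
  have [/h3 i|/(h4 n) i] := boolP (apart le bar a w); last first.
    by case: i => -[i1 i2 i3]; clear -h1 g1 i1 i2 i3 b1 b2; lia.
  by clear -h1 g1 i b1 b2; lia.
have ms a b : meets le bar a b = meets le bar b a by rewrite /meets dj_sym.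
rewrite /flipped_arc; case: ifPn => [Wx|Wx]; case: ifPn => [Wy|Wy].
- rewrite /meets /arcs_meet /=; have [h1 h2 h3 h4] := order Wx Wy; have [g1 g2 _ _] := order Wy Wx.
  have b1 := bound x; have b2 := bound y.
  have [e|ne] := eqVneq x y; first by subst y; rewrite /apart le_barF; clear -h1 b1; lia.
  have [/h3 i|d] := boolP (apart le bar x y); first by clear -h1 g1 i b1 b2; lia.
  have [aw|aw] := boolP (le x y); first by have [i1 i2] := h2 aw ne; clear -h1 g1 i1 i2 b1 b2; lia.
  have [wa|wa] := boolP (le y x).
    by rewrite eq_sym in ne; have [i1 i2] := g2 wa ne; clear -h1 g1 i1 i2 b1 b2; lia.
  have n : incomparable le x y by rewrite /incomparable aw wa.
  by case: (h4 n d) => -[i1 i2 i3]; clear -h1 g1 i1 i2 i3 b1 b2; lia.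
- by rewrite -{1}(barK y) mixed // W_bar.
- by rewrite ms -{1}(barK x) mixed // ?W_bar // arcs_meet_sym.
rewrite /meets /apart -{1}(barK x) W_cover ?W_bar // /arcs_meet /=.
have [h1 _ _ _] := order (W_bar Wx) (W_bar Wx); have [h2 _ _ _] := order (W_bar Wy) (W_bar Wy).
have := bound (bar x); have := bound (bar y); clear -h1 h2; lia.
Qed.

End FlippedIntervals.

(** * A table language and its semantics *)

(** A layer between the mathematics and the machine: expressions have no side effects and every loop
    makes [N] rounds, so time and word size can be computed from the syntax. Variables are de Bruijn
    levels, counted from the outermost binder. *)
Inductive hexp : Type :=
| HLit of nat
| HVar of nat
| HN
| HGet of nat & hexp & hexp
| HIn of hexp
| HBin of binop & hexp & hexp
| HIf of hexp & hexp & hexp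
| HFold of bool & hexp.

(* When searching, the accumulator advances with [k] until the first nonzero [v],
   so it ends as the index of that value, or as the bound if there is none. *)
Definition fold_step (summing : bool) (acc k v : nat) : nat :=
  if summing then acc + v else acc + (1 - v) * (1 - (k - acc)).

(* [v] if [v < b] and 0 otherwise, so that accesses stay inside the tables. *)
Definition clamp (b v : nat) : nat := v * (1 - (v.+1 - b)).

Lemma clamp_lt b v : 0 < b -> clamp b v < b.
Proof. by rewrite /clamp => b0; case: (ltnP v b) => h; nia. Qed.

Lemma clamp_id b v : v < b -> clamp b v = v.
Proof. by rewrite /clamp => h; nia. Qed.

Lemma foldl_find (p : nat -> nat) j : 
  foldl (fun acc k => fold_step false acc k (p k)) 0 (iota 0 j) =
  find (fun k => p k != 0) (iota 0 j).
Proof.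
elim: j => // j IH; rewrite -addn1 iotaD add0n foldl_cat find_cat IH /=.
have hf : find (fun k => p k != 0) (iota 0 j) <= j by rewrite -[leqRHS](size_iota 0) find_size.
rewrite has_find size_iota; move: hf; set f := find _ _ => hf.
rewrite /fold_step; case: (ltnP f j) => h; first by nia.
have -> : f = j by lia.
by rewrite subnn; case: (p j) => [|v] /=; lia.
Qed.

Lemma foldl_sum (p : nat -> nat) j : 
  foldl (fun acc k => fold_step true acc k (p k)) 0 (iota 0 j) =
  \sum_(k < j) p k.
Proof.
elim: j => [|j IH]; first by rewrite big_ord0.
by rewrite -addn1 iotaD add0n foldl_cat IH /= addn1 big_ord_recr.
Qed.

Definition table := nat -> nat -> nat -> nat.

Section Evaluation.

Variables (N : nat) (inp : nat -> nat).

Fixpoint ev (tb : table) (vs : seq nat) (e : hexp) : nat :=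
  match e with
  | HLit c => c
  | HVar i => nth 0 vs i
  | HN => N
  | HGet t a b => tb t (clamp N (ev tb vs a)) (clamp N (ev tb vs b))
  | HIn a => inp (clamp (N * N) (ev tb vs a))
  | HBin o a b => eval_binop o (ev tb vs a) (ev tb vs b)
  | HIf c a b => if ev tb vs c == 0 then ev tb vs b else ev tb vs a
  | HFold f b =>
      foldl (fun acc k => fold_step f acc k (ev tb (rcons vs k) b)) 0 (iota 0 N)
  end.

(** The exponent of a strict bound by a power of [N], for [N > 1]. Hence 2 for [N] itself and for a
    search, whose result may equal [N], and [c] for a literal [c], as [c < N ^ c]. *)
Fixpoint degree (td : nat -> nat) (ds : seq nat) (e : hexp) : nat :=
  match e with
  | HLit c => c
  | HVar i => nth 0 ds i
  | HN => 2
  | HGet t _ _ => td t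
  | HIn _ => 1
  | HBin Add a b => (maxn (degree td ds a) (degree td ds b)).+1
  | HBin Mul a b => degree td ds a + degree td ds b
  | HBin _ a _ => degree td ds a
  | HIf _ a b => maxn (degree td ds a) (degree td ds b)
  | HFold f b => if f then (degree td (rcons ds 1) b).+1 else 2
  end.

Fixpoint scoped (lv : nat) (e : hexp) : bool :=
  match e with
  | HVar i => i < lv
  | HGet _ a b | HBin _ a b => scoped lv a && scoped lv b
  | HIn a => scoped lv a
  | HIf c a b => [&& scoped lv c, scoped lv a & scoped lv b]
  | HFold _ b => scoped lv.+1 b
  | _ => true
  end.

Definition bounded (td : nat -> nat) (ds : seq nat) (tb : table) (vs : seq nat) : Prop :=
  [/\ size vs = size ds, forall i, i < size vs -> nth 0 vs i < N ^ nth 0 ds i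
    & forall t x y, x < N -> y < N -> tb t x y < N ^ td t].

Hypothesis N1 : 1 < N.
Hypothesis inp_lt : forall a, a < N * N -> inp a < N.

Lemma bounded_rcons td ds tb vs k : bounded td ds tb vs -> k < N ->
  bounded td (rcons ds 1) tb (rcons vs k).
Proof.
move=> [h1 h2 h3] kN; split=> //; first by rewrite !size_rcons h1.
move=> i; rewrite size_rcons !nth_rcons h1 => hi; case: ifPn => h.
  by apply: h2; rewrite h1.
by have -> : i = size ds; [lia|rewrite eqxx expn1].
Qed.

Lemma lt_expn c : c < N ^ c.
Proof. exact: ltn_expl. Qed.

Lemma lt_expn_le i j v : v < N ^ i -> i <= j -> v < N ^ j.
Proof. by move=> h ij; apply: leq_trans h _; rewrite leq_exp2l. Qed.

Lemma ev_lt td ds tb vs e : bounded td ds tb vs -> scoped (size ds) e ->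
  ev tb vs e < N ^ degree td ds e.
Proof.
elim: e ds vs => [c|i| |t a IHa b IHb|a IHa|o a IHa b IHb|c IHc a IHa b IHb|f b IHb] ds vs hb /=.
- by move=> _; apply: lt_expn.
- by case: hb => h1 h2 _ hi; apply: h2; rewrite h1.
- by move=> _; rewrite -[ltnLHS]expn1 ltn_exp2l.
- by case: hb => _ _ h3 _; apply: h3; apply: clamp_lt; lia.
- by move=> _; rewrite expn1; apply: inp_lt; apply: clamp_lt; nia.
- move=> /andP[sa sb]; have {}IHa := IHa _ _ hb sa; have {}IHb := IHb _ _ hb sb.
  case: o => /=.
  + have h1 := lt_expn_le IHa (leq_maxl _ (degree td ds b)).
    have h2 := lt_expn_le IHb (leq_maxr (degree td ds a) _).
    by rewrite expnS; nia.
  + by apply: leq_ltn_trans IHa; apply: leq_subr.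
  + by rewrite expnD; apply: ltn_mul.
  + by apply: leq_ltn_trans IHa; apply: leq_div.
- move=> /and3P[_ sa sb]; case: ifP => _.
    by apply: lt_expn_le (IHb _ _ hb sb) _; apply: leq_maxr.
  by apply: lt_expn_le (IHa _ _ hb sa) _; apply: leq_maxl.
move=> sb; have hk k : k < N -> ev tb (rcons vs k) b < N ^ degree td (rcons ds 1) b.
  by move=> kN; apply: IHb; [apply: bounded_rcons|rewrite size_rcons].
case: f.
  rewrite foldl_sum expnS.
  have : \sum_(k < N) (ev tb (rcons vs k) b + 1) <= \sum_(k < N) N ^ degree td (rcons ds 1) b.
    by apply: leq_sum => k _; rewrite addn1; apply: hk.
  rewrite big_split /= !sum_nat_const !card_ord; lia.
rewrite foldl_find; apply: (@leq_ltn_trans N); first by rewrite -[leqRHS](size_iota 0) find_size.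
by rewrite -[ltnLHS]expn1 ltn_exp2l.
Qed.

End Evaluation.

(** * Compilation to the word RAM *)

(* Register 0 holds [N], the odd registers hold variables and the positive even ones
   temporaries.  Entry [x, y] of table [t] is in cell [((t + 2) * N + x) * N + y];
   the first [N * N] cells hold the input and the next ones are a buffer. *)
Definition vr (i : nat) := (2 * i).+1.
Definition tr (d : nat) := (2 * d).+2.

Definition clampE (b a : expr) : expr :=
  Bin Mul a (Bin Defs.Sub (Lit 1) (Bin Defs.Sub (Bin Add a (Lit 1)) b)).

Definition addressE (t : expr) (a b : expr) : expr :=
  Bin Add (Bin Mul (Bin Add (Bin Mul t (Reg 0)) a) (Reg 0)) b.

Definition upto (c : nat) (body : program) : program :=
  Seq (Assign c (Lit 0)) (While (Bin Defs.Sub (Reg 0) (Reg c))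
    (Seq body (Assign c (Bin Add (Reg c) (Lit 1))))).

(** [lv] is the number of variables in scope and [d] the number of temporaries in use. The value is
    left in temporary [d], and later temporaries may be overwritten. *)
Fixpoint compE (lv d : nat) (e : hexp) : program :=
  match e with
  | HLit c => Assign (tr d) (Lit c)
  | HVar i => Assign (tr d) (Reg (vr i))
  | HN => Assign (tr d) (Reg 0)
  | HGet t a b => Seq (compE lv d a) (Seq (compE lv d.+1 b)
      (Assign (tr d) (Fetch (addressE (Lit t.+2)
        (clampE (Reg 0) (Reg (tr d))) (clampE (Reg 0) (Reg (tr d.+1)))))))
  | HIn a => Seq (compE lv d a)
      (Assign (tr d) (Fetch (clampE (Bin Mul (Reg 0) (Reg 0)) (Reg (tr d)))))
  | HBin o a b => Seq (compE lv d a) (Seq (compE lv d.+1 b)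
      (Assign (tr d) (Bin o (Reg (tr d)) (Reg (tr d.+1)))))
  | HIf c a b => Seq (compE lv d c) (If (Reg (tr d)) (compE lv d a) (compE lv d b))
  | HFold f b => Seq (Assign (tr d) (Lit 0)) (upto (vr lv)
      (Seq (compE lv.+1 d.+1 b) (Assign (tr d)
        (if f then Bin Add (Reg (tr d)) (Reg (tr d.+1)) else
           Bin Add (Reg (tr d)) (Bin Mul (Bin Defs.Sub (Lit 1) (Reg (tr d.+1)))
             (Bin Defs.Sub (Lit 1) (Bin Defs.Sub (Reg (vr lv)) (Reg (tr d)))))))))
  end.

(* All words met during the evaluation are below [N ^ need]. *)
Fixpoint need (td : nat -> nat) (ds : seq nat) (e : hexp) : nat :=
  maxn (degree td ds e + 6)
  match e with
  | HGet t a b => maxn (t + 8) (maxn (need td ds a) (need td ds b))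
  | HIn a => need td ds a
  | HBin o a b => maxn (need td ds a) (need td ds b)
  | HIf c a b => maxn (need td ds c) (maxn (need td ds a) (need td ds b))
  | HFold _ b => need td (rcons ds 1) b
  | _ => 0
  end.

Fixpoint costE (e : hexp) : nat :=
  match e with
  | HGet _ a b | HBin _ a b => costE a + costE b + 50
  | HIn a => costE a + 50
  | HIf c a b => costE c + costE a + costE b + 50
  | HFold _ b => costE b + 50
  | _ => 50
  end.

Fixpoint depthE (e : hexp) : nat :=
  match e with
  | HGet _ a b | HBin _ a b => maxn (depthE a) (depthE b)
  | HIn a => depthE a
  | HIf c a b => maxn (depthE c) (maxn (depthE a) (depthE b))
  | HFold _ b => (depthE b).+1
  | _ => 0
  end.

Fixpoint pval (s : state) (e : expr) : nat :=
  match e with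
  | Lit v => v
  | Reg r => regs s r
  | Fetch a => Defs.mem s (pval s a)
  | Bin o a b => eval_binop o (pval s a) (pval s b)
  end.

(** The largest value met during evaluation, so that a single inequality excludes overflow. *)
Fixpoint pmax (s : state) (e : expr) : nat :=
  match e with
  | Lit v => v
  | Reg r => regs s r
  | Fetch a => maxn (pmax s a) (Defs.mem s (pval s a))
  | Bin o a b => maxn (eval_binop o (pval s a) (pval s b)) (maxn (pmax s a) (pmax s b))
  end.

Lemma eval_pval W s e : pmax s e < W -> eval W s e = Some (pval s e).
Proof.
elim: e => [v|r|a IH|o a IHa b IHb] /=.
- by rewrite /word => ->.
- by rewrite /word => ->.
- by rewrite gtn_max => /andP[/IH -> h]; rewrite /word h.
by rewrite !gtn_max => /andP[h /andP[/IHa -> /IHb ->]]; rewrite /word h.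
Qed.

Definition upd (s : state) (r v : nat) : state :=
  State [eta regs s with r |-> v] (Defs.mem s) (out s).

Lemma exec_assignP W s r e : pmax s e < W ->
  exec W (Assign r e) s (cost e).+1 (upd s r (pval s e)).
Proof. by move=> h; apply: exec_assign; apply: eval_pval. Qed.

Section Loops.

Variables (W N : nat).
Hypothesis NW : N < W.

Lemma exec_upto c body T (Inv : nat -> state -> Prop) s :
  (forall k s, k < N -> Inv k s -> regs s 0 = N -> regs s c = k ->
    exists t s', [/\ exec W body s t s', t <= T, Inv k.+1 (upd s' c k.+1),
      regs s' 0 = N & regs s' c = k]) ->
  c != 0 -> regs s 0 = N -> Inv 0 (upd s c 0) ->
  exists t s', [/\ exec W (upto c body) s t s', t <= (T + 15) * N + 15, Inv N s' &
    regs s' 0 = N].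
Proof.
move=> hb c0 s0 inv0.
have loop j : forall k s1, k + j = N -> Inv k s1 -> regs s1 0 = N -> regs s1 c = k ->
  exists t s', [/\ exec W (While (Bin Defs.Sub (Reg 0) (Reg c))
    (Seq body (Assign c (Bin Add (Reg c) (Lit 1))))) s1 t s', t <= (T + 15) * j + 5, Inv N s' &
    regs s' 0 = N].
  elim: j => [|j IH] k s1 kj inv r0 rc.
    exists 4, s1; split=> //; last by rewrite -kj addn0.
      apply: (@exec_while_stop W (Bin Defs.Sub (Reg 0) (Reg c))).
      rewrite eval_pval /= ?r0 ?rc; first by congr Some; lia.
      lia.
    by rewrite muln0.
  have kN : k < N by lia.
  have [t [s2 [e1 t1 inv2 r2 c2]]] := hb k s1 kN inv r0 rc.
  have [||||t' [s3 [e3 t3 inv3 r3]]] := IH k.+1 (upd s2 c k.+1).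
  - lia.
  - by [].
  - by rewrite /upd /= eq_sym (negbTE c0).
  - by rewrite /upd /= eqxx.
  have ea := @exec_assignP W s2 c (Bin Add (Reg c) (Lit 1)).
  exists (cost (Bin Defs.Sub (Reg 0) (Reg c)) + (t + (cost (Bin Add (Reg c) (Lit 1))).+1).+1 + t').+1, s3.
  split=> //; last by move: t1 t3; rewrite /=; lia.
  apply: (@exec_while_step _ _ _ _ j _ (upd s2 c k.+1)) e3.
    by rewrite eval_pval /= ?r0 ?rc; [congr Some|]; lia.
  apply: exec_seq e1 _.
  have -> : k.+1 = pval s2 (Bin Add (Reg c) (Lit 1)) by rewrite /= c2 addn1.
  by apply: ea; rewrite /= c2; lia.
have [|//|||t [s1 [e1 t1 i1 r1]]] := loop N 0 (upd s c 0).
- by [].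
- by rewrite /upd /= eq_sym (negbTE c0).
- by rewrite /upd /= eqxx.
exists (2 + t).+1, s1; split=> //; last by lia.
apply: exec_seq e1; apply: (@exec_assignP W s c (Lit 0)) => /=; lia.
Qed.

End Loops.

Section CompileExpr.

Variables (W N : nat) (inp : nat -> nat) (td : nat -> nat).
Hypothesis N1 : 1 < N.
Hypothesis inp_lt : forall a, a < N * N -> inp a < N.

Record corr (tb : table) (vs : seq nat) (s : state) : Prop := Corr {
  corr_N : regs s 0 = N;
  corr_var : forall i, i < size vs -> regs s (vr i) = nth 0 vs i;
  corr_tab : forall t x y, x < N -> y < N ->
    Defs.mem s ((t.+2 * N + x) * N + y) = tb t x y;
  corr_inp : forall a, a < N * N -> Defs.mem s a = inp a }.

Record frame (lv d : nat) (s s' : state) : Prop := Frame {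
  frame_N : regs s' 0 = regs s 0;
  frame_mem : Defs.mem s' = Defs.mem s;
  frame_out : out s' = out s;
  frame_tmp : forall j, j < d -> regs s' (tr j) = regs s (tr j);
  frame_var : forall i, i < lv -> regs s' (vr i) = regs s (vr i) }.

Lemma frame_trans lv d lv' d' s1 s2 s3 : lv <= lv' -> d <= d' ->
  frame lv d s1 s2 -> frame lv' d' s2 s3 -> frame lv d s1 s3.
Proof.
move=> hl hd [a1 a2 a3 a4 a5] [b1 b2 b3 b4 b5]; split; rewrite ?b1 ?b2 ?b3 //.
  by move=> j jd; rewrite b4 ?a4 //; lia.
by move=> j jd; rewrite b5 ?a5 //; lia.
Qed.

Lemma frame_upd lv d s v : frame lv d s (upd s (tr d) v).
Proof.
split=> //= [j jd|i il].
  by case: eqP => //; rewrite /tr; lia.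
by case: eqP => //; rewrite /tr /vr; lia.
Qed.

Lemma corr_frame tb vs d s s' : corr tb vs s -> frame (size vs) d s s' -> corr tb vs s'.
Proof.
move=> [c1 c2 c3 c4] [f1 f2 f3 f4 f5]; split; rewrite ?f1 ?f2 //.
by move=> i hi; rewrite f5 ?c2.
Qed.

Lemma degree_need ds e : N ^ (degree td ds e + 6) <= N ^ need td ds e.
Proof. by rewrite leq_exp2l //; case: e => * /=; exact: leq_maxl. Qed.

Lemma pow_bounds d : [/\ N ^ d * N = N ^ d.+1, 0 < N ^ d & N * N = N ^ 2].
Proof. by rewrite expnSr expn_gt0 ltnW. Qed.

Lemma fold_lt (f : bool) (p : nat -> nat) d j : j <= N -> (forall k, k < N -> p k < N ^ d) ->
  foldl (fun acc k => fold_step f acc k (p k)) 0 (iota 0 j) < N ^ (if f then d.+1 else 2).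
Proof.
move=> jN hp; case: f; last first.
  rewrite foldl_find; apply: (@leq_ltn_trans j).
    by rewrite -[leqRHS](size_iota 0) find_size.
  by apply: leq_ltn_trans jN _; rewrite -[ltnLHS]expn1 ltn_exp2l.
rewrite foldl_sum; have : \sum_(k < j) (p k + 1) <= \sum_(k < j) N ^ d.
  by apply: leq_sum => k _; rewrite addn1; apply: hp; apply: leq_trans jN.
rewrite big_split /= !sum_nat_const !card_ord muln1 expnS.
have : j * N ^ d <= N * N ^ d by rewrite leq_mul2r jN orbT.
have [_ h _] := pow_bounds d; case: j jN => [|j] jN; first by rewrite big_ord0 => *; nia.
by move=> h1 h2; lia.
Qed.

Lemma pmax_clamp s b a : pmax s b < W -> pmax s a < W -> pval s a + 1 < W ->
  pmax s (clampE b a) < W /\ pval s (clampE b a) = clamp (pval s b) (pval s a).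
Proof.
move=> h1 h2 h3; rewrite /= !gtn_max h1 h2 h3 /clamp addn1; split=> //.
rewrite !andbT.
have h4 : pval s a * (1 - ((pval s a).+1 - pval s b)) <= pval s a.
  by rewrite -[leqRHS]muln1 leq_mul // leq_subr.
by do !(apply/andP; split); lia.
Qed.

(** Addresses in table [t] stay below [(t + 3) * N ^ 2], and [t + 3 < N ^ (t + 6)] since [t < N ^ t]
    and [64 <= N ^ 6]. *)
Lemma pmax_address s t x y : N ^ (t + 8) <= W -> regs s 0 = N ->
  pmax s x < W -> pmax s y < W -> pval s x < N -> pval s y < N ->
  pmax s (addressE (Lit t.+2) x y) < W /\
  pval s (addressE (Lit t.+2) x y) = (t.+2 * N + pval s x) * N + pval s y.
Proof.
move=> hW r0 mx my vx vy; rewrite /= !gtn_max mx my r0; split=> //.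
have ht := lt_expn N1 t; have h1 : (t + 3) * N ^ 2 < W.
  apply: leq_trans hW; rewrite expnD.
  have [_ h6 _] := pow_bounds 6.
  have -> : N ^ 8 = N ^ 6 * N ^ 2 by rewrite -expnD.
  have [_ h2 _] := pow_bounds 2.
  have h7 : 64 <= N ^ 6 by rewrite (@leq_exp2r 2 N 6).
  rewrite mulnA ltn_mul2r h2 /=.
  have : t.+1 * 64 <= N ^ t * N ^ 6 by apply: leq_mul.
  by clear -h7; lia.
move: h1; have [_ _ <-] := pow_bounds 0 => h1.
have h2 : N * 2 <= N * N by rewrite leq_mul2l N1 orbT.
have a1 : t.+2 * N + pval s x < t.+3 * N by rewrite [t.+3 * N]mulSn addnC ltn_add2r.
have a2 : (t.+2 * N + pval s x) * N + pval s y < t.+3 * N * N.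
  apply: leq_trans (_ : (t.+2 * N + pval s x).+1 * N <= _).
    by rewrite mulSn addnC ltn_add2r.
  by rewrite leq_mul2r a1 orbT.
have e3 : t.+3 * N * N = (t + 3) * (N * N) by rewrite -mulnA addn3.
have a3 : (t + 3) <= (t + 3) * (N * N) by rewrite leq_pmulr // muln_gt0; lia.
have a4 : (t + 3) * N <= (t + 3) * (N * N) by rewrite leq_mul2l leq_pmulr ?orbT //; lia.
have a5 : t.+2 * N <= (t + 3) * N by rewrite leq_mul2r; lia.
have a6 : (t.+2 * N + pval s x) * N <= (t + 3) * (N * N) by rewrite -e3; apply: leq_trans (ltnW a2); apply: leq_addr.
have a7 : N <= (t + 3) * N by rewrite leq_pmull //; lia.
rewrite e3 in a2.
by move: h1 a1 a2 a3 a4 a5 a6 a7; rewrite -addn3; clear; do !(move=> ?); lia.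
Qed.

Lemma cost_add t1 t2 c1 c2 d1 d2 d : t1 <= c1 * N ^ d1 -> t2 <= c2 * N ^ d2 ->
  d1 <= d -> d2 <= d -> t1 + t2 + 50 <= (c1 + c2 + 50) * N ^ d.
Proof.
move=> h1 h2 h3 h4; have [_ h _] := pow_bounds d.
have g1 : c1 * N ^ d1 <= c1 * N ^ d by rewrite leq_mul // leq_exp2l.
have g2 : c2 * N ^ d2 <= c2 * N ^ d by rewrite leq_mul // leq_exp2l.
rewrite !mulnDl; apply: leq_add; last by rewrite leq_pmulr.
by apply: leq_add; [apply: leq_trans g1|apply: leq_trans g2].
Qed.

Lemma below_W ds tb vs e : bounded N td ds tb vs -> scoped (size ds) e ->
  N ^ need td ds e <= W -> ev N inp tb vs e + 1 < W.
Proof.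
move=> hb sc hW; have := ev_lt N1 inp_lt hb sc => h.
apply: leq_trans (leq_trans (degree_need ds e) hW); rewrite expnD.
have [_ h0 _] := pow_bounds (degree td ds e).
have h6 : 64 <= N ^ 6 by rewrite (@leq_exp2r 2 N 6).
have : N ^ degree td ds e * 64 <= N ^ degree td ds e * N ^ 6 by rewrite leq_mul2l h6 orbT.
by clear -h h0; lia.
Qed.

Lemma need_sub ds e k : k <= need td ds e -> N ^ need td ds e <= W -> N ^ k <= W.
Proof. by move=> h; apply: leq_trans; rewrite leq_exp2l. Qed.

Lemma need6 ds e : N ^ need td ds e <= W -> N < W /\ 2 < W.
Proof.
move=> h; have h6 : N ^ 6 <= W.
  by apply: need_sub h; apply: leq_trans (_ : degree td ds e + 6 <= _); [lia|case: e => * /=; exact: leq_maxl].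
have h5 : 32 * N <= N ^ 6 by rewrite expnSr leq_mul2r (@leq_exp2r 2 N 5) // N1 orbT.
by move: h5 h6 N1; clear; lia.
Qed.

(** The frame clause carries the induction: the value of a left operand survives in temporary [d]
    while the right operand is computed. *)
Lemma compE_correct e : forall ds d tb vs s, bounded N td ds tb vs ->
  scoped (size ds) e -> N ^ need td ds e <= W -> corr tb vs s ->
  exists t s', [/\ exec W (compE (size ds) d e) s t s',
    t <= costE e * N ^ depthE e, regs s' (tr d) = ev N inp tb vs e &
    frame (size ds) d s s'].
Proof.
have asg d e' s : pmax s e' < W -> exec W (Assign (tr d) e') s (cost e').+1 (upd s (tr d) (pval s e')).
  exact: exec_assignP.
have updE s r v : regs (upd s r v) r = v by rewrite /= eqxx.
elim: e => [c|i| |t a IHa b IHb|a IHa|o a IHa b IHb|c IHc a IHa b IHb|f b IHb] ds d tb vs s hb sc hW hc;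
  have sz : size vs = size ds by case: hb.
- exists 2, (upd s (tr d) c); split=> //; last exact: frame_upd.
  by apply: asg; have := below_W hb sc hW => /=; rewrite addn1; apply: ltnW.
- have vi : regs s (vr i) = nth 0 vs i by rewrite (corr_var hc) ?sz.
  exists 2, (upd s (tr d) (regs s (vr i))); split=> //; last exact: frame_upd.
    by apply: asg; have := below_W hb sc hW => /=; rewrite vi addn1; apply: ltnW.
  by rewrite updE /= vi.
- exists 2, (upd s (tr d) (regs s 0)); split=> //; last exact: frame_upd.
    by apply: asg; have := below_W hb sc hW => /=; rewrite (corr_N hc) addn1; apply: ltnW.
  by rewrite updE (corr_N hc).
- have [NW W2] := need6 hW; have bw := below_W hb sc hW.
  move: sc (hW) => /= /andP[sa sb] _.
  have le1 : N ^ need td ds a <= W by apply: need_sub hW => /=; clear; lia.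
  have le2 : N ^ need td ds b <= W by apply: need_sub hW => /=; clear; lia.
  have le4 : N ^ (t + 8) <= W by apply: need_sub hW => /=; clear; lia.
  have [t1 [s1 [e1 c1 v1 f1]]] := IHa ds d tb vs s hb sa le1 hc.
  have hc1 : corr tb vs s1 by apply: corr_frame hc _; rewrite sz; exact: f1.
  have [t2 [s2 [e2 c2 v2 f2]]] := IHb ds d.+1 tb vs s1 hb sb le2 hc1.
  have hc2 : corr tb vs s2 by apply: corr_frame hc1 _; rewrite sz; exact: f2.
  have v1' : regs s2 (tr d) = ev N inp tb vs a by rewrite (frame_tmp f2).
  have f12 : frame (size ds) d s s2 by apply: frame_trans f1 f2.
  have ba := below_W hb sa le1; have bb := below_W hb sb le2.
  have r0 := corr_N hc2.
  have [|||m1 p1] := @pmax_clamp s2 (Reg 0) (Reg (tr d)); rewrite /= ?r0 ?v1' //.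
    by rewrite addn1 in ba; apply: ltnW.
  have [|||m2 p2] := @pmax_clamp s2 (Reg 0) (Reg (tr d.+1)); rewrite /= ?r0 ?v2 //.
    by rewrite addn1 in bb; apply: ltnW.
  set ca := clampE (Reg 0) (Reg (tr d)) in m1 p1 *.
  set cb := clampE (Reg 0) (Reg (tr d.+1)) in m2 p2 *.
  have cla : pval s2 ca < N by rewrite p1 /= r0; apply: clamp_lt; apply: ltnW.
  have clb : pval s2 cb < N by rewrite p2 /= r0; apply: clamp_lt; apply: ltnW.
  have [m3 p3] := pmax_address le4 r0 m1 m2 cla clb.
  set ad := addressE _ _ _ in m3 p3 *.
  have pvm : pval s2 (Fetch ad) = ev N inp tb vs (HGet t a b).
    rewrite -[LHS]/(Defs.mem s2 (pval s2 ad)) p3 (corr_tab hc2) //.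
    by rewrite p1 p2 /= r0 v1' v2.
  exists (t1 + (t2 + (cost (Fetch ad)).+1).+1).+1, (upd s2 (tr d) (pval s2 (Fetch ad))).
  split.
  + apply: exec_seq e1 _; apply: exec_seq e2 _; apply: asg.
    rewrite -[pmax _ _]/(maxn (pmax s2 ad) (pval s2 (Fetch ad))) gtn_max m3 pvm.
    by rewrite addn1 in bw; apply: ltnW.
  + apply: leq_trans (cost_add c1 c2 (leq_maxl _ _) (leq_maxr _ _)).
    by rewrite /=; clear; lia.
  + by rewrite updE pvm.
  + by apply: frame_trans f12 (frame_upd _ _ _ _).
- have [NW W2] := need6 hW; have bw := below_W hb sc hW.
  have sa : scoped (size ds) a by [].
  have le1 : N ^ need td ds a <= W by apply: need_sub hW => /=; clear; lia.
  have le6 : N ^ 6 <= W by apply: need_sub hW => /=; clear; lia.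
  have [t1 [s1 [e1 c1 v1 f1]]] := IHa ds d tb vs s hb sa le1 hc.
  have hc1 : corr tb vs s1 by apply: corr_frame hc _; rewrite sz; exact: f1.
  have ba := below_W hb sa le1; have r0 := corr_N hc1.
  have NNW : N * N < W.
    by apply: leq_trans le6; have [_ _ ->] := pow_bounds 0; rewrite ltn_exp2l.
  have [|||m1 p1] := @pmax_clamp s1 (Bin Mul (Reg 0) (Reg 0)) (Reg (tr d));
    rewrite /= ?r0 ?v1 ?gtn_max ?NW ?NNW //.
    by rewrite addn1 in ba; apply: ltnW.
  set ad := clampE _ _ in m1 p1 *.
  have pvm : pval s1 (Fetch ad) = ev N inp tb vs (HIn a).
    rewrite -[LHS]/(Defs.mem s1 (pval s1 ad)) p1 /= r0 v1 (corr_inp hc1) //.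
    by apply: clamp_lt; rewrite muln_gt0 ltnW.
  exists (t1 + (cost (Fetch ad)).+1).+1, (upd s1 (tr d) (pval s1 (Fetch ad))).
  split.
  + apply: exec_seq e1 _; apply: asg.
    rewrite -[pmax _ _]/(maxn (pmax s1 ad) (pval s1 (Fetch ad))) gtn_max m1 pvm.
    by rewrite addn1 in bw; apply: ltnW.
  + have := @cost_add t1 0 _ 0 _ 0 (depthE a) c1 (leq0n _) (leqnn _) (leq0n _).
    by rewrite addn0 /= addn0; apply: leq_trans; clear; lia.
  + by rewrite updE pvm.
  + by apply: frame_trans f1 (frame_upd _ _ _ _).
- have bw := below_W hb sc hW.
  move: sc (hW) => /= /andP[sa sb] _.
  have le1 : N ^ need td ds a <= W by apply: need_sub hW => /=; clear; lia.
  have le2 : N ^ need td ds b <= W by apply: need_sub hW => /=; clear; lia.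
  have [t1 [s1 [e1 c1 v1 f1]]] := IHa ds d tb vs s hb sa le1 hc.
  have hc1 : corr tb vs s1 by apply: corr_frame hc _; rewrite sz; exact: f1.
  have [t2 [s2 [e2 c2 v2 f2]]] := IHb ds d.+1 tb vs s1 hb sb le2 hc1.
  have v1' : regs s2 (tr d) = ev N inp tb vs a by rewrite (frame_tmp f2).
  have f12 : frame (size ds) d s s2 by apply: frame_trans f1 f2.
  have ba := below_W hb sa le1; have bb := below_W hb sb le2.
  rewrite addn1 in ba; rewrite addn1 in bb; rewrite addn1 in bw.
  exists (t1 + (t2 + 4).+1).+1, (upd s2 (tr d) (pval s2 (Bin o (Reg (tr d)) (Reg (tr d.+1))))).
  split.
  + apply: exec_seq e1 _; apply: exec_seq e2 _; apply: asg.
    by rewrite /= !gtn_max v1' v2 (ltnW ba) (ltnW bb) (ltnW bw).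
  + by apply: leq_trans (cost_add c1 c2 (leq_maxl _ _) (leq_maxr _ _)); clear; lia.
  + by rewrite updE /= v1' v2.
  + by apply: frame_trans f12 (frame_upd _ _ _ _).
- have bw := below_W hb sc hW.
  move: sc (hW) => /= /and3P[sk sa sb] _.
  have le0 : N ^ need td ds c <= W by apply: need_sub hW => /=; clear; lia.
  have le1 : N ^ need td ds a <= W by apply: need_sub hW => /=; clear; lia.
  have le2 : N ^ need td ds b <= W by apply: need_sub hW => /=; clear; lia.
  have [t0 [s0 [e0 c0 v0 f0]]] := IHc ds d tb vs s hb sk le0 hc.
  have hc0 : corr tb vs s0 by apply: corr_frame hc _; rewrite sz; exact: f0.
  have bk := below_W hb sk le0; rewrite addn1 in bk.
  have ek : eval W s0 (Reg (tr d)) = Some (ev N inp tb vs c).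
    by rewrite eval_pval /= v0 // ltnW.
  have final t1 s1 (pr : hexp) : exec W (if ev N inp tb vs c == 0 then compE (size ds) d b else compE (size ds) d a) s0 t1 s1 ->
      t1 <= costE pr * N ^ depthE pr -> costE pr <= costE a + costE b ->
      depthE pr <= maxn (depthE a) (depthE b) -> frame (size ds) d s0 s1 ->
      regs s1 (tr d) = ev N inp tb vs (HIf c a b) ->
      exists t s', [/\ exec W (Seq (compE (size ds) d c) (If (Reg (tr d)) (compE (size ds) d a) (compE (size ds) d b))) s t s',
        t <= (costE c + costE a + costE b + 50) * N ^ maxn (depthE c) (maxn (depthE a) (depthE b)),
        regs s' (tr d) = ev N inp tb vs (HIf c a b) & frame (size ds) d s s'].
    move=> e1 c1 l1 l2 f1 v1; exists (t0 + (1 + t1).+1).+1, s1; split=> //.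
    + by apply: exec_seq e0 _; apply: exec_if ek _.
    + apply: leq_trans (_ : (costE c + costE pr + 50) * N ^ maxn (depthE c) (maxn (depthE a) (depthE b)) <= _).
        apply: leq_trans (cost_add c0 c1 _ _); [clear; lia|exact: leq_maxl|].
        by apply: leq_trans l2 (leq_maxr _ _).
      by rewrite leq_mul2r; apply/orP; right; move: l1; clear; lia.
    + by apply: frame_trans f0 f1.
  have [hk|hk'] : ev N inp tb vs c = 0 \/ (ev N inp tb vs c == 0) = false.
    by case: (ev N inp tb vs c) => [|k]; [left|right].
    have [t1 [s1 [e1 c1 v1 f1]]] := IHb ds d tb vs s0 hb sb le2 hc0.
    refine (final t1 s1 b _ c1 (leq_addl _ _) (leq_maxr _ _) f1 _); by rewrite /= hk.
  have [t1 [s1 [e1 c1 v1 f1]]] := IHa ds d tb vs s0 hb sa le1 hc0.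
  by refine (final t1 s1 a _ c1 (leq_addr _ _) (leq_maxl _ _) f1 _); rewrite /= hk'.
have [NW W2] := need6 hW; have bw := below_W hb sc hW.
have le1 : N ^ need td (rcons ds 1) b <= W by apply: need_sub hW; rewrite /=; clear; lia.
have sb : scoped (size (rcons ds 1)) b by rewrite size_rcons.
pose p k := ev N inp tb (rcons vs k) b.
have hp k : k < N -> p k < N ^ degree td (rcons ds 1) b.
  by move=> kN; apply: ev_lt => //; apply: bounded_rcons.
pose acc j := foldl (fun a k => fold_step f a k (p k)) 0 (iota 0 j).
have accS j : acc j.+1 = fold_step f (acc j) j (p j).
  by rewrite /acc -addn1 iotaD add0n foldl_cat.
have dg : N ^ (if f then (degree td (rcons ds 1) b).+1 else 2) < W.
  have h6 : N ^ (degree td ds (HFold f b) + 6) <= W by apply: leq_trans (degree_need _ _) hW.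
  by apply: leq_trans h6; rewrite ltn_exp2l //= -addn1 leq_add2l.
have accW j : j <= N -> acc j < W.
  by move=> jN; apply: ltn_trans (fold_lt f jN hp) dg.
pose Inv k s1 := regs s1 (tr d) = acc k /\ frame (size ds) d s s1.
pose ex := if f then Bin Add (Reg (tr d)) (Reg (tr d.+1)) else
  Bin Add (Reg (tr d)) (Bin Mul (Bin Defs.Sub (Lit 1) (Reg (tr d.+1)))
    (Bin Defs.Sub (Lit 1) (Bin Defs.Sub (Reg (vr (size ds))) (Reg (tr d))))).
pose body := Seq (compE (size ds).+1 d.+1 b) (Assign (tr d) ex).
have hbody k s1 : k < N -> Inv k s1 -> regs s1 0 = N -> regs s1 (vr (size ds)) = k ->
    exists t s', [/\ exec W body s1 t s', t <= costE b * N ^ depthE b + 15,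
      Inv k.+1 (upd s' (vr (size ds)) k.+1), regs s' 0 = N & regs s' (vr (size ds)) = k].
  move=> kN [ia fr] r0 rk.
  have hc1 : corr tb (rcons vs k) s1.
    have [g1 g2 g3 g4] : corr tb vs s1 by apply: corr_frame hc _; rewrite sz; exact: fr.
    split=> // i; rewrite size_rcons nth_rcons sz => hi; case: ifP => h; first by apply: g2; rewrite sz.
    by have -> : i = size ds; [lia|rewrite eqxx].
  have hb1 := bounded_rcons N1 hb kN.
  have [t1 [s2 [e1 c1 v1 f1]]] := IHb (rcons ds 1) d.+1 tb (rcons vs k) s1 hb1 sb le1 hc1.
  rewrite size_rcons in e1 f1; have pW := below_W hb1 sb le1.
  have a2 : regs s2 (tr d) = acc k by rewrite (frame_tmp f1).
  have k2 : regs s2 (vr (size ds)) = k by rewrite (frame_var f1).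
  have aW := accW k (ltnW kN); have aW' := accW k.+1 kN.
  have pv : pval s2 ex = acc k.+1.
    rewrite accS /fold_step /ex; case: (f) => /=; rewrite a2 v1 //.
    by rewrite k2.
  have pm : pmax s2 ex < W.
    rewrite addn1 in pW; have pW' := ltnW pW; move: pv aW'; rewrite /ex; case: (f) => /=.
      by rewrite a2 v1 !gtn_max aW pW' => -> ->.
    rewrite a2 v1 k2 !gtn_max aW pW' => -> -> /=.
    have : (1 - ev N inp tb (rcons vs k) b) * (1 - (k - acc k)) <= 1 * 1.
      by apply: leq_mul; apply: leq_subr.
    by move: W2 NW kN; clear; lia.
  exists (t1 + (cost ex).+1).+1, (upd s2 (tr d) (pval s2 ex)); split.
  + by apply: exec_seq e1 _; apply: asg.
  + move: c1; rewrite /ex; case: (f) => /=; clear; lia.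
  + split.
      rewrite /= eqxx pv; case: eqP => //; rewrite /tr /vr; lia.
    apply: (@frame_trans _ _ (size ds) d _ s1) => //; split=> //=.
    * by rewrite -(frame_N f1).
    * by rewrite (frame_mem f1).
    * by rewrite (frame_out f1).
    * move=> j jd; rewrite -(frame_tmp f1 (ltnW jd)) //.
      by do 2?case: eqP => //; rewrite /tr /vr; lia.
    move=> i il; rewrite -(frame_var f1 (ltnW il)).
    by do 2?case: eqP => //; rewrite /tr /vr; lia.
  + by rewrite /= (frame_N f1) r0.
  rewrite /= k2; case: eqP => //; rewrite /tr /vr; lia.
have [|||t1 [s1 [e1 c1 [i1 f1] r1]]] := @exec_upto W N NW (vr (size ds)) body _ Inv (upd s (tr d) 0) hbody.
- by [].
- by rewrite /= (corr_N hc).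
- split; first by rewrite /= eqxx; case: ifP.
  split=> //= [j jd|i il]; do 2?case: eqP => //; rewrite /tr /vr; lia.
exists (2 + t1).+1, s1; split=> //.
  apply: exec_seq e1; apply: (@exec_assignP W s (tr d) (Lit 0)) => /=; lia.
apply: leq_trans (_ : (costE b * N ^ depthE b + 15 + 15) * N + 15 + 3 <= _); first by lia.
rewrite /= expnS; have [_ h _] := pow_bounds (depthE b).
rewrite !mulnDl [N * _]mulnC mulnA -!addnA leq_add2l mulnA.
have : N * 1 <= N * N ^ depthE b by rewrite leq_mul2l h orbT.
by clear -N1; nia.
Qed.

End CompileExpr.

(** * Statements of the table language *)

Inductive hstm : Type :=
| HSkip
| HSet of nat & hexp
| HTab of nat & hexp
| HSeq of hstm & hstm
| HFor of hstm
| HIfS of hexp & hstm & hstm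
| HOut of hexp.

Record hstate := HState { tabs : table; vars : seq nat; outs : seq nat }.

Fixpoint run (N : nat) (inp : nat -> nat) (c : hstm) (st : hstate) : hstate :=
  let: HState tb vs o := st in
  match c with
  | HSkip => st
  | HSet i e => HState tb (set_nth 0 vs i (ev N inp tb vs e)) o
  | HTab t e => HState (fun t' x y => if t' == t then
      ev N inp tb (rcons (rcons vs x) y) e else tb t' x y) vs o
  | HSeq c1 c2 => run N inp c2 (run N inp c1 st)
  | HFor b => foldl (fun st k =>
      let: HState tb vs o := st in
      let: HState tb' vs' o' := run N inp b (HState tb (rcons vs k) o) in
      HState tb' (take (size vs) vs') o') st (iota 0 N)
  | HIfS e c1 c2 => if ev N inp tb vs e == 0 then run N inp c2 st else run N inp c1 st
  | HOut e => HState tb vs (rcons o (ev N inp tb vs e))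
  end.

(** Degrees are declared once and no assignment may exceed them, so the bounds hold through any
    number of rounds. Assignments reach only the first [g] variables, so loop counters are safe from
    the body. *)
Fixpoint okS (td : nat -> nat) (g : nat) (ds : seq nat) (c : hstm) : bool :=
  match c with
  | HSkip => true
  | HSet i e => [&& i < g, i < size ds, scoped (size ds) e & degree td ds e <= nth 0 ds i]
  | HTab t e => scoped (size ds).+2 e && (degree td (rcons (rcons ds 1) 1) e <= td t)
  | HSeq c1 c2 => okS td g ds c1 && okS td g ds c2
  | HFor b => okS td g (rcons ds 1) b
  | HIfS e c1 c2 => [&& scoped (size ds) e, okS td g ds c1 & okS td g ds c2]
  | HOut e => scoped (size ds) e
  end.

Definition cell (t : nat) (lv : nat) := addressE (Lit t) (Reg (vr lv)) (Reg (vr lv.+1)).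

(** A table may be redefined from its own old entries, so [HTab] first fills the buffer and then
    copies it. *)
Fixpoint compS (lv : nat) (c : hstm) : program :=
  match c with
  | HSkip => Skip
  | HSet i e => Seq (compE lv 0 e) (Assign (vr i) (Reg (tr 0)))
  | HTab t e => Seq
      (upto (vr lv) (upto (vr lv.+1)
        (Seq (compE lv.+2 0 e) (Store (cell 1 lv) (Reg (tr 0))))))
      (upto (vr lv) (upto (vr lv.+1) (Store (cell t.+2 lv) (Fetch (cell 1 lv)))))
  | HSeq c1 c2 => Seq (compS lv c1) (compS lv c2)
  | HFor b => upto (vr lv) (compS lv.+1 b)
  | HIfS e c1 c2 => Seq (compE lv 0 e) (If (Reg (tr 0)) (compS lv c1) (compS lv c2))
  | HOut e => Seq (compE lv 0 e) (Output (Reg (tr 0)))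
  end.

Fixpoint needS (td : nat -> nat) (ds : seq nat) (c : hstm) : nat :=
  match c with
  | HSkip => 6
  | HSet _ e => need td ds e
  | HTab t e => maxn (need td (rcons (rcons ds 1) 1) e) (maxn (t + 10) (td t + 6))
  | HSeq c1 c2 => maxn (needS td ds c1) (needS td ds c2)
  | HFor b => needS td (rcons ds 1) b
  | HIfS e c1 c2 => maxn (need td ds e) (maxn (needS td ds c1) (needS td ds c2))
  | HOut e => need td ds e
  end.

Fixpoint costS (c : hstm) : nat :=
  match c with
  | HSkip => 50
  | HSet _ e => costE e + 50
  | HTab t e => costE e + 300
  | HSeq c1 c2 => costS c1 + costS c2 + 50
  | HFor b => costS b + 50
  | HIfS e c1 c2 => costE e + costS c1 + costS c2 + 50
  | HOut e => costE e + 50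
  end.

Fixpoint depthS (c : hstm) : nat :=
  match c with
  | HSkip => 0
  | HSet _ e => depthE e
  | HTab t e => (depthE e).+2
  | HSeq c1 c2 => maxn (depthS c1) (depthS c2)
  | HFor b => (depthS b).+1
  | HIfS e c1 c2 => maxn (depthE e) (maxn (depthS c1) (depthS c2))
  | HOut e => depthE e
  end.

Section CompileStm.

Variables (W N : nat) (inp : nat -> nat) (td : nat -> nat) (g : nat).
Hypothesis N1 : 1 < N.
Hypothesis inp_lt : forall a, a < N * N -> inp a < N.

Definition fits (ds : seq nat) (st : hstate) : Prop := bounded N td ds (tabs st) (vars st).

Definition corrS (st : hstate) (s : state) : Prop :=
  corr N inp (tabs st) (vars st) s /\ out s = outs st.

Definition keeps (ds : seq nat) (st st' : hstate) : Prop :=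
  fits ds st' /\ forall i, g <= i -> nth 0 (vars st') i = nth 0 (vars st) i.

Lemma fits_pop ds d st : fits (rcons ds d) st -> fits ds (HState (tabs st) (take (size ds) (vars st)) (outs st)).
Proof.
move=> [h1 h2 h3]; split=> //=; first by rewrite size_takel // h1 size_rcons.
move=> i; rewrite size_takel ?h1 ?size_rcons // => hi.
rewrite nth_take //; have := h2 i; rewrite nth_rcons hi; apply.
by rewrite h1 size_rcons ltnW.
Qed.

Lemma run_keeps c : forall ds st, fits ds st -> okS td g ds c -> g <= size ds ->
  keeps ds st (run N inp c st).
Proof.
elim: c => [|i e|t e|c1 IH1 c2 IH2|b IH|e c1 IH1 c2 IH2|e] ds [tb vs o] hb /=.
- by [].
- move=> /and4P[ig isz sc dg] _; have [h1 h2 h3] := hb; rewrite /= in h1 h2 h3.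
  split; last by move=> j gj /=; rewrite nth_set_nth /=; case: eqP => // ?; lia.
  split=> //=; first by rewrite size_set_nth h1; apply/maxn_idPr.
  move=> j; rewrite size_set_nth h1 (maxn_idPr isz) nth_set_nth /= => hj.
  case: eqP => [->|_]; last by apply: h2; rewrite h1.
  by apply: lt_expn_le dg => //; apply: ev_lt.
- move=> /andP[sc dg] _; have [h1 h2 h3] := hb; rewrite /= in h1 h2 h3.
  split=> //; split=> //= t' x y xN yN; case: eqP => [->|_]; last exact: h3.
  apply: lt_expn_le dg => //; apply: ev_lt => //; last by rewrite !size_rcons.
  by apply: bounded_rcons yN; [exact: N1|apply: bounded_rcons xN].
- move=> /andP[o1 o2] gd; have [f1 k1] := IH1 ds _ hb o1 gd.
  have [f2 k2] := IH2 ds _ f1 o2 gd; split=> // i gi.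
  by rewrite k2 // k1.
- move=> ob gd; set F := (F in foldl F).
  suff H j : j <= N -> keeps ds (HState tb vs o) (foldl F (HState tb vs o) (iota 0 j)) by exact: H.
  elim: j => [|j IHj] jN; first by split.
  rewrite -addn1 iotaD add0n foldl_cat [foldl _ _ (iota j 1)]/=; have := IHj (ltnW jN).
  case: (foldl _ _ _) => tb1 vs1 o1 [f1 k1]; rewrite /= in k1; rewrite /F.
  have := IH (rcons ds 1) (HState tb1 (rcons vs1 j) o1) _ ob _.
  case: (run _ _ _ _) => tb2 vs2 o2 [||f2 k2].
  + by apply: bounded_rcons.
  + by rewrite size_rcons; lia.
  have s1 : size vs1 = size ds by case: f1.
  split; first by have := fits_pop f2; rewrite s1.
  move=> i gi /=; rewrite -k1 //; have s2 : size vs2 = (size ds).+1 by case: f2; rewrite /= size_rcons.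
  case: (ltnP i (size ds)) => hi.
    by rewrite nth_take ?s1 // k2 //= nth_rcons s1 hi.
  by rewrite !nth_default ?s1 // size_takel ?s1 // s2.
- by move=> /and3P[se o1 o2] gd; case: ifP => _; [apply: IH2|apply: IH1].
- by [].
Qed.

Lemma corr_upd tb vs s r v : corr N inp tb vs s -> r != 0 ->
  (forall i, i < size vs -> r != vr i) -> corr N inp tb vs (upd s r v).
Proof.
move=> [c1 c2 c3 c4] r0 rv; split=> //=; first by rewrite eq_sym (negbTE r0).
by move=> i hi; rewrite eq_sym (negbTE (rv i hi)) c2.
Qed.

Lemma vr_neq i j : i != j -> vr i != vr j.
Proof. by rewrite /vr; lia. Qed.

Lemma exec_upto2 lv body T (Inv : nat -> state -> Prop) s : N < W ->
  (forall k s1 i v, Inv k s1 -> lv <= i -> Inv k (upd s1 (vr i) v)) ->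
  (forall x y s1, x < N -> y < N -> Inv (x * N + y) s1 -> regs s1 0 = N ->
     regs s1 (vr lv) = x -> regs s1 (vr lv.+1) = y ->
     exists t s', [/\ exec W body s1 t s', t <= T, Inv (x * N + y).+1 s' &
       [/\ regs s' 0 = N, regs s' (vr lv) = x & regs s' (vr lv.+1) = y]]) ->
  regs s 0 = N -> Inv 0 s ->
  exists t s', [/\ exec W (upto (vr lv) (upto (vr lv.+1) body)) s t s',
    t <= (T + 60) * N ^ 2, Inv (N * N) s' & regs s' 0 = N].
Proof.
move=> NW stab hb r0 i0.
have inner x s1 : x < N -> Inv (x * N) s1 -> regs s1 0 = N -> regs s1 (vr lv) = x ->
    exists t s', [/\ exec W (upto (vr lv.+1) body) s1 t s', t <= (T + 15) * N + 15,
      Inv (x.+1 * N) (upd s' (vr lv) x.+1), regs s' 0 = N & regs s' (vr lv) = x].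
  move=> xN ix rx0 rx.
  have [||||t [s' [e c [i' k'] r']]] := @exec_upto W N NW (vr lv.+1) body T
      (fun y s2 => Inv (x * N + y) s2 /\ regs s2 (vr lv) = x) s1.
  - move=> y s2 yN [iy ky] ry0 ry.
    have [t [s3 [e c i3 [g1 g2 g3]]]] := hb x y s2 xN yN iy ry0 ky ry.
    exists t, s3; split=> //; split.
      by rewrite addnS; apply: stab.
    by rewrite /=; case: eqP => //; rewrite /vr; lia.
  - by [].
  - by [].
  - split; first by rewrite addn0; apply: stab.
    by rewrite /=; case: eqP => //; rewrite /vr; lia.
  exists t, s'; split=> //; apply: stab => //.
  by rewrite mulSn addnC.
have [|||t [s' [e c i' r']]] := @exec_upto W N NW (vr lv) _ _ (fun x s1 => Inv (x * N) s1) s inner.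
- by [].
- by [].
- by rewrite mul0n; apply: stab.
exists t, s'; split=> //; apply: leq_trans c _.
have [_ _ <-] := pow_bounds N1 0; rewrite !mulnDl; move: N1; clear; nia.
Qed.

Lemma digit_inj a y a' y' : y < N -> y' < N -> a * N + y = a' * N + y' -> a = a' /\ y = y'.
Proof.
move=> yN yN' e; have ea : a = a'.
  by have := congr1 (divn^~ N) e; rewrite /= !divnMDl ?(ltnW N1) // !divn_small // !addn0.
by split=> //; move: e; rewrite ea => /addnI.
Qed.

Lemma cell_inj t x y t' x' y' : x < N -> y < N -> x' < N -> y' < N ->
  (t * N + x) * N + y = (t' * N + x') * N + y' -> [/\ t = t', x = x' & y = y'].
Proof.
move=> h1 h2 h3 h4 /(digit_inj h2 h4)[e ->].
by have [-> ->] := digit_inj h1 h3 e.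
Qed.

Lemma cell_val s lv t x y : N ^ (t + 8) <= W -> regs s 0 = N -> regs s (vr lv) = x ->
  regs s (vr lv.+1) = y -> x < N -> y < N -> 
  pmax s (cell t lv) < W /\ pval s (cell t lv) = (t * N + x) * N + y.
Proof.
move=> hW r0 rx ry xN yN; have NW : N < W.
  apply: leq_trans hW; rewrite addnS expnS -[ltnLHS]muln1 ltn_mul2l ltnW //=.
  by rewrite addnS expnS; have [_ h _] := pow_bounds N1 (t + 6); move: N1 h; clear; nia.
split; last by rewrite /= r0 rx ry.
have tW : t.+2 <= W.
  by apply: leq_trans hW; apply: leq_trans (ltnW (lt_expn N1 (t + 8))); lia.
case: t hW tW => [|[|t]] hW tW.
- rewrite /= r0 rx ry !gtn_max !mul0n add0n NW; move: hW; rewrite add0n => hW.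
  have h2 : N ^ 2 < W by apply: leq_trans hW; rewrite ltn_exp2l.
  have [_ _ e2] := pow_bounds N1 0.
  have h3 : x * N + y < N * N by move: xN yN; clear; nia.
  have h4 : x * N <= N * N by rewrite leq_mul2r ltnW ?orbT.
  by move: h2 h3 h4 NW xN yN; rewrite -e2; clear; lia.
- rewrite /= r0 rx ry !gtn_max !mul1n NW; move: hW => /= hW.
  have h2 : N ^ 3 < W by apply: leq_trans hW; rewrite ltn_exp2l.
  have h3 : (N + x) * N + y < 2 * N * N by move: xN yN; clear; nia.
  have h4 : 2 * N * N <= N ^ 3 by rewrite expnS; have [_ _ <-] := pow_bounds N1 0; rewrite mulnA !leq_mul2r N1 !orbT.
  have h5 : (N + x) * N <= 2 * N * N by rewrite leq_mul2r; move: xN; clear; lia.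
  have h6 : 2 * N <= 2 * N * N by rewrite leq_pmulr //; lia.
  by move: h2 h3 h4 h5 h6 NW xN yN; clear; lia.
have vx : pval s (Reg (vr lv)) < N by rewrite /= rx.
have vy : pval s (Reg (vr lv.+1)) < N by rewrite /= ry.
have hW' : N ^ (t + 8) <= W by apply: leq_trans hW; rewrite leq_exp2l //; lia.
have mx : pmax s (Reg (vr lv)) < W := ltn_trans vx NW.
have my : pmax s (Reg (vr lv.+1)) < W := ltn_trans vy NW.
by case: (pmax_address N1 hW' r0 mx my vx vy).
Qed.

Lemma compS_tab t e ds st s : fits ds st -> okS td g ds (HTab t e) ->
  N ^ needS td ds (HTab t e) <= W -> corrS st s ->
  exists T s', [/\ exec W (compS (size ds) (HTab t e)) s T s',
    T <= costS (HTab t e) * N ^ depthS (HTab t e) & corrS (run N inp (HTab t e) st) s'].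
Proof.
case: st => tb vs o /= hb /andP[sc dg] hW [hc ho]; rewrite /= in hc ho.
have sz : size vs = size ds by case: hb.
have hW1 : N ^ need td (rcons (rcons ds 1) 1) e <= W.
  by apply: leq_trans hW; rewrite leq_exp2l //; clear; lia.
have hW2 : N ^ (t.+2 + 8) <= W by apply: leq_trans hW; rewrite leq_exp2l //; clear; lia.
have hW9 : N ^ (1 + 8) <= W by apply: leq_trans hW; rewrite leq_exp2l //; clear; lia.
have hW3 : N ^ (td t + 6) <= W by apply: leq_trans hW; rewrite leq_exp2l //; clear; lia.
have [NW W2] := need6 N1 hW1.
pose val x y := ev N inp tb (rcons (rcons vs x) y) e.
have valW x y : x < N -> y < N -> val x y + 1 < W.
  move=> xN yN; apply: (below_W N1 inp_lt (ds := rcons (rcons ds 1) 1) (td := td)) => //; last by rewrite !size_rcons.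
  by apply: bounded_rcons yN; [exact: N1|apply: bounded_rcons xN].
pose Inv1 j s1 := corrS (HState tb vs o) s1 /\ forall x y, x < N -> y < N ->
  x * N + y < j -> Defs.mem s1 ((1 * N + x) * N + y) = val x y.
have vlt i lv : i < size ds -> lv >= size ds -> vr lv != vr i by rewrite /vr; lia.
have [||||t1 [s1 [e1 c1 [[hc1 ho1] i1] r1]]] := @exec_upto2 (size ds)
  (Seq (compE (size ds).+2 0 e) (Store (cell 1 (size ds)) (Reg (tr 0))))
  (costE e * N ^ depthE e + 12) Inv1 s NW.
- move=> k s1 i v [[h1 h2] h3] hi; split=> //; split=> //.
  by apply: corr_upd => // j; rewrite sz => hj; apply: vlt.
- move=> x y s1 xN yN [[h1 h2] h3] r0 rx ry; rewrite /= in h1 h2.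
  have hc1 : corr N inp tb (rcons (rcons vs x) y) s1.
    have [g1 g2 g3 g4] := h1; split=> // i.
    rewrite !size_rcons !nth_rcons size_rcons sz => hi.
    case: ltnP => h; last by have -> : i = (size ds).+1; [lia|rewrite eqxx].
    case: ltnP => h'; first by apply: g2; rewrite sz.
    by have -> : i = size ds; [lia|rewrite eqxx].
  have hb1 : bounded N td (rcons (rcons ds 1) 1) tb (rcons (rcons vs x) y).
    by apply: bounded_rcons yN; [exact: N1|apply: bounded_rcons xN].
  have sc1 : scoped (size (rcons (rcons ds 1) 1)) e by rewrite !size_rcons.
  have [t1 [s2 [e1 c1 v1 f1]]] := compE_correct N1 inp_lt 0 hb1 sc1 hW1 hc1.
  rewrite !size_rcons in e1 f1.
  have rx2 : regs s2 (vr (size ds)) = x by rewrite (frame_var f1) // ltnW.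
  have ry2 : regs s2 (vr (size ds).+1) = y by rewrite (frame_var f1).
  have r02 : regs s2 0 = N by rewrite (frame_N f1).
  have [m2 p2] := cell_val hW9 r02 rx2 ry2 xN yN.
  have vW := valW x y xN yN.
  have es : exec W (Store (cell 1 (size ds)) (Reg (tr 0))) s2 (cost (cell 1 (size ds)) + 1).+1
     (State (regs s2) [eta Defs.mem s2 with (1 * N + x) * N + y |-> val x y] (out s2)).
    apply: exec_store; first by rewrite eval_pval // p2.
    by rewrite eval_pval /= v1 //; rewrite addn1 in vW; apply: ltnW.
  exists (t1 + (cost (cell 1 (size ds)) + 1).+1).+1, (State (regs s2) [eta Defs.mem s2 with (1 * N + x) * N + y |-> val x y] (out s2)).
  split=> //.
  + by apply: exec_seq e1 es.
  + by move: c1; rewrite /=; clear; lia.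
  split.
    have [g1 g2 g3 g4] := h1; split; last by rewrite /= (frame_out f1).
    split=> //=.
    * by move=> i hi; rewrite (frame_var f1) ?g2 //; rewrite sz in hi; lia.
    * move=> t' x' y' x'N y'N; rewrite (frame_mem f1); case: eqP => [/cell_inj|_]; last exact: g3.
      by case.
    * move=> a hN; rewrite (frame_mem f1); case: eqP => [ea|_]; last exact: g4.
      by move: hN; rewrite ea; clear; nia.
  move=> x' y' x'N y'N; rewrite ltnS leq_eqVlt /= (frame_mem f1) => hlt.
  case: eqP => [/cell_inj [] // _ -> ->|ne] //.
  apply: h3 => //; case/orP: hlt => // /eqP ee; case: ne.
  by have [-> ->] := digit_inj y'N yN ee.
- by rewrite (corr_N hc).
- by split.
pose Inv2 j s1 := [/\ regs s1 0 = N, (forall i, i < size vs -> regs s1 (vr i) = nth 0 vs i),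
  (forall x y, x < N -> y < N -> Defs.mem s1 ((1 * N + x) * N + y) = val x y) /\
  (forall t' x y, x < N -> y < N -> Defs.mem s1 ((t'.+2 * N + x) * N + y) =
     if (t' == t) && (x * N + y < j) then val x y else tb t' x y) &
  (forall a, a < N * N -> Defs.mem s1 a = inp a) /\ out s1 = o].
have [||||t2 [s2 [e2 c2 i2 r2]]] := @exec_upto2 (size ds)
  (Store (cell t.+2 (size ds)) (Fetch (cell 1 (size ds)))) 30 Inv2 s1 NW.
- move=> k s2 i v [h1 h2 [h3 h4] [h5 h6]] hi; split=> // j hj; rewrite /= ifN_eq ?h2 //.
  by rewrite eq_sym vlt // -sz.
- move=> x y s2 xN yN [h1 h2 [h3 h4] [h5 h6]] r0 rx ry.
  have [m2 p2] := cell_val hW9 r0 rx ry xN yN.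
  have [m3 p3] := cell_val hW2 r0 rx ry xN yN.
  have vW := valW x y xN yN.
  exists (cost (cell t.+2 (size ds)) + cost (Fetch (cell 1 (size ds)))).+1,
    (State (regs s2) [eta Defs.mem s2 with (t.+2 * N + x) * N + y |-> val x y] (out s2)).
  split=> //.
    apply: exec_store; first by rewrite eval_pval // p3.
    have pf : pval s2 (Fetch (cell 1 (size ds))) = val x y.
      by rewrite -[LHS]/(Defs.mem s2 (pval s2 (cell 1 (size ds)))) p2 h3.
    rewrite eval_pval ?pf // -[pmax _ _]/(maxn (pmax s2 (cell 1 (size ds))) (pval s2 (Fetch (cell 1 (size ds))))).
    by rewrite gtn_max m2 pf; rewrite addn1 in vW; apply: ltnW.
  split=> //=.
    split=> [x' y' x'N y'N|t' x' y' x'N y'N].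
      by case: eqP => [/cell_inj|_]; [case|apply: h3].
    case: eqP => [/cell_inj|ne].
      by case=> // -[->] -> ->; rewrite eqxx ltnSn.
    rewrite h4 //; case: eqP => //= et; subst t'.
    rewrite ltnS [in RHS]leq_eqVlt; case: eqP => //= ee; case: ne.
    by have [-> ->] := digit_inj y'N yN ee.
  split=> // a hN; case: eqP => [ea|_]; last exact: h5.
  by move: hN; rewrite ea; clear; nia.
- by [].
- have [g1 g2 g3 g4] := hc1; split=> //; split=> // x y xN yN.
    by apply: i1 => //; move: xN yN; clear; nia.
  by move=> yN'; rewrite ltn0 andbF; apply: g3.
exists (t1 + t2).+1, s2; split.
- exact: exec_seq e1 e2.
- move: c1 c2; rewrite /= -[(depthE e).+2]addn2 expnD; set A := N ^ depthE e; set B := N ^ 2.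
  have [_ hA _] := pow_bounds N1 (depthE e); have [_ hB _] := pow_bounds N1 2.
  rewrite -/A -/B in hA hB * => c1 c2.
  have : 300 * B <= 300 * (A * B) by rewrite leq_mul2l leq_pmull.
  by move: c1 c2 hB; rewrite !mulnDl mulnA; clear; lia.
case: i2 => h1 h2 [h3 h4] [h5 h6]; split=> //; split=> //=.
move=> t' x y xN yN; rewrite h4 //; case: eqP => //= _.
by have -> : x * N + y < N * N by move: xN yN; clear; nia.
Qed.

Lemma fits_push ds st k : fits ds st -> k < N ->
  fits (rcons ds 1) (HState (tabs st) (rcons (vars st) k) (outs st)).
Proof. by move=> h kN; apply: bounded_rcons. Qed.

Lemma needS6 ds c : 6 <= needS td ds c.
Proof.
have need_ge ds' e : 6 <= need td ds' e.
  by apply: leq_trans (_ : degree td ds' e + 6 <= _); [exact: leq_addl|case: e => * /=; exact: leq_maxl].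
elim: c ds => [|i e|t e|c1 IH1 c2 IH2|b IH|e c1 IH1 c2 IH2|e] ds //=.
- by rewrite leq_max need_ge.
- by rewrite leq_max IH1.
- by rewrite leq_max need_ge.
Qed.

Lemma compS_correct c : forall ds st s, fits ds st -> okS td g ds c -> g <= size ds ->
  N ^ needS td ds c <= W -> corrS st s ->
  exists T s', [/\ exec W (compS (size ds) c) s T s',
    T <= costS c * N ^ depthS c & corrS (run N inp c st) s'].
Proof.
elim: c => [|i e|t e|c1 IH1 c2 IH2|b IH|e c1 IH1 c2 IH2|e] ds st s hb ok gd hW hc.
- by exists 1, s; split; [exact: exec_skip| |case: st hb hc].
- case: st hb hc => tb vs o hb [hc ho]; move: ok => /= /and4P[ig isz sc dg].
  have [t1 [s1 [e1 c1 v1 f1]]] := compE_correct N1 inp_lt 0 hb sc hW hc.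
  have bw := below_W N1 inp_lt hb sc hW; rewrite /= addn1 in bw.
  exists (t1 + 2).+1, (upd s1 (vr i) (ev N inp tb vs e)); split.
  + apply: exec_seq e1 _.
    have -> : ev N inp tb vs e = pval s1 (Reg (tr 0)) by rewrite /= v1.
    by apply: (@exec_assignP W s1 (vr i) (Reg (tr 0))); rewrite /= v1 ltnW.
  + have := @cost_add N N1 t1 0 _ 0 _ 0 _ c1 (leq0n _) (leqnn _) (leq0n _).
    by rewrite !addn0; apply: leq_trans; clear; lia.
  have sz : size vs = size ds by case: hb.
  have [g1 g2 g3 g4] := corr_frame hc (eq_ind_r (fun m => frame m 0 s s1) f1 sz).
  split; last by rewrite /= (frame_out f1).
  split=> //= j; rewrite size_set_nth sz (maxn_idPr isz) nth_set_nth /= => hj.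
  have [->|ne] := eqVneq j i; first by rewrite eqxx.
  by rewrite (negbTE (vr_neq ne)) g2 ?sz.
- by apply: compS_tab hc.
- move: ok hW => /= /andP[o1 o2] hW.
  have le1 : N ^ needS td ds c1 <= W by apply: leq_trans hW; rewrite leq_exp2l ?leq_maxl.
  have le2 : N ^ needS td ds c2 <= W by apply: leq_trans hW; rewrite leq_exp2l ?leq_maxr.
  have [t1 [s1 [e1 k1 h1]]] := IH1 ds st s hb o1 gd le1 hc.
  have [fb _] := run_keeps hb o1 gd.
  have [t2 [s2 [e2 k2 h2]]] := IH2 ds _ s1 fb o2 gd le2 h1.
  exists (t1 + t2).+1, s2; split.
  + exact: exec_seq e1 e2.
  + by apply: leq_trans (cost_add N1 k1 k2 (leq_maxl _ _) (leq_maxr _ _)); clear; lia.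
  by case: st hb hc h1 fb h2.
- case: st hb hc => tb vs o hb hc; rewrite /= in ok hW.
  have NW : N < W.
    apply: leq_trans hW; apply: leq_trans (_ : N ^ 6 <= _); last by rewrite leq_exp2l ?needS6.
    by rewrite -[ltnLHS]expn1 ltn_exp2l.
  have sz : size vs = size ds by case: hb.
  pose F st k := let: HState tb vs o := st in
      let: HState tb' vs' o' := run N inp b (HState tb (rcons vs k) o) in
      HState tb' (take (size vs) vs') o'.
  pose S j := foldl F (HState tb vs o) (iota 0 j).
  have SS j : S j.+1 = F (S j) j by rewrite /S -addn1 iotaD add0n foldl_cat.
  have fitsS j : j <= N -> fits ds (S j).
    elim: j => [|j IHj] jN; first exact: hb.
    rewrite SS; have := IHj (ltnW jN); case: (S j) => tb1 vs1 o1 f1; rewrite /F.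
    have s1 : size vs1 = size ds by case: f1.
    have [] := @run_keeps b (rcons ds 1) _ (fits_push f1 jN) ok _.
      by rewrite size_rcons ltnW.
    case: (run _ _ _ _) => tb2 vs2 o2 f2 _.
    by rewrite s1; apply: fits_pop f2.
  have ok' := ok; have gd' : g <= size (rcons ds 1) by rewrite size_rcons ltnW.
  have vlt i lv : i < size ds -> lv >= size ds -> vr lv != vr i by rewrite /vr; lia.
  have [||||t1 [s1 [e1 k1 i1 r1]]] := @exec_upto W N NW (vr (size ds)) (compS (size ds).+1 b)
    (costS b * N ^ depthS b) (fun j s1 => corrS (S j) s1) s.
  + move=> k s1 kN; have fk := fitsS k (ltnW kN).
    case Sk : (S k) fk => [tb1 vs1 o1] fk [h1 h2] r0 rk; rewrite /= in h1 h2.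
    have s1z : size vs1 = size ds by case: fk.
    have h1' : corrS (HState tb1 (rcons vs1 k) o1) s1.
      split=> //; have [g1 g2 g3 g4] := h1; split=> //= i.
      rewrite size_rcons nth_rcons s1z => hi; case: ltnP => h; first by apply: g2; rewrite s1z.
      by have -> : i = size ds; [lia|rewrite eqxx].
    have [t2 [s2 [e2 k2 [h3 h4]]]] := IH (rcons ds 1) _ s1 (fits_push fk kN) ok gd' hW h1'.
    have [fb kb] := run_keeps (fits_push fk kN) ok gd'.
    rewrite size_rcons in e2; exists t2, s2.
    (* The counter has an index that is at least [g], out of reach of the assignments in the
       body. *)
    have kS : nth 0 (vars (run N inp b (HState tb1 (rcons vs1 k) o1))) (size ds) = k.
      by rewrite kb //= nth_rcons s1z ltnn eqxx.
    have szb : size (vars (run N inp b (HState tb1 (rcons vs1 k) o1))) = (size ds).+1.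
      by case: fb => ->; rewrite size_rcons.
    split=> //.
    * rewrite SS Sk /F; case: (run _ _ _ _) h3 h4 fb szb {kb kS} => tb2 vs2 o2 /= h3 h4 fb szb.
      split=> //=; rewrite s1z; apply: corr_upd => //.
        have [g1 g2 g3 g4] := h3; split=> // i; rewrite size_takel ?szb // => hi.
        by rewrite nth_take ?g2 ?szb // ltnW.
      by move=> i; rewrite size_takel ?szb // => hi; apply: vlt.
    * exact: corr_N h3.
    * by rewrite (corr_var h3) ?szb.
  + by [].
  + by case: hc => h _; exact: corr_N h.
  + case: hc => h1 h2; split=> //; apply: corr_upd => // i hi.
    by apply: vlt => //; rewrite -sz.
  exists t1, s1; split=> //; apply: leq_trans k1 _; rewrite /= expnS.
  have [_ h _] := pow_bounds N1 (depthS b).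
  have h2 : N * 1 <= N * N ^ depthS b by rewrite leq_mul2l h orbT.
  rewrite !mulnDl [N * N ^ _]mulnC mulnA -!addnA leq_add2l.
  by move: h2 N1; clear; nia.
- move: ok hW => /= /and3P[se o1 o2] hW; case: st hb hc => tb vs o hb hc.
  have le0 : N ^ need td ds e <= W by apply: leq_trans hW; rewrite leq_exp2l ?leq_maxl.
  have le1 : N ^ needS td ds c1 <= W by apply: leq_trans hW; rewrite leq_exp2l //; clear; lia.
  have le2 : N ^ needS td ds c2 <= W by apply: leq_trans hW; rewrite leq_exp2l //; clear; lia.
  have [hc0 ho] := hc; have sz : size vs = size ds by case: hb.
  have [t0 [s0 [e0 k0 v0 f0]]] := compE_correct N1 inp_lt 0 hb se le0 hc0.
  have bw := below_W N1 inp_lt hb se le0; rewrite /= addn1 in bw.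
  have ek : eval W s0 (Reg (tr 0)) = Some (ev N inp tb vs e) by rewrite eval_pval /= v0 // ltnW.
  have hc1 : corrS (HState tb vs o) s0.
    split; last by rewrite (frame_out f0).
    exact: corr_frame hc0 (eq_ind_r (fun m => frame m 0 s s0) f0 sz).
  have cst t1 c' : t1 <= costS c' * N ^ depthS c' -> costS c' <= costS c1 + costS c2 ->
      depthS c' <= maxn (depthS c1) (depthS c2) ->
      (t0 + (1 + t1).+1).+1 <= (costE e + costS c1 + costS c2 + 50) *
        N ^ maxn (depthE e) (maxn (depthS c1) (depthS c2)).
    move=> k1 l1 l2; apply: leq_trans (_ : (costE e + costS c' + 50) *
        N ^ maxn (depthE e) (maxn (depthS c1) (depthS c2)) <= _).
      apply: leq_trans (cost_add N1 k0 k1 (leq_maxl _ _) _); first by clear; lia.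
      exact: leq_trans l2 (leq_maxr _ _).
    by rewrite leq_mul2r; apply/orP; right; move: l1; clear; lia.
  rewrite /=; have [hk|hk] : ev N inp tb vs e = 0 \/ (ev N inp tb vs e == 0) = false.
    by case: (ev N inp tb vs e) => [|k]; [left|right].
    have [t1 [s1 [e1 k1 h1]]] := IH2 ds _ s0 hb o2 gd le2 hc1.
    exists (t0 + (1 + t1).+1).+1, s1; split.
    * by apply: exec_seq e0 _; apply: exec_if ek _; rewrite hk.
    * by apply: cst k1 (leq_addl _ _) (leq_maxr _ _).
    by rewrite hk.
  have [t1 [s1 [e1 k1 h1]]] := IH1 ds _ s0 hb o1 gd le1 hc1.
  exists (t0 + (1 + t1).+1).+1, s1; split.
  * by apply: exec_seq e0 _; apply: exec_if ek _; rewrite hk.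
  * by apply: cst k1 (leq_addr _ _) (leq_maxl _ _).
  by rewrite hk.
case: st hb hc => tb vs o hb [hc ho]; rewrite /= in ok hW.
have [t1 [s1 [e1 c1 v1 f1]]] := compE_correct N1 inp_lt 0 hb ok hW hc.
have bw := below_W N1 inp_lt hb ok hW; rewrite /= addn1 in bw.
have sz : size vs = size ds by case: hb.
exists (t1 + 2).+1, (State (regs s1) (Defs.mem s1) (rcons (out s1) (ev N inp tb vs e))); split.
- apply: exec_seq e1 _; apply: (@exec_output W s1 (Reg (tr 0))).
  by rewrite eval_pval /= v1 // ltnW.
- have := @cost_add N N1 t1 0 _ 0 _ 0 _ c1 (leq0n _) (leqnn _) (leq0n _).
  by rewrite !addn0; apply: leq_trans; clear; lia.
have [g1 g2 g3 g4] := corr_frame hc (eq_ind_r (fun m => frame m 0 s s1) f1 sz).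
by split; last by rewrite /= (frame_out f1) ho.
Qed.

End CompileStm.

(** * Labelling components by their least key *)

(* [mark]: 0 for an unseen pair, 1 for a pending one, 2 for a scanned one. *)
Record search := Search {
  mark : nat * nat -> nat;
  parent : nat * nat -> nat * nat;
  label : nat * nat -> nat }.

Section Search.

Variables (N : nat) (fp : pred (nat * nat)) (mv : rel (nat * nat)) (key : nat * nat -> nat).
Definition in_range (p : nat * nat) := (p.1 < N) && (p.2 < N).
Hypothesis fp_range : forall p, fp p -> in_range p.
Hypothesis mv_fp : forall p q, mv p q -> fp p && fp q.
Hypothesis mv_refl : forall p, fp p -> mv p p.
Hypothesis mv_sym : forall p q, mv p q -> mv q p.
Hypothesis key_inj : forall p q, in_range p -> in_range q -> key p = key q -> p = q.

(** As moves are reflexive, a fresh root falls under the same rule as its neighbours and becomes its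
    own parent. *)
Definition advance (c : nat * nat) (r : nat) (s s' : search) : Prop :=
  forall p, in_range p -> let new := (mark s p == 0) && mv c p in
    [/\ mark s' p = if p == c then 2 else if new then 1 else mark s p,
        parent s' p = if new then c else parent s p
      & label s' p = if new then r else label s p].

(** The idle step, once everything has been seen, allows a loop of fixed length. *)
Definition search_step (s s' : search) : Prop :=
  (exists c, [/\ in_range c, mark s c = 1 & advance c (label s c) s s']) \/
  (forall p, in_range p -> mark s p <> 1) /\
  ((exists c, [/\ fp c, mark s c = 0,
      forall p, fp p -> mark s p = 0 -> key c <= key p & advance c (key c) s s']) \/
   (forall p, fp p -> mark s p <> 0) /\
   (forall p, in_range p ->
      [/\ mark s' p = mark s p, parent s' p = parent s p & label s' p = label s p])).

Local Notation MV := (fun p q => mv p q : Prop).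

(** A step deepens the forest by at most one level, so after [k] steps every seen pair reaches its
    root by [k] parent steps; surplus ones stay at the root. *)
Definition rooted (k : nat) (s : search) (p : nat * nat) : Prop :=
  exists rho, [/\ iter k (parent s) p = rho, parent s rho = rho,
    label s p = key rho /\ label s rho = key rho, star MV p rho /\ mark s rho <> 0
    & forall q, star MV p q -> key rho <= key q].

Definition scanned (s : search) := #|[pred p : 'I_N * 'I_N | mark s (val p.1, val p.2) == 2]|.

Definition search_inv (k : nat) (s : search) : Prop :=
  [/\ forall p, in_range p -> mark s p <> 0 -> fp p,
      forall p, in_range p -> mark s p <= 2,
      forall p q, in_range p -> mark s p = 2 -> mv p q -> mark s q <> 0,
      forall p, in_range p -> mark s p <> 0 ->
        [/\ mv p (parent s p), mark s (parent s p) <> 0 & rooted k s p]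
    & k <= scanned s \/ forall p, fp p -> mark s p = 2].

Lemma star_fp p q : star MV p q -> fp p -> fp q.
Proof. by elim=> // {}p q1 q2 _ _ /mv_fp/andP[]. Qed.

(** The two hypotheses on [r] are the two ways to scan: a pending pair passes on its label, a new
    root its own key. *)
Lemma advance_inv k c r s s' : search_inv k s -> advance c r s s' -> fp c -> mark s c <> 2 ->
  (mark s c = 1 -> r = label s c) ->
  (mark s c = 0 -> r = key c /\ forall q, star MV c q -> key c <= key q) ->
  search_inv k.+1 s'.
Proof.
move=> [i1 i2 i3 i4 i5] adv fc c2 r1 r0; have cR := fp_range fc.
have seen p : in_range p -> mark s p <> 0 -> 
    [/\ mark s' p <> 0, parent s' p = parent s p & label s' p = label s p].
  move=> pR np; have [-> -> ->] := adv p pR; move/eqP/negbTE: (np) => -> /=.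
  by split=> //; case: ifP.
have par_seen p : in_range p -> mark s p <> 0 -> in_range (parent s p) /\ mark s (parent s p) <> 0.
  by move=> pR np; have [h1 h2 _] := i4 p pR np; split=> //; case/mv_fp/andP: h1 => _ /fp_range.
have it_seen j p : in_range p -> mark s p <> 0 ->
    [/\ iter j (parent s') p = iter j (parent s) p, in_range (iter j (parent s) p) &
    mark s (iter j (parent s) p) <> 0].
  move=> pR np; elim: j => //= j [-> h1 h2]; have [_ -> _] := seen _ h1 h2.
  by have [? ?] := par_seen _ h1 h2.
have rooted_old p : in_range p -> mark s p <> 0 -> rooted k.+1 s' p.
  move=> pR np; have [_ _ [rho [h1 h2 [h3 h4] [h5 h6] h7]]] := i4 p pR np.
  have [e1 rR _] := it_seen k p pR np; rewrite h1 in e1 rR.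
  have [g1 g2 g3] := seen rho rR h6; have [_ _ g4] := seen p pR np.
  by exists rho; split=> //; rewrite ?g4 ?g3 ?g2 //= e1 g2.
have c_new : mark s c = 0 -> [/\ parent s' c = c, label s' c = key c & mark s' c = 2].
  move=> m0; have [-> -> ->] := adv c cR; rewrite m0 /= mv_refl // eqxx.
  by case: (r0 m0).
have c_seen : mark s' c <> 0 by have [-> _ _] := adv c cR; rewrite eqxx.
have rooted_new p : in_range p -> mark s p = 0 -> mv c p -> rooted k.+1 s' p.
  move=> pR m0 cp; have [_ pp lp] := adv p pR; rewrite m0 /= cp in pp lp.
  have pc : star MV p c by apply: star_step (star_refl _ _) _; exact: mv_sym.
  have cp' : star MV c p by apply: star_step (star_refl _ _) _.
  have [mc|mc] : mark s c = 0 \/ mark s c <> 0 by case: (mark s c); [left|right].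
    have [rk mn] := r0 mc; have [q1 q2 q3] := c_new mc.
    exists c; split=> //; first by rewrite iterSr pp; elim: (k) => //= j ->.
    - by rewrite lp rk q2.
    - by move=> q pq; apply: mn; apply: star_trans cp' pq.
  have [_ _ [rho [h1 h2 [h3 h4] [h5 h6] h7]]] := i4 c cR mc.
  have [e1 rR _] := it_seen k c cR mc; rewrite h1 in e1 rR.
  have [g1 g2 g3] := seen rho rR h6.
  have m1 : mark s c = 1 by move: (i2 c cR) c2 mc; clear; lia.
  exists rho; split=> //.
  - by rewrite iterSr pp.
  - by rewrite g2.
  - by rewrite lp g3 (r1 m1).
  - by split=> //; apply: star_trans pc h5.
  - by move=> q pq; apply: h7; apply: star_trans cp' pq.
split.
- move=> p pR; have [-> _ _] := adv p pR; case: eqP => [->//|_].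
  case: ifP => [/andP[_ /mv_fp/andP[]]//|_]; exact: i1.
- move=> p pR; have [-> _ _] := adv p pR; case: eqP => // _; case: ifP => // _; exact: i2.
- move=> p q pR; have [-> _ _] := adv p pR; case: eqP => [-> _ cq|_].
    have qR : in_range q by apply: fp_range; case/andP: (mv_fp cq).
    have [-> _ _] := adv q qR; case: eqP => // _; rewrite cq andbT; case: eqP => // h.
  case: ifP => // _ m2 pq; have qR : in_range q by apply: fp_range; case/andP: (mv_fp pq).
  by have [] := seen q qR (i3 p q pR m2 pq).
- move=> p pR; have [m0|mp] : mark s p = 0 \/ mark s p <> 0 by case: (mark s p); [left|right].
    have [-> -> _] := adv p pR; rewrite m0 /=.
    case: (boolP (mv c p)) => [cp _|ncp]; first by split; [exact: mv_sym| |apply: rooted_new].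
    by case: eqP => // e; move: ncp; rewrite e mv_refl.
  move=> _; have [_ -> _] := seen p pR mp; have [h1 h2 _] := i4 p pR mp.
  have [h3 h4] := par_seen p pR mp; have [h5 _ _] := seen _ h3 h4.
  by split=> //; apply: rooted_old.
case: i5 => [hd|al]; last by case: c2; apply: al.
left; apply: leq_ltn_trans hd _; apply: proper_card; apply/properP; split.
  apply/subsetP => -[a b]; rewrite !inE => /eqP; set p := (val _, val _) => m2.
  have pR : in_range p by rewrite /in_range /= !ltn_ord.
  by have [-> _ _] := adv _ pR; case: (p =P c) => // _; rewrite m2.
have [c1N c2N] := andP cR; exists (Ordinal c1N, Ordinal c2N); rewrite inE /= -surjective_pairing.
  by have [-> _ _] := adv c cR; rewrite eqxx.
by apply/eqP.
Qed.

Lemma search_step_inv k s s' : search_inv k s -> search_step s s' -> search_inv k.+1 s'.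
Proof.
move=> inv [[c [cR c1 adv]]|[nop]].
  have [i1 _ _ _ _] := inv.
  apply: advance_inv inv adv _ _ _ _; rewrite ?c1 //; apply: i1; rewrite ?c1 //.
have [i1 i2 i3 i4 i5] := inv.
case=> [[c [fc m0 mn adv]]|[al eqs]].
  (* With nothing pending, the seen pairs form whole components. Hence the component of an unseen
     pair is unseen, and the least unseen key is the least key of its component. *)
  have unseen a q : star MV a q -> fp a -> mark s a = 0 -> mark s q = 0.
    elim=> // {}a q1 q2 st IH m12 fa a0; have m1 := IH fa a0; have f1 := star_fp st fa.
    have [//|m2] : mark s q2 = 0 \/ mark s q2 <> 0 by case: (mark s q2); [left|right].
    have f2 : fp q2 by case/andP: (mv_fp m12).
    have m2' : mark s q2 = 2 by move: (i2 _ (fp_range f2)) (nop _ (fp_range f2)) m2; clear; lia.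
    by case: (i3 _ q1 (fp_range f2) m2' (mv_sym m12)).
  apply: (advance_inv inv adv fc); rewrite ?m0 // => _; split=> // q st.
  by apply: mn; [apply: star_fp st fc|apply: unseen st fc m0].
have all2 p : fp p -> mark s p = 2.
  move=> f; move: (i2 _ (fp_range f)) (nop _ (fp_range f)) (al _ f); clear; lia.
have mk p : in_range p -> mark s' p = mark s p by move=> /eqs[].
have pk p : in_range p -> parent s' p = parent s p by move=> /eqs[].
have lk p : in_range p -> label s' p = label s p by move=> /eqs[].
have qR p q : mv p q -> in_range q by case/mv_fp/andP => _ /fp_range.
split.
- by move=> p pR; rewrite mk //; apply: i1.
- by move=> p pR; rewrite mk //; apply: i2.
- by move=> p q pR; rewrite mk // => m2 pq; rewrite mk; [apply: i3 pq|apply: qR pq].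
- move=> p pR; rewrite mk // pk // => mp; have [h1 h2 [rho [g1 g2 [g3 g4] [g5 g6] g7]]] := i4 p pR mp.
  have itR j : in_range (iter j (parent s) p) /\ mark s (iter j (parent s) p) <> 0.
    elim: j => //= j [h3 h4]; have [h5 h6 _] := i4 _ h3 h4; split=> //; exact: qR h5.
  have its j : iter j (parent s') p = iter j (parent s) p.
    by elim: j => //= j ->; rewrite pk //; case: (itR j).
  have rR : in_range rho by rewrite -g1; case: (itR k).
  split=> //; first by rewrite mk //; apply: qR h1.
  exists rho; rewrite its /= g1 g2 pk // !lk // mk //.
right=> p f; rewrite mk ?all2 //; exact: fp_range.
Qed.

Lemma search_inv0 s : (forall p, in_range p -> mark s p = 0) -> search_inv 0 s.
Proof.
move=> h0; split=> //; try by move=> p pR; rewrite h0.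
- by move=> p q pR; rewrite h0.
- by left.
Qed.

Lemma search_complete S : search_inv (N * N) S ->
  forall p, fp p -> [/\ mv p (parent S p), rooted (N * N) S p &
     forall q, star MV p q -> label S p = label S q].
Proof.
case=> i1 i2 i3 i4 i5.
have all2 p : fp p -> mark S p <> 0.
  move=> f; case: i5 => [hd|al]; last by rewrite al.
  have pR := fp_range f; have [p1 p2] := andP pR.
  have : [pred q : 'I_N * 'I_N | mark S (val q.1, val q.2) == 2] =i predT.
    apply/subset_cardP; last by apply/subsetP.
    apply/eqP; rewrite eqn_leq max_card /=; move: hd.
    by rewrite /scanned card_prod !card_ord.
  by move=> /(_ (Ordinal p1, Ordinal p2)); rewrite !inE /= -surjective_pairing => /eqP ->.
move=> p f; have [h1 h2 h3] := i4 p (fp_range f) (all2 p f); split=> // q pq.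
have fq := star_fp pq f; have [_ _ h4] := i4 q (fp_range fq) (all2 q fq).
case: h3 => rho [_ _ [-> _] [g1 _] g2]; case: h4 => rho' [_ _ [-> _] [g1' _] g2'].
have qp : star MV q p by apply: star_sym pq => a b; exact: mv_sym.
apply/eqP; rewrite eqn_leq g2 ?g2' //; first by apply: star_trans qp g1.
by apply: star_trans pq g1'.
Qed.

End Search.

(** * The recognition program *)

Definition eNot a := HBin Defs.Sub (HLit 1) a.
Definition eLt a b := eNot (HBin Defs.Sub (HBin Add a (HLit 1)) b).
Definition eEq a b := eNot (HBin Add (HBin Defs.Sub a b) (HBin Defs.Sub b a)).
Definition eAnd a b := HBin Mul a b.
Definition eOr a b := eNot (eAnd (eNot a) (eNot b)).
Definition eImp a b := eNot (eAnd a (eNot b)).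
Definition eB a := eNot (eNot a).
Definition eEx a := eB (HFold true (eB a)).
Definition eAll a := eNot (eEx (eNot a)).
Definition eFind a := HFold false a.
Definition eSum a := HFold true a.
Definition eAdd a b := HBin Add a b.
Definition eSub a b := HBin Defs.Sub a b.
Definition eMul a b := HBin Mul a b.

Section Macros.

Variables (N : nat) (inp : nat -> nat).
Local Notation ev := (ev N inp).

Definition tv tb vs e : bool := ev tb vs e != 0.

Lemma ev_not tb vs a : ev tb vs (eNot a) = ~~ tv tb vs a.
Proof. by rewrite /tv /=; case: (ev _ _ _). Qed.

Lemma tv_not tb vs a : tv tb vs (eNot a) = ~~ tv tb vs a.
Proof. by rewrite {1}/tv ev_not; case: (tv _ _ _). Qed.

Lemma ev_B tb vs a : ev tb vs (eB a) = tv tb vs a.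
Proof. by rewrite /eB ev_not tv_not negbK. Qed.

Lemma tv_B tb vs a : tv tb vs (eB a) = tv tb vs a.
Proof. by rewrite /eB !tv_not negbK. Qed.

Lemma tv_lt tb vs a b : tv tb vs (eLt a b) = (ev tb vs a < ev tb vs b).
Proof. by rewrite /eLt tv_not /tv /=; lia. Qed.

Lemma tv_eq tb vs a b : tv tb vs (eEq a b) = (ev tb vs a == ev tb vs b).
Proof. by rewrite /eEq tv_not /tv /=; lia. Qed.

Lemma tv_and tb vs a b : tv tb vs (eAnd a b) = tv tb vs a && tv tb vs b.
Proof. by rewrite /tv /= muln_eq0 negb_or. Qed.

Lemma tv_or tb vs a b : tv tb vs (eOr a b) = tv tb vs a || tv tb vs b.
Proof. by rewrite /eOr tv_not tv_and !tv_not negb_and !negbK. Qed.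

Lemma tv_imp tb vs a b : tv tb vs (eImp a b) = (tv tb vs a ==> tv tb vs b).
Proof. by rewrite /eImp tv_not tv_and tv_not negb_and negbK implybE. Qed.

Lemma ev_sum tb vs a : ev tb vs (eSum a) = \sum_(k < N) ev tb (rcons vs k) a.
Proof. exact: foldl_sum. Qed.

Lemma ev_find tb vs a : ev tb vs (eFind a) = find (fun k => tv tb (rcons vs k) a) (iota 0 N).
Proof. exact: foldl_find. Qed.

Lemma tv_ex tb vs a : tv tb vs (eEx a) = has (fun k => tv tb (rcons vs k) a) (iota 0 N).
Proof.
rewrite /eEx tv_B /tv -/(eSum (eB a)) ev_sum sum_nat_eq0 negb_forall.
apply/existsP/hasP => [[k]|[k]].
  rewrite ev_B => h; exists (val k); first by rewrite mem_iota ltn_ord.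
  by move: h; rewrite /tv; case: (_ != 0).
rewrite mem_iota add0n => /andP[_ kN] h; exists (Ordinal kN).
by rewrite ev_B /tv /= h.
Qed.

Lemma tv_all tb vs a : tv tb vs (eAll a) = all (fun k => tv tb (rcons vs k) a) (iota 0 N).
Proof.
rewrite /eAll tv_not tv_ex -all_predC; apply: eq_all => k /=.
by rewrite tv_not negbK.
Qed.

Lemma tv_get tb vs t a b : tv tb vs (HGet t a b) = (tb t (clamp N (ev tb vs a)) (clamp N (ev tb vs b)) != 0).
Proof. by []. Qed.

Lemma ev_if tb vs c a b : ev tb vs (HIf c a b) = if tv tb vs c then ev tb vs a else ev tb vs b.
Proof. by rewrite /tv /=; case: (_ == 0). Qed.

Lemma tv_if tb vs c a b : tv tb vs (HIf c a b) = if tv tb vs c then tv tb vs a else tv tb vs b.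
Proof. by rewrite /tv ev_if -/(tv tb vs c); case: (tv _ _ _). Qed.

Definition tvE := (tv_not, tv_B, tv_lt, tv_eq, tv_and, tv_or, tv_imp, tv_ex, tv_all, tv_get, tv_if).

End Macros.

Definition tADJ := 0. Definition tTW := 1. Definition tREP := 2. Definition tSUB := 3.
Definition tSPAN := 4. Definition tPLE := 5. Definition tSEL := 6. Definition tFP := 7.
Definition tMARK := 8. Definition tPAR := 9. Definition tROOT := 10. Definition tNEW := 11.
Definition tO := 12. Definition tSIDE := 13. Definition tPL := 14. Definition tPR := 15.
Definition tBAR := 16. Definition tARCS := 17. Definition tARCT := 18. Definition tCNT := 19.
Definition tREPOF := 20.

(** Global variables: the vertex count; [z] and [bar z]; the pair being scanned and the label it
    passes on; the candidate for a new root, in exchanged numbering; a root sharing its label with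
    its reversal; the coded position of a climb. *)
Notation vn := (HVar 0). Notation vz := (HVar 1). Notation vzb := (HVar 2).
Notation vcx := (HVar 3). Notation vcy := (HVar 4). Notation vrt := (HVar 5).
Notation vrx := (HVar 6). Notation vry := (HVar 7). Notation vca := (HVar 8).
Notation vcb := (HVar 9). Notation vcur := (HVar 10).
Definition nglobals := 11.

Notation X := (HVar 11). Notation Y := (HVar 12). Notation K := (HVar 13).
Notation get t a b := (HGet t a b).
Notation get1 t a := (HGet t a (HLit 0)).

Definition eVx a := eLt a vn.
Definition eBar a := HIf (eLt a vn) (eAdd a vn) (eSub a vn).
Definition ePle a b := get tPLE a b.
Definition eDj a b := ePle a (eBar b).
Definition eNi a b := eAnd (eNot (ePle a b)) (eNot (ePle b a)).
Definition eSw a := HIf (eEq a (HLit 0)) vzb (HIf (eEq a vzb) (HLit 0) a).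
Definition eVz a := eAnd (get1 tSEL a) (eNi vz a).

Definition bADJ := eAnd (eAnd (eVx X) (eVx Y))
  (HIn (eAdd (HLit 1) (eAdd (eMul X vn) Y))).
Definition cADJ := HTab tADJ bADJ.
Definition bTW := eAll (eImp (eVx K) (eEq (eB (get tADJ X K)) (eB (get tADJ Y K)))).
Definition cTW := HTab tTW bTW.
Definition bREP := eAnd (eVx X) (eAnd
  (eEx (eAnd (eVx K) (eNot (get tADJ X K))))
  (eNot (eEx (eAnd (eLt K X) (get tTW K X))))).
Definition cREP := HTab tREP bREP.
Definition bSUB := eAll (eImp (eAnd (get1 tREP K) (get tADJ X K)) (get tADJ Y K)).
Definition cSUB := HTab tSUB bSUB.
Definition bSPAN := eAll (eImp (get1 tREP K)
  (eAnd (eOr (get tADJ Y K) (get tSUB K X)) (eOr (get tADJ X K) (get tSUB K Y)))).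
Definition cSPAN := HTab tSPAN bSPAN.
Definition bPLE := HIf (eVx X)
  (HIf (eVx Y) (get tSUB X Y) (eNot (get tADJ X (eSub Y vn))))
  (HIf (eVx Y) (get tSPAN (eSub X vn) Y) (get tSUB (eSub Y vn) (eSub X vn))).
Definition cPLE := HTab tPLE bPLE.
Definition bSEL := HIf (eVx X) (get1 tREP X)
  (eAnd (eAnd (eLt X (eAdd vn vn)) (get1 tREP (eSub X vn)))
    (eNot (eEx (eAnd (get1 tREP K) (eAnd (eNot (get tADJ (eSub X vn) K)) (get tSPAN (eSub X vn) K)))))).
Definition cSEL := HTab tSEL bSEL.
Definition cZ := HSet 1 (eFind (eAnd (get1 tSEL X)
  (eNot (eEx (eAnd (get1 tSEL Y) (eAnd (eNot (eEq Y X)) (ePle Y X))))))).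
Definition cZB := HSet 2 (eFind (eAnd (get1 tSEL X) (eAnd (ePle X (eBar vz)) (ePle (eBar vz) X)))).
Definition bFP := eAnd (eVz X) (eAnd (eVz Y) (eNi X Y)).
Definition cFP := HTab tFP bFP.

Definition c_pre := HSeq (HSet 0 (HIn (HLit 0))) (HSeq cADJ (HSeq cTW (HSeq cREP (HSeq cSUB
  (HSeq cSPAN (HSeq cPLE (HSeq cSEL (HSeq cZ (HSeq cZB cFP))))))))).

(** Inside the double loop of the search, levels 11 and 12 belong to the two counters. *)
Notation X2 := (HVar 13). Notation Y2 := (HVar 14).

Definition eCode a b := eAdd (eMul a HN) b.
Definition eMove2 c d y := eAnd (eNot (eDj d y))
  (eImp (eNi d y) (eAnd (eOr (eDj c d) (eDj c y)) (eOr (eDj vz d) (eDj vz y)))).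
Definition eMove := eAnd (get tFP X2 Y2) (eOr
  (eAnd (eEq X2 vcx) (eMove2 vcx vcy Y2)) (eAnd (eEq Y2 vcy) (eMove2 vcy vcx X2))).

Definition eFresh a b := eAnd (get tFP (eSw a) (eSw b)) (eNot (get tMARK (eSw a) (eSw b))).

(** Stored in a table of its own, because parents, labels and marks must all be updated with respect
    to the marks before the scan. *)
Definition bNEW := eAnd (eNot (get tMARK X2 Y2)) eMove.
Definition bPAR := HIf (get tNEW X2 Y2) (eCode vcx vcy) (get tPAR X2 Y2).
Definition bROOT := HIf (get tNEW X2 Y2) vrt (get tROOT X2 Y2).
Definition bMARK := HIf (eAnd (eEq X2 vcx) (eEq Y2 vcy)) (HLit 2)
  (HIf (get tNEW X2 Y2) (HLit 1) (get tMARK X2 Y2)).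

(** A pending pair and a new root are scanned by the same commands; [vcx] still equal to [N] signals
    that nothing is left. *)
Definition c_body :=
  HSeq (HSet 3 (eFind (eLt (eFind (eEq (get tMARK X2 Y2) (HLit 1))) HN)))
  (HSeq (HSet 4 (eFind (eEq (get tMARK vcx X2) (HLit 1))))
  (HSeq (HIfS (eLt vcx HN) (HSet 5 (get tROOT vcx vcy))
    (HSeq (HSet 6 (eFind (eLt (eFind (eFresh X2 Y2)) HN)))
    (HSeq (HSet 7 (eFind (eFresh vrx X2)))
    (HIfS (eLt vrx HN)
      (HSeq (HSet 3 (eSw vrx)) (HSeq (HSet 4 (eSw vry)) (HSet 5 (eCode vrx vry))))
      HSkip))))
  (HIfS (eLt vcx HN)
    (HSeq (HTab tNEW bNEW)
    (HSeq (HTab tPAR bPAR)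
    (HSeq (HTab tROOT bROOT)
    (HTab tMARK bMARK))))
    HSkip))).

Definition c_search := HFor (HFor c_body).

Definition eConf a b := eAnd (get tFP a b) (eAnd (eEq (get tPAR a b) (eCode a b))
  (eEq (get tROOT a b) (get tROOT b a))).
Definition cCA := HSet 8 (eFind (eLt (eFind (eConf X Y)) HN)).
Definition cCB := HSet 9 (eFind (eConf vca X)).
Definition bO := eAnd (get tFP X Y) (eLt (get tROOT X Y) (get tROOT Y X)).
Definition cO := HTab tO bO.
Definition bSIDE := eAnd (eVz X) (eOr (eDj vz X) (get tO vzb X)).
Definition cSIDE := HTab tSIDE bSIDE.
Definition bPL := eSum (HIf (get1 tSIDE K)
  (eAdd (eB (eOr (get tO K X) (eAnd (ePle X K) (eNot (eEq K X)))))
        (eB (eAnd (get tO K X) (eDj K X)))) (HLit 0)).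
Definition cPL := HTab tPL bPL.
Definition bPR := eSum (HIf (get1 tSIDE K)
  (eAdd (eB (eOr (get tO K X) (eAnd (ePle K X) (eNot (eEq K X)))))
        (eNot (eAnd (get tO X K) (eDj X K)))) (HLit 0)).
Definition cPR := HTab tPR bPR.
Definition bBAR := eFind (eAnd (get1 tSEL K) (eAnd (ePle K (eBar X)) (ePle (eBar X) K))).
Definition cBAR := HTab tBAR bBAR.
Definition bARCS := HIf (get1 tSIDE X) (eMul (HLit 2) (get1 tPL X))
  (eAdd (eMul (HLit 2) (get1 tPR (get1 tBAR X))) (HLit 1)).
Definition cARCS := HTab tARCS bARCS.
(** At most [2 * n] vertices yield positions up to [4 * n], and a doubled position plus 2 is then
    below [4 * N = 8 * n + 8]. *)
Definition eL := eMul (HLit 4) HN.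
Definition bARCT := HIf (get1 tSIDE X) (eMul (HLit 2) (get1 tPR X))
  (eSub (eAdd (eMul (HLit 2) (get1 tPL (get1 tBAR X))) eL) (HLit 1)).
Definition cARCT := HTab tARCT bARCT.
Definition bCNT := eSum (eB (eAnd (eLt K X) (get1 tSEL K))).
Definition cCNT := HTab tCNT bCNT.
Definition bREPOF := eFind (eAnd (get1 tREP K) (get tTW K X)).
Definition cREPOF := HTab tREPOF bREPOF.

Definition c_post := HSeq cCA (HSeq cCB (HSeq cO (HSeq cSIDE (HSeq cPL (HSeq cPR (HSeq cBAR
  (HSeq cARCS (HSeq cARCT (HSeq cCNT cREPOF))))))))).

Definition eQ := HBin Div vcur HN.
Definition eR := eSub vcur (eMul eQ HN).
(** The output lists one walk after the other on a write-only tape, so the climb is repeated for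
    each coordinate. After the [N * N] parent steps the last vertex is still to be written. *)
Definition c_walk (first : bool) :=
  HSeq (HSet 10 (eCode vcb vca))
  (HSeq (HFor (HFor (HSeq (HOut (get1 tCNT (if first then eQ else eR))) (HSet 10 (get tPAR eQ eR)))))
  (HOut (get1 tCNT (if first then eQ else eR)))).
Definition eNonuniv := eEx (eAnd (eLt Y vn) (eNot (get tADJ X Y))).

Definition c_arcs := HSeq (HOut (HLit 1)) (HSeq (HOut eL)
  (HSeq (HFor (HIfS (eVx X) (HOut (HIf eNonuniv (get1 tARCS (get1 tREPOF X)) (HLit 0))) HSkip))
        (HFor (HIfS (eVx X) (HOut (HIf eNonuniv (get1 tARCT (get1 tREPOF X)) (eSub eL (HLit 1)))) HSkip)))).

Definition c_obstruction :=
  HSeq (HOut (HLit 0)) (HSeq (HOut (eSum (eB (get1 tREP X)))) (HSeq (HOut (eSum (eB (get1 tSEL X))))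
  (HSeq (HFor (HIfS (get1 tREP X) (HOut X) HSkip))
  (HSeq (HFor (HIfS (get1 tREP X) (HOut (get1 tCNT X)) HSkip))
  (HSeq (HFor (HIfS (get1 tSEL X) (HFor (HIfS (get1 tSEL Y) (HOut (eNot (eDj X Y))) HSkip)) HSkip))
  (HSeq (HOut (get1 tCNT vz)) (HSeq (HOut (get1 tCNT vcb)) (HSeq (HOut (get1 tCNT vca))
  (HSeq (HOut (eAdd (eMul HN HN) (HLit 1))) (HSeq (HOut (eAdd (eMul HN HN) (HLit 1)))
  (HSeq (c_walk true) (c_walk false)))))))))))).

Definition recognizer := HSeq c_pre (HSeq c_search (HSeq c_post
  (HIfS (eLt vca HN) c_obstruction c_arcs))).

(* Variables and table entries stay below these powers of [N]. *)
Definition var_degrees : seq nat := [:: 1; 2; 2; 3; 3; 9; 3; 3; 2; 2; 9].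
Definition tab_degrees (t : nat) : nat := nth 1 
  [:: 3; 1; 3; 1; 1; 3; 6; 20; 2; 9; 9; 50; 25; 50; 6; 6; 2; 20; 20; 4; 2] t.

Lemma recognizer_ok : okS tab_degrees nglobals var_degrees recognizer.
Proof. by vm_compute. Qed.

(** The exponent of the running time: passes over all pairs, of depth 2, inside the two loops of the
    search. *)
Lemma recognizer_depth : depthS recognizer = 4.
Proof. by vm_compute. Qed.

Lemma eq_all_iota N (p q : pred nat) : (forall k, k < N -> p k = q k) ->
  all p (iota 0 N) = all q (iota 0 N).
Proof. by move=> h; apply: eq_in_all => k; rewrite mem_iota => /andP[_]; apply: h. Qed.

Lemma eq_has_iota N (p q : pred nat) : (forall k, k < N -> p k = q k) ->
  has p (iota 0 N) = has q (iota 0 N).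
Proof. by move=> h; apply: eq_in_has => k; rewrite mem_iota => /andP[_]; apply: h. Qed.

Lemma eq_find_iota N (p q : pred nat) : (forall k, k < N -> p k = q k) ->
  find p (iota 0 N) = find q (iota 0 N).
Proof.
move=> h; elim: N h => // N IH h.
rewrite -addn1 iotaD add0n !find_cat /= h // IH => [|k kN]; last by apply: h; apply: ltnW.
by rewrite (eq_has_iota (q := q)) // => k kN; apply: h; apply: ltnW.
Qed.

(** * The preprocessing tables as functions on numbers *)

Section Preprocessing.

Variables (n : nat) (inp : nat -> nat).
Local Notation N := (2 * n + 2).
Local Notation R := (iota 0 N).
Hypothesis inp0 : inp 0 = n.

Definition GN x y := [&& x < n, y < n & inp (1 + (x * n + y)) != 0].
Definition twN x y := all (fun k => (k < n) ==> (GN x k == GN y k)) R.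
Definition repN x := [&& x < n, has (fun k => (k < n) && ~~ GN x k) R &
  ~~ has (fun k => (k < x) && twN k x) R].
Definition subN x y := all (fun k => repN k && GN x k ==> GN y k) R.
Definition spanN x y := all (fun k => repN k ==>
  (GN y k || subN k x) && (GN x k || subN k y)) R.
(* Vertex [u] has number [u] and its circular partner [n + u]. *)
Definition barN a := if a < n then a + n else a - n.
Definition pleN a b := if a < n then (if b < n then subN a b else ~~ GN a (b - n))
  else (if b < n then spanN (a - n) b else subN (b - n) (a - n)).
Definition selN a := if a < n then repN a else
  (a < n + n) && repN (a - n) &&
  ~~ has (fun k => repN k && (~~ GN (a - n) k && spanN (a - n) k)) R.
Definition djN a b := pleN a (barN b).
Definition niN a b := ~~ pleN a b && ~~ pleN b a.
Definition zN := find (fun x => selN x && ~~ has (fun y => selN y && (~~ (y == x) && pleN y x)) R) R.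
Definition zbN := find (fun x => selN x && (pleN x (barN zN) && pleN (barN zN) x)) R.
Definition vzN a := selN a && niN zN a.
Definition fpN a b := vzN a && (vzN b && niN a b).

Definition tabN (t : nat) : rel nat :=
  nth (fun _ _ => false) [:: GN; twN; fun x _ => repN x; subN; spanN; pleN;
    fun x _ => selN x; fpN] t.

Definition tab_ok (tb : table) (t : nat) : Prop :=
  forall x y, x < N -> y < N -> (tb t x y != 0) = tabN t x y.

Lemma barN_lt a : a < n + n -> barN a < n + n.
Proof. by rewrite /barN; case: ifP => h; lia. Qed.

Variables (v1 v2 v3 v4 v5 v6 v7 v8 v9 v10 : nat).
Local Notation vs := [:: n; v1; v2; v3; v4; v5; v6; v7; v8; v9; v10].

Lemma adj_ok tb x y : x < N -> y < N ->
  tv N inp tb (rcons (rcons vs x) y) bADJ = GN x y.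
Proof.
move=> xN yN; rewrite /bADJ /eVx !tvE /= /GN -andbA; case: ltnP => //= xn; case: ltnP => //= yn.
by rewrite /tv /= clamp_id //; nia.
Qed.

Lemma tw_ok tb x y : tab_ok tb tADJ -> x < N -> y < N ->
  tv N inp tb (rcons (rcons vs x) y) bTW = twN x y.
Proof.
move=> ok xN yN; rewrite /bTW /eVx tv_all; apply: eq_all_iota => k kN.
rewrite !tvE !ev_B !tvE /= !clamp_id // !ok //=; change (tabN tADJ) with GN.
by case: (GN x k); case: (GN y k).
Qed.

Lemma rep_ok tb x y : tab_ok tb tADJ -> tab_ok tb tTW -> x < N -> y < N ->
  tv N inp tb (rcons (rcons vs x) y) bREP = repN x.
Proof.
move=> ok1 ok2 xN yN; rewrite /bREP /eVx !tvE /= /repN; congr [&& _, _ & ~~ _].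
  by apply: eq_has_iota => k kN; rewrite !tvE /= !clamp_id // !ok1.
by apply: eq_has_iota => k kN; rewrite !tvE /= !clamp_id // !ok2.
Qed.

Lemma sub_ok tb x y : tab_ok tb tADJ -> tab_ok tb tREP -> x < N -> y < N ->
  tv N inp tb (rcons (rcons vs x) y) bSUB = subN x y.
Proof.
move=> ok1 ok2 xN yN; rewrite /bSUB tv_all; apply: eq_all_iota => k kN.
by rewrite !tvE /= !clamp_id // ?ok1 ?ok2 //; lia.
Qed.

Lemma span_ok tb x y : tab_ok tb tADJ -> tab_ok tb tREP -> tab_ok tb tSUB ->
  x < N -> y < N -> tv N inp tb (rcons (rcons vs x) y) bSPAN = spanN x y.
Proof.
move=> ok1 ok2 ok3 xN yN; rewrite /bSPAN tv_all; apply: eq_all_iota => k kN.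
by rewrite !tvE /= !clamp_id // ?ok1 ?ok2 ?ok3 //; lia.
Qed.

Lemma ple_ok tb x y : tab_ok tb tADJ -> tab_ok tb tSUB -> tab_ok tb tSPAN ->
  x < N -> y < N -> tv N inp tb (rcons (rcons vs x) y) bPLE = pleN x y.
Proof.
move=> ok1 ok2 ok3 xN yN; have xN' : x - n < N by lia.
have yN' : y - n < N by lia.
by rewrite /bPLE /eVx !tvE /= !clamp_id // !ok1 // !ok2 // ok3.
Qed.

Lemma sel_ok tb x y : tab_ok tb tADJ -> tab_ok tb tREP -> tab_ok tb tSPAN ->
  x < N -> y < N -> tv N inp tb (rcons (rcons vs x) y) bSEL = selN x.
Proof.
move=> ok1 ok2 ok3 xN yN; have xN' : x - n < N by lia.
have N0 : 0 < N by lia.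
rewrite /bSEL /eVx !tvE /= /selN !clamp_id // !ok2 //; case: ifP => // xn.
congr (_ && ~~ _); apply: eq_has_iota => k kN.
by rewrite !tvE /= !clamp_id // ok1 // ok2 // ok3.
Qed.

Lemma ple_tv tb ws a b : tab_ok tb tPLE -> ev N inp tb ws a < N -> ev N inp tb ws b < N ->
  tv N inp tb ws (ePle a b) = pleN (ev N inp tb ws a) (ev N inp tb ws b).
Proof. by move=> ok aN bN; rewrite /ePle tvE !clamp_id // ok. Qed.

Lemma bar_ev tb ws a : nth 0 ws 0 = n -> ev N inp tb ws (eBar a) = barN (ev N inp tb ws a).
Proof. by move=> e; rewrite /eBar ev_if tvE /= e. Qed.

Lemma sel_tv tb ws a : tab_ok tb tSEL -> ev N inp tb ws a < N ->
  tv N inp tb ws (get1 tSEL a) = selN (ev N inp tb ws a).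
Proof. move=> ok aN; have N0 : 0 < N by lia.
by rewrite tvE /= !clamp_id // ok.
Qed.

Lemma sel_lt a : selN a -> a < n + n.
Proof. by rewrite /selN; case: ltnP => [h _|h /andP[/andP[]]//]; lia. Qed.

Lemma zN_sel : zN < N -> selN zN.
Proof.
move=> h; have hh : has (fun x => selN x && ~~ has (fun y => selN y && (~~ (y == x) && pleN y x)) R) R.
  by rewrite has_find size_iota.
by have := nth_find 0 hh; rewrite nth_iota // add0n => /andP[].
Qed.

Lemma zN_le : zN <= N.
Proof. by rewrite -[leqRHS](size_iota 0) find_size. Qed.

End Preprocessing.

Definition upd_tab (tb : table) (t : nat) (f : nat -> nat -> nat) : table :=
  fun t' x y => if t' == t then f x y else tb t' x y.

Section Run.

Variables (N : nat) (inp : nat -> nat).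

Lemma run_tab t e tb vs o : run N inp (HTab t e) (HState tb vs o) =
  HState (upd_tab tb t (fun x y => ev N inp tb (rcons (rcons vs x) y) e)) vs o.
Proof. by []. Qed.

Lemma run_seq a b st : run N inp (HSeq a b) st = run N inp b (run N inp a st).
Proof. by case: st. Qed.

Lemma run_set i e tb vs o : run N inp (HSet i e) (HState tb vs o) =
  HState tb (set_nth 0 vs i (ev N inp tb vs e)) o.
Proof. by []. Qed.

Lemma run_if e a b tb vs o : run N inp (HIfS e a b) (HState tb vs o) =
  if tv N inp tb vs e then run N inp a (HState tb vs o) else run N inp b (HState tb vs o).
Proof. by rewrite /= /tv; case: (_ == 0). Qed.

Lemma run_out e tb vs o : run N inp (HOut e) (HState tb vs o) =
  HState tb vs (rcons o (ev N inp tb vs e)).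
Proof. by []. Qed.

End Run.

Section Preprocessing2.

Variables (n : nat) (inp : nat -> nat).
Local Notation N := (2 * n + 2).
Hypothesis inp0 : inp 0 = n.

Definition vars_pre := [:: n; zN n inp; zbN n inp; 0; 0; 0; 0; 0; 0; 0; 0].

(** If no vertex is selected, the search for [z] returns [N], which is not a valid index; the table
    of free pairs is described separately for that case. *)
Definition pre_ok (tb : table) : Prop :=
  [/\ forall t, t < 7 -> tab_ok n inp tb t,
      zN n inp < N -> tab_ok n inp tb tFP,
      (forall x, x < N -> ~~ selN n inp x) ->
        forall x y, x < N -> y < N -> (tb tFP x y != 0) = false
    & forall t x y, tFP < t -> tb t x y = 0].

Lemma run_pre : exists2 tb, pre_ok tb &
  run N inp c_pre (HState (fun _ _ _ => 0) (nseq 11 0) [::]) = HState tb vars_pre [::].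
Proof.
have N0 : 0 < N by lia.
rewrite /c_pre run_seq run_set [set_nth _ _ _ _]/= /clamp mul0n inp0.
rewrite run_seq run_tab; set tb1 := upd_tab _ _ _.
have ok1 : tab_ok n inp tb1 tADJ by move=> x y xN yN; apply: adj_ok.
rewrite run_seq run_tab; set tb2 := upd_tab tb1 _ _.
have ok2 : tab_ok n inp tb2 tTW by move=> x y xN yN; apply: tw_ok xN yN; exact: ok1.
rewrite run_seq run_tab; set tb3 := upd_tab tb2 _ _.
have ok3 : tab_ok n inp tb3 tREP.
  by move=> x y xN yN; apply: rep_ok xN yN.
rewrite run_seq run_tab; set tb4 := upd_tab tb3 _ _.
have ok4 : tab_ok n inp tb4 tSUB.
  by move=> x y xN yN; apply: sub_ok xN yN.
rewrite run_seq run_tab; set tb5 := upd_tab tb4 _ _.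
have ok5 : tab_ok n inp tb5 tSPAN.
  by move=> x y xN yN; apply: span_ok xN yN.
rewrite run_seq run_tab; set tb6 := upd_tab tb5 _ _.
have ok6 : tab_ok n inp tb6 tPLE.
  by move=> x y xN yN; apply: ple_ok xN yN.
rewrite run_seq run_tab; set tb7 := upd_tab tb6 _ _.
have ok7 : tab_ok n inp tb7 tSEL.
  by move=> x y xN yN; apply: sel_ok xN yN.
have ok7' : tab_ok n inp tb7 tPLE by [].
rewrite run_seq run_set; set z := ev _ _ _ _ _.
have ez : z = zN n inp.
  rewrite /z ev_find; apply: eq_find_iota => k kN.
  rewrite tv_and sel_tv //= tv_not tv_ex; congr (_ && ~~ _); apply: eq_has_iota => j jN.
  by rewrite tv_and sel_tv //= tv_and ple_tv // !tvE.
rewrite ez [set_nth _ _ _ _]/= run_seq run_set; set zb := ev _ _ _ _ _.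
have ezb : zb = zbN n inp.
  rewrite /zb ev_find; apply: eq_find_iota => k kN; rewrite tv_and sel_tv //= tv_and.
  case: (boolP (selN n inp k)) => //= sk.
  have bz : barN n (zN n inp) < N.
    by rewrite /barN; have := sel_lt inp0 sk; have := zN_le n inp; case: ifP; clear; lia.
  by rewrite !ple_tv ?bar_ev.
rewrite ezb [set_nth _ _ _ _]/= run_tab; set tb8 := upd_tab tb7 _ _.
exists tb8 => //; split.
- by do 7?[case=> [_|]].
- move=> zlt x y xN yN; rewrite -[_ != _]/(tv N inp tb7 _ bFP) /bFP /eVz /eNi.
  by rewrite !tv_and !tv_not !sel_tv // !ple_tv.
- move=> ns x y xN yN; rewrite -[_ != _]/(tv N inp tb7 _ bFP) /bFP /eVz !tv_and sel_tv //=.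
  by rewrite (negbTE (ns x xN)).
- by do 8?[case=> //].
Qed.

End Preprocessing2.

(** * The search loop *)

Lemma find_iotaP N (P : pred nat) : find P (iota 0 N) < N ->
  P (find P (iota 0 N)) /\ forall k, k < find P (iota 0 N) -> ~~ P k.
Proof.
move=> h; have hh : has P (iota 0 N) by rewrite has_find size_iota.
split; first by have := nth_find 0 hh; rewrite nth_iota.
move=> k kf; have := before_find 0 kf; rewrite nth_iota //; last exact: ltn_trans h.
by rewrite add0n => ->.
Qed.

Lemma find_lt_ex N (P : pred nat) k : k < N -> P k -> find P (iota 0 N) < N.
Proof.
by move=> kN Pk; rewrite -{2}(size_iota 0 N) -has_find; apply/hasP; exists k; rewrite ?mem_iota.
Qed.

(** The least pair in lexicographic order; failure shows as a first entry equal to [N]. *)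
Definition find_pair N (P : rel nat) :=
  let a := find (fun a => find (P a) (iota 0 N) < N) (iota 0 N) in
  (a, find (P a) (iota 0 N)).

Lemma find_pairP N (P : rel nat) : let p := find_pair N P in p.1 < N ->
  [/\ p.2 < N, P p.1 p.2 & forall a b, a < N -> b < N -> P a b ->
     p.1 * N + p.2 <= a * N + b].
Proof.
rewrite /find_pair /= => h; have [h1 h2] := find_iotaP h; have [h3 h4] := find_iotaP h1.
split=> // a b aN bN Pab; move: h2 h3 h4 h1; set p := find _ _; set q := find _ _ => h2 h3 h4 h1.
have pa : p <= a.
  by rewrite leqNgt; apply/negP => /h2; rewrite (find_lt_ex bN).
move: pa; rewrite leq_eqVlt => /orP[/eqP e|lt].
  rewrite e leq_add2l leqNgt; apply/negP => /h4.
  by rewrite e Pab.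
have : p.+1 * N <= a * N by rewrite leq_mul2r lt orbT.
by move: h1; rewrite mulSn; clear; lia.
Qed.

Lemma find_pair_none N (P : rel nat) : ~~ ((find_pair N P).1 < N) ->
  forall a b, a < N -> b < N -> ~~ P a b.
Proof.
move=> h a b aN bN; apply/negP => Pab; case/negP: h.
by apply: (find_lt_ex aN); apply: find_lt_ex Pab.
Qed.

Section SearchLoop.

Variables (n : nat) (inp : nat -> nat).
Local Notation N := (2 * n + 2).
Hypothesis inp0 : inp 0 = n.
Variables (z zb : nat) (F : rel nat).
Local Notation dj := (djN n inp).
Local Notation ni := (niN n inp).
Hypothesis F_sel : forall a b, F a b -> [/\ selN n inp a, selN n inp b, selN n inp z & zb < N].
Hypothesis ple_refl : forall a, selN n inp a -> pleN n inp a a.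
Hypothesis dj_irr : forall a, selN n inp a -> ~~ dj a a.
Hypothesis dj_sym : forall a b, selN n inp a -> selN n inp b -> dj a b = dj b a.

(* Gives [bar z] the least rank. *)
Definition swN a := if a == 0 then zb else if a == zb then 0 else a.
Definition keyN (p : nat * nat) := swN p.1 * N + swN p.2.
Definition fpairN (p : nat * nat) := in_range N p && F p.1 p.2.
Definition half_move c d y := ~~ dj d y &&
  (ni d y ==> (dj c d || dj c y) && (dj z d || dj z y)).
Definition moveN (p q : nat * nat) := [&& fpairN p, fpairN q &
  (q.1 == p.1) && half_move p.1 p.2 q.2 || (q.2 == p.2) && half_move p.2 p.1 q.1].

Lemma fpairN_range p : fpairN p -> in_range N p.
Proof. by case/andP. Qed.

Lemma moveN_fp p q : moveN p q -> fpairN p && fpairN q.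
Proof. by case/and3P=> -> ->. Qed.

Lemma moveN_refl p : fpairN p -> moveN p p.
Proof.
move=> f; rewrite /moveN f eqxx /half_move; case/andP: f => _ /F_sel[_ s _ _].
by rewrite dj_irr // /niN ple_refl.
Qed.

Lemma moveN_sym p q : moveN p q -> moveN q p.
Proof.
case/and3P=> fp fq h; rewrite /moveN fp fq /=.
have [_ /F_sel[p1 p2 sz _]] := andP fp; have [_ /F_sel[q1 q2 _ _]] := andP fq.
have hm c d y : selN n inp d -> selN n inp y -> half_move c d y -> half_move c y d.
  move=> sd sy; rewrite /half_move (dj_sym sy sd) (orbC (dj c y)) (orbC (dj z y)).
  by have -> : ni y d = ni d y by rewrite /niN andbC.
case/orP: h => /andP[/eqP e h]; first by rewrite e eqxx hm.
by rewrite e eqxx (hm p.2 p.1 q.1) ?orbT //.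
Qed.

Lemma swN_lt a : zb < N -> a < N -> swN a < N.
Proof. by rewrite /swN => h1 h2; do 2?case: ifP => _ //; lia. Qed.

Lemma swNK a : swN (swN a) = a.
Proof.
rewrite /swN; case: (eqVneq a 0) => [->|a0].
  by case: (eqVneq zb 0) => [->|]; rewrite ?eqxx.
case: (eqVneq a zb) => [->|ab]; first by rewrite eqxx.
by rewrite (negbTE a0) (negbTE ab).
Qed.

Lemma keyN_inj : zb < N -> forall p q, in_range N p -> in_range N q -> keyN p = keyN q -> p = q.
Proof.
move=> zN [a b] [c d] /andP[/= h1 h2] /andP[/= h3 h4]; rewrite /keyN /= => e.
have N1 : 1 < N by lia.
have [e1 e2] := digit_inj N1 (swN_lt zN h2) (swN_lt zN h4) e.
by rewrite -(swNK a) -(swNK b) e1 e2 !swNK.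
Qed.

Definition search_of (tb : table) : search :=
  Search (fun p => tb tMARK p.1 p.2)
         (fun p => (tb tPAR p.1 p.2 %/ N, tb tPAR p.1 p.2 - tb tPAR p.1 p.2 %/ N * N))
         (fun p => tb tROOT p.1 p.2).

Local Notation inv := (search_inv N fpairN moveN keyN).

Variable tb0 : table.
Hypothesis ok_ple : tab_ok n inp tb0 tPLE.
Hypothesis ok_F : forall x y, x < N -> y < N -> (tb0 tFP x y != 0) = F x y.

Definition unsearched (tb : table) := forall t, t \notin [:: tMARK; tPAR; tROOT; tNEW] -> tb t = tb0 t.

Definition c_mark := HSeq (HTab tNEW bNEW) (HSeq (HTab tPAR bPAR) (HSeq (HTab tROOT bROOT) (HTab tMARK bMARK))).

Lemma move_tv tb cx cy rt rx ry i j x y : unsearched tb -> fpairN (cx, cy) -> x < N -> y < N ->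
  tv N inp tb [:: n; z; zb; cx; cy; rt; rx; ry; 0; 0; 0; i; j; x; y] eMove =
  moveN (cx, cy) (x, y).
Proof.
move=> ut fc xN yN; rewrite /eMove tv_and tv_get [clamp N _]/= !clamp_id // (ut tFP) // ok_F //.
have -> : moveN (cx, cy) (x, y) = F x y && ((x == cx) && half_move cx cy y || (y == cy) && half_move cy cx x).
  by rewrite /moveN fc /= {1}/fpairN /in_range /= xN yN.
case: (boolP (F x y)) => // fxy; rewrite !andTb.
have [sx sy sz zbN] := F_sel fxy; have [_ /F_sel[/= sc sd _ _]] := andP fc.
have sel2 a : selN n inp a -> a < N by move/(sel_lt inp0); clear; lia.
have b2 a : selN n inp a -> barN n a < N by move/(sel_lt inp0)/(barN_lt inp0); clear; lia.
have okp : tab_ok n inp tb tPLE by move=> a b aN bN; rewrite (ut tPLE) //; apply: ok_ple.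
set vs := [:: _; _; _; _; _; _; _; _; _; _; _; _; _; _; _].
have djE a b : selN n inp (ev N inp tb vs a) -> selN n inp (ev N inp tb vs b) ->
    tv N inp tb vs (eDj a b) = dj (ev N inp tb vs a) (ev N inp tb vs b).
  by move=> sa sb; have h1 := sel2 _ sa; have h2 := b2 _ sb; rewrite /eDj ple_tv ?bar_ev.
have niE a b : selN n inp (ev N inp tb vs a) -> selN n inp (ev N inp tb vs b) ->
    tv N inp tb vs (eNi a b) = ni (ev N inp tb vs a) (ev N inp tb vs b).
  by move=> sa sb; have h1 := sel2 _ sa; have h2 := sel2 _ sb; rewrite /eNi tv_and !tv_not !ple_tv.
have half c d y' : selN n inp (ev N inp tb vs c) -> selN n inp (ev N inp tb vs d) ->
    selN n inp (ev N inp tb vs y') -> tv N inp tb vs (eMove2 c d y') =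
    half_move (ev N inp tb vs c) (ev N inp tb vs d) (ev N inp tb vs y').
  by move=> s1 s2 s3; rewrite /eMove2 tv_and tv_not tv_imp tv_and !tv_or !djE // niE.
by rewrite tv_or (tv_and _ _ _ _ (eEq X2 vcx)) (tv_and _ _ _ _ (eEq Y2 vcy)) !tv_eq !half.
Qed.

Lemma run_mark tb cx cy rt rx ry i j o : unsearched tb -> fpairN (cx, cy) ->
  exists tb', [/\ unsearched tb', advance N moveN (cx, cy) rt (search_of tb) (search_of tb') &
    run N inp c_mark (HState tb [:: n; z; zb; cx; cy; rt; rx; ry; 0; 0; 0; i; j] o) =
      HState tb' [:: n; z; zb; cx; cy; rt; rx; ry; 0; 0; 0; i; j] o].
Proof.
move=> ut fc; have N0 : 0 < N by lia.
rewrite /c_mark run_seq run_tab; set tb1 := upd_tab _ _ _.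
have newE x y : x < N -> y < N -> (tb1 tNEW x y != 0) =
    (tb tMARK x y == 0) && moveN (cx, cy) (x, y).
  move=> xN yN; rewrite -[_ != _]/(tv N inp tb [:: n; z; zb; cx; cy; rt; rx; ry; 0; 0; 0; i; j; x; y] bNEW).
  by rewrite /bNEW tv_and tv_not move_tv // tv_get [clamp N _]/= !clamp_id // negbK.
rewrite run_seq run_tab; set tb2 := upd_tab tb1 _ _.
rewrite run_seq run_tab; set tb3 := upd_tab tb2 _ _.
rewrite run_tab; set tb4 := upd_tab tb3 _ _.
exists tb4; split=> //.
  move=> t; rewrite !inE !negb_or => /and4P[h1 h2 h3 h4].
  rewrite /tb4 /tb3 /tb2 /tb1 /upd_tab.
  by rewrite (negbTE h1) (negbTE h2) (negbTE h3) (negbTE h4) ut // !inE !negb_or h1 h2 h3 h4.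
move=> [x y] /andP[/= xN yN].
have nE : (tb1 tNEW x y != 0) = (tb tMARK x y == 0) && moveN (cx, cy) (x, y) by apply: newE.
have getN tb' : tb' tNEW = tb1 tNEW -> forall t, tv N inp tb' [:: n; z; zb; cx; cy; rt; rx; ry; 0; 0; 0; i; j; x; y] (get t X2 Y2) = (tb' t x y != 0).
  by move=> e t; rewrite tv_get [clamp N _]/= !clamp_id.
split=> /=.
- rewrite -[tb4 tMARK x y]/(ev N inp tb3 [:: n; z; zb; cx; cy; rt; rx; ry; 0; 0; 0; i; j; x; y] bMARK).
  rewrite /bMARK ev_if tv_and !tv_eq ev_if getN // -nE [ev _ _ _ _ (HLit 2)]/= [ev _ _ _ _ (HLit 1)]/=.
  by rewrite [ev _ _ _ _ (get _ _ _)]/= !clamp_id.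
- have -> : tb4 tPAR x y = if tb1 tNEW x y != 0 then cx * N + cy else tb tPAR x y.
    rewrite -[tb4 tPAR x y]/(ev N inp tb1 [:: n; z; zb; cx; cy; rt; rx; ry; 0; 0; 0; i; j; x; y] bPAR).
    by rewrite /bPAR ev_if getN // [ev _ _ _ _ (get _ _ _)]/= !clamp_id.
  rewrite nE; case: ifP => // _; have [/= _ cyN] := andP (fpairN_range fc).
  by rewrite divnMDl // divn_small // addn0 addKn.
rewrite -[tb4 tROOT x y]/(ev N inp tb2 [:: n; z; zb; cx; cy; rt; rx; ry; 0; 0; 0; i; j; x; y] bROOT).
by rewrite /bROOT ev_if getN // [ev _ _ _ _ (get _ _ _)]/= !clamp_id // -nE.
Qed.

Lemma run_body k tb cx cy rt rx ry i j o : unsearched tb -> inv k (search_of tb) ->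
  exists tb' cx' cy' rt' rx' ry', [/\ unsearched tb', inv k.+1 (search_of tb') &
    run N inp c_body (HState tb [:: n; z; zb; cx; cy; rt; rx; ry; 0; 0; 0; i; j] o) =
      HState tb' [:: n; z; zb; cx'; cy'; rt'; rx'; ry'; 0; 0; 0; i; j] o].
Proof.
move=> ut iv; have N0 : 0 < N by lia.
have okp : tab_ok n inp tb tPLE by move=> x y xN yN; rewrite (ut tPLE) //; apply: ok_ple.
have okF x y : x < N -> y < N -> (tb tFP x y != 0) = F x y by rewrite (ut tFP) //; apply: ok_F.
rewrite /c_body run_seq run_set; set e1 := ev _ _ _ _ _.
pose pend a b := tb tMARK a b == 1.
have E1 : e1 = (find_pair N pend).1.
  rewrite /e1 ev_find; apply: eq_find_iota => a aN; rewrite tv_lt ev_find [ev _ _ _ _ HN]/=.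
  by rewrite (eq_find_iota (q := pend a)) // => b bN; rewrite tv_eq /= !clamp_id.
rewrite [set_nth _ _ _ _]/= run_seq run_set; set e2 := ev _ _ _ _ _.
have E2 : e1 < N -> e2 = (find_pair N pend).2.
  move=> h; rewrite /e2 ev_find /find_pair; rewrite E1 /= in h *.
  by apply: eq_find_iota => b bN; rewrite tv_eq /= !clamp_id.
rewrite [set_nth _ _ _ _]/= run_seq run_if tv_lt [ev _ _ _ _ HN]/= [ev _ _ _ _ vcx]/=.
have fp_of p : in_range N p -> tb tMARK p.1 p.2 <> 0 -> fpairN p by case: iv => i1 _ _ _ _; apply: i1.
have [c1|c1] := boolP (e1 < N).
  have c1' : (find_pair N pend).1 < N by rewrite -E1.
  have [p2 p1 _] := find_pairP c1'; rewrite -(E2 c1) -E1 in p1 p2.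
  rewrite run_set; set e3 := ev _ _ _ _ _; rewrite [set_nth _ _ _ _]/=.
  have E3 : e3 = tb tROOT e1 e2 by rewrite /e3 /= !clamp_id.
  rewrite run_if tv_lt [ev _ _ _ _ HN]/= [ev _ _ _ _ vcx]/= c1.
  have cR : in_range N (e1, e2) by rewrite /in_range /= c1.
  have fc : fpairN (e1, e2) by apply: fp_of => //=; move/eqP: p1 => ->.
  have [tb' [ut' adv er]] := @run_mark tb e1 e2 e3 rx ry i j o ut fc.
  exists tb', e1, e2, e3, rx, ry; split=> //.
  apply: search_step_inv iv _ => //; try by [exact: fpairN_range|exact: moveN_fp|exact: moveN_refl|exact: moveN_sym].
  by left; exists (e1, e2); split=> //; [move/eqP: p1|move: adv; rewrite E3].
have nop p : in_range N p -> mark (search_of tb) p <> 1.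
  move=> /andP[p1 p2] /eqP m1; rewrite E1 in c1.
  by have := find_pair_none c1 p1 p2; rewrite /pend m1.
rewrite run_seq run_set; set e6 := ev _ _ _ _ _.
(* The search runs over exchanged numbers, so its first hit is the unseen pair of least key. *)
pose fresh a b := F (clamp N (swN a)) (clamp N (swN b)) &&
  (tb tMARK (clamp N (swN a)) (clamp N (swN b)) == 0).
have freshE w1 w2 w3 w4 w5 a b l : let vs := [:: n, z, zb, w1, w2, w3, w4, w5, 0, 0, 0 & l] in
    tv N inp tb vs (eFresh a b) = fresh (ev N inp tb vs a) (ev N inp tb vs b).
  move=> vs; have swE c : ev N inp tb vs (eSw c) = swN (ev N inp tb vs c).
    by rewrite /eSw ev_if tv_eq ev_if tv_eq.
  by rewrite /eFresh tv_and tv_not !tv_get !swE negbK okF ?clamp_lt.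
have E6 : e6 = (find_pair N fresh).1.
  rewrite /e6 ev_find; apply: eq_find_iota => a aN; rewrite tv_lt ev_find [ev _ _ _ _ HN]/=.
  by rewrite (eq_find_iota (q := fresh a)) // => b bN; rewrite freshE.
rewrite [set_nth _ _ _ _]/= run_seq run_set; set e7 := ev _ _ _ _ _.
have E7 : e7 = (find_pair N fresh).2.
  rewrite /e7 ev_find /find_pair -/(find_pair N fresh).1.
  have -> : find (fun a => find (fresh a) (iota 0 N) < N) (iota 0 N) = e6 by rewrite E6.
  by apply: eq_find_iota => b bN; rewrite freshE.
rewrite [set_nth _ _ _ _]/= run_if tv_lt [ev _ _ _ _ HN]/= [ev _ _ _ _ vrx]/=.
have [c6|c6] := boolP (e6 < N); last first.
  rewrite [run _ _ HSkip _]/= run_if tv_lt [ev _ _ _ _ HN]/= [ev _ _ _ _ vcx]/= (negbTE c1).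
  exists tb, e1, e2, rt, e6, e7; split=> //.
  apply: search_step_inv iv _ => //; try by [exact: fpairN_range|exact: moveN_fp|exact: moveN_refl|exact: moveN_sym].
  right; split=> //; right; split=> // p fp0 m0; have [_ fF] := andP fp0.
  have /andP[p1 p2] := fpairN_range fp0; have [_ _ _ zbN] := F_sel fF.
  rewrite E6 in c6; have := find_pair_none c6 (swN_lt zbN p1) (swN_lt zbN p2).
  by rewrite /fresh !swNK !clamp_id // fF /= => /eqP; apply.
have c6' : (find_pair N fresh).1 < N by rewrite -E6.
have [p2 p1 pm] := find_pairP c6'; rewrite -E6 -E7 in p1 p2 pm.
have zbN : zb < N by case/andP: p1 => /F_sel[].
have s6 := swN_lt zbN c6; have s7 := swN_lt zbN p2.
rewrite run_seq run_set; set e8 := ev _ _ _ _ _.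
have E8 : e8 = swN e6 by rewrite /e8 /eSw ev_if tv_eq ev_if tv_eq.
rewrite [set_nth _ _ _ _]/= run_seq run_set; set e9 := ev _ _ _ _ _.
have E9 : e9 = swN e7 by rewrite /e9 /eSw ev_if tv_eq ev_if tv_eq.
rewrite [set_nth _ _ _ _]/= run_set; set e10 := ev _ _ _ _ _.
have E10 : e10 = e6 * N + e7 by [].
rewrite [set_nth _ _ _ _]/= run_if tv_lt [ev _ _ _ _ HN]/= [ev _ _ _ _ vcx]/= E8 s6 E9.
move: p1; rewrite /fresh !clamp_id // => /andP[f8 m8].
have cR : in_range N (swN e6, swN e7) by rewrite /in_range /= s6.
have fc : fpairN (swN e6, swN e7) by rewrite /fpairN cR.
have [tb' [ut' adv er]] := @run_mark tb (swN e6) (swN e7) e10 e6 e7 i j o ut fc.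
exists tb', (swN e6), (swN e7), e10, e6, e7; split=> //.
apply: search_step_inv iv _ => //; try by [exact: fpairN_range|exact: moveN_fp|exact: moveN_refl|exact: moveN_sym].
have kE : keyN (swN e6, swN e7) = e10 by rewrite /keyN /= !swNK.
right; split=> //; left; exists (swN e6, swN e7); split=> //; last by rewrite kE.
  exact/eqP.
move=> p fp0 m0; rewrite kE E10 /keyN; have /andP[q1 q2] := fpairN_range fp0.
apply: pm; rewrite ?swN_lt // /fresh !swNK !clamp_id //.
by case/andP: fp0 => _ ->; rewrite /=; apply/eqP.
Qed.

End SearchLoop.

Section RunFor.

Variables (N : nat) (inp : nat -> nat).

Lemma run_for b tb vs o (Inv : nat -> table -> seq nat -> seq nat -> Prop) :
  (forall k tb vs o, k < N -> Inv k tb vs o -> exists tb' vs' o',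
     run N inp b (HState tb (rcons vs k) o) = HState tb' (rcons vs' k) o' /\
     size vs' = size vs /\ Inv k.+1 tb' vs' o') ->
  Inv 0 tb vs o ->
  exists tb' vs' o', [/\ run N inp (HFor b) (HState tb vs o) = HState tb' vs' o',
    size vs' = size vs & Inv N tb' vs' o'].
Proof.
move=> hb i0; set F := fun st k => let: HState tb vs o := st in
      let: HState tb' vs' o' := run N inp b (HState tb (rcons vs k) o) in
      HState tb' (take (size vs) vs') o'.
suff H j : j <= N -> exists tb' vs' o', [/\ foldl F (HState tb vs o) (iota 0 j) = HState tb' vs' o',
    size vs' = size vs & Inv j tb' vs' o'] by exact: H.
elim: j => [|j IH] jN; first by exists tb, vs, o.
have [tb1 [vs1 [o1 [e1 s1 i1]]]] := IH (ltnW jN).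
rewrite -addn1 iotaD add0n foldl_cat e1 [iota j 1]/= [foldl _ _ [:: j]]/=.
have [tb2 [vs2 [o2 [e2 [s2 i2]]]]] := hb j tb1 vs1 o1 jN i1.
exists tb2, vs2, o2; rewrite e2; split; last by rewrite addn1.
  by rewrite -cats1 -s2 take_size_cat.
by rewrite s2.
Qed.

Lemma run_for_out b tb vs o (f : nat -> seq nat) :
  (forall k o, k < N -> run N inp b (HState tb (rcons vs k) o) = HState tb (rcons vs k) (o ++ f k)) ->
  run N inp (HFor b) (HState tb vs o) = HState tb vs (o ++ flatten [seq f k | k <- iota 0 N]).
Proof.
move=> hb; set F := fun st k => let: HState tb vs o := st in
      let: HState tb' vs' o' := run N inp b (HState tb (rcons vs k) o) in
      HState tb' (take (size vs) vs') o'.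
suff H j : j <= N -> foldl F (HState tb vs o) (iota 0 j) =
    HState tb vs (o ++ flatten [seq f k | k <- iota 0 j]) by exact: H.
elim: j => [|j IH] jN; first by rewrite cats0.
rewrite -addn1 iotaD add0n foldl_cat IH ?(ltnW jN) // [iota j 1]/= [foldl _ _ [:: j]]/=.
by rewrite hb // -cats1 take_size_cat // map_cat flatten_cat /= cats0 catA.
Qed.

End RunFor.

Section SearchRun.

Variables (n : nat) (inp : nat -> nat).
Local Notation N := (2 * n + 2).
Hypothesis inp0 : inp 0 = n.
Variables (z zb : nat) (F : rel nat).
Local Notation dj := (djN n inp).
Hypothesis F_sel : forall a b, F a b -> [/\ selN n inp a, selN n inp b, selN n inp z & zb < N].
Hypothesis ple_refl : forall a, selN n inp a -> pleN n inp a a.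
Hypothesis dj_irr : forall a, selN n inp a -> ~~ dj a a.
Hypothesis dj_sym : forall a b, selN n inp a -> selN n inp b -> dj a b = dj b a.
Variable tb0 : table.
Hypothesis ok_ple : tab_ok n inp tb0 tPLE.
Hypothesis ok_F : forall x y, x < N -> y < N -> (tb0 tFP x y != 0) = F x y.
Hypothesis mark0 : forall x y, tb0 tMARK x y = 0.

Local Notation inv := (search_inv N (fpairN n F) (moveN n inp z F) (keyN n zb)).

Lemma run_search o : exists tb cx cy rt rx ry,
  [/\ unsearched tb0 tb, inv (N * N) (search_of n tb) &
    run N inp c_search (HState tb0 [:: n; z; zb; 0; 0; 0; 0; 0; 0; 0; 0] o) =
      HState tb [:: n; z; zb; cx; cy; rt; rx; ry; 0; 0; 0] o].
Proof.
pose I k tb (vs o' : seq nat) := exists cx cy rt rx ry, [/\ unsearched tb0 tb,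
  inv k (search_of n tb), vs = [:: n; z; zb; cx; cy; rt; rx; ry; 0; 0; 0] & o' = o].
pose I2 i k tb (vs o' : seq nat) := exists cx cy rt rx ry, [/\ unsearched tb0 tb,
  inv (i * N + k) (search_of n tb), vs = [:: n; z; zb; cx; cy; rt; rx; ry; 0; 0; 0; i] & o' = o].
have [||] := @run_for N inp (HFor c_body) tb0 [:: n; z; zb; 0; 0; 0; 0; 0; 0; 0; 0] o
    (fun i => I (i * N)).
- move=> i tb vs o1 iN [cx [cy [rt [rx [ry [h1 h2 -> ->]]]]]].
  have [||] := @run_for N inp c_body tb [:: n; z; zb; cx; cy; rt; rx; ry; 0; 0; 0; i] o (I2 i).
  + move=> k tb1 vs1 o2 kN [cx1 [cy1 [rt1 [rx1 [ry1 [g1 g2 -> ->]]]]]].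
    have [tb2 [cx2 [cy2 [rt2 [rx2 [ry2 [f1 f2 f3]]]]]]] :=
      run_body inp0 F_sel ple_refl dj_irr dj_sym ok_ple ok_F cx1 cy1 rt1 rx1 ry1 i k o g1 g2.
    exists tb2, [:: n; z; zb; cx2; cy2; rt2; rx2; ry2; 0; 0; 0; i], o; split=> //; split=> //.
    by exists cx2, cy2, rt2, rx2, ry2; rewrite (addnS (i * N)).
  + by exists cx, cy, rt, rx, ry; rewrite addn0.
  move=> tb3 [vs3 [o3 [e3 _ [cx3 [cy3 [rt3 [rx3 [ry3 [g1 g2 g3 g4]]]]]]]]].
  exists tb3, [:: n; z; zb; cx3; cy3; rt3; rx3; ry3; 0; 0; 0], o; split; first by rewrite e3 g3 g4.
  split=> //; exists cx3, cy3, rt3, rx3, ry3; split=> //.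
  by rewrite (mulSnr i).
- exists 0, 0, 0, 0, 0; split=> //; apply: search_inv0 => p _; exact: mark0.
move=> tb [vs [o1 [e _ [cx [cy [rt [rx [ry [g1 g2 g3 g4]]]]]]]]].
by exists tb, cx, cy, rt, rx, ry; split=> //; rewrite e g3 g4.
Qed.

End SearchRun.

(** * Output of the certificate *)

Section Post.

Variables (n : nat) (inp : nat -> nat).
Local Notation N := (2 * n + 2).
Hypothesis inp0 : inp 0 = n.
Local Notation z := (zN n inp).
Local Notation zb := (zbN n inp).
Local Notation sel := (selN n inp).
Local Notation ple := (pleN n inp).
Local Notation dj := (djN n inp).
Local Notation F := (fpN n inp).
Hypothesis sel_z : forall a, sel a -> sel z /\ zb < N.
Variable tb0 : table.
Hypothesis ok_pre : forall t, t < 7 -> tab_ok n inp tb0 t.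
Hypothesis ok_F : forall x y, x < N -> y < N -> (tb0 tFP x y != 0) = F x y.

(* A root whose component is its own reversal. *)
Definition conf a b := [&& F a b, tb0 tPAR a b == a * N + b & tb0 tROOT a b == tb0 tROOT b a].
Definition oN x y := F x y && (tb0 tROOT x y < tb0 tROOT y x).
Definition sideN x := vzN n inp x && (dj z x || oN zb x).
Definition leftN x := \sum_(k < N) if sideN k then
  (oN k x || (ple x k && ~~ (val k == x))) + (oN k x && dj k x) else 0.
Definition rightN x := \sum_(k < N) if sideN k then
  (oN k x || (ple k x && ~~ (val k == x))) + ~~ (oN x k && dj x k) else 0.
(** The selected number that stands for the complement of [x]: the formal number [barN n x] may have
    been dropped in favour of an existing partner. *)
Definition reprN x := find (fun k => sel k && (ple k (barN n x) && ple (barN n x) k)) (iota 0 N).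
Definition arcsN x := if sideN x then 2 * leftN x else 2 * rightN (reprN x) + 1.
Definition arctN x := if sideN x then 2 * rightN x else 2 * leftN (reprN x) + 4 * N - 1.
(** Selected numbers have gaps; this is the index of a vertex in the completion that is written
    out. *)
Definition cntN x := \sum_(k < N) ((k < x) && sel k).
Definition twinN x := find (fun k => repN n inp k && twN n inp k x) (iota 0 N).

Hypothesis repr_sel : forall x, sel x -> sel (reprN x).

Definition post_ok (tb : table) : Prop :=
  (forall t, t < 12 -> tb t = tb0 t) /\
  [/\ forall x, sel x -> tb tARCS x 0 = arcsN x,
      forall x, sel x -> tb tARCT x 0 = arctN x,
      forall x, x < N -> tb tCNT x 0 = cntN x
    & forall x, x < N -> tb tREPOF x 0 = twinN x].

Lemma sel_ltN a : sel a -> a < N.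
Proof. by move/(sel_lt inp0); clear; lia. Qed.

Lemma bar_ltN a : sel a -> barN n a < N.
Proof. by move/(sel_lt inp0)/(barN_lt inp0); clear; lia. Qed.

Lemma side_sel x : sideN x -> sel x.
Proof. by case/andP=> /andP[]. Qed.

Lemma run_post cx cy rt rx ry o : exists tb ca cb,
  [/\ post_ok tb, ca = (find_pair N conf).1, ca < N -> cb = (find_pair N conf).2 &
    run N inp c_post (HState tb0 [:: n; z; zb; cx; cy; rt; rx; ry; 0; 0; 0] o) =
      HState tb [:: n; z; zb; cx; cy; rt; rx; ry; ca; cb; 0] o].
Proof.
have N0 : 0 < N by lia.
have okple : tab_ok n inp tb0 tPLE by apply: ok_pre.
have oksel : tab_ok n inp tb0 tSEL by apply: ok_pre.
have confE vs a b : ev N inp tb0 vs a < N -> ev N inp tb0 vs b < N ->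
    tv N inp tb0 vs (eConf a b) = conf (ev N inp tb0 vs a) (ev N inp tb0 vs b).
  by move=> aN bN; rewrite /eConf !tv_and !tv_eq tv_get /= !clamp_id // ok_F.
rewrite /c_post run_seq run_set; set ca := ev _ _ _ _ _.
have Eca : ca = (find_pair N conf).1.
  rewrite /ca ev_find; apply: eq_find_iota => a aN; rewrite tv_lt ev_find [ev _ _ _ _ HN]/=.
  by rewrite (eq_find_iota (q := conf a)) // => b bN; rewrite confE.
rewrite [set_nth _ _ _ _]/= run_seq run_set; set cb := ev _ _ _ _ _.
have Ecb : ca < N -> cb = (find_pair N conf).2.
  move=> h; rewrite /cb ev_find /find_pair -/(find_pair N conf).1.
  have -> : find (fun a => find (conf a) (iota 0 N) < N) (iota 0 N) = ca by rewrite Eca.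
  by apply: eq_find_iota => b bN; rewrite confE.
rewrite [set_nth _ _ _ _]/=; set vs := [:: n; z; zb; cx; cy; rt; rx; ry; ca; cb; 0].
have sel_ok (tb : table) w a : tb tSEL = tb0 tSEL -> ev N inp tb w a < N ->
    tv N inp tb w (get1 tSEL a) = sel (ev N inp tb w a).
  by move=> e aN; apply: sel_tv => // x y; rewrite e; apply: oksel.
have ple_okk (tb : table) w a b : tb tPLE = tb0 tPLE -> ev N inp tb w a < N -> ev N inp tb w b < N ->
    tv N inp tb w (ePle a b) = ple (ev N inp tb w a) (ev N inp tb w b).
  by move=> e aN bN; apply: ple_tv => // x y; rewrite e; apply: okple.
have dj_okk (tb : table) w a b : tb tPLE = tb0 tPLE -> nth 0 w 0 = n ->
    sel (ev N inp tb w a) -> sel (ev N inp tb w b) ->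
    tv N inp tb w (eDj a b) = dj (ev N inp tb w a) (ev N inp tb w b).
  move=> e w0 sa sb; have h1 := sel_ltN sa; have h2 := bar_ltN sb.
  by rewrite /eDj ple_okk ?bar_ev.
rewrite run_seq run_tab; set tb1 := upd_tab _ _ _.
have okO x y : x < N -> y < N -> (tb1 tO x y != 0) = oN x y.
  move=> xN yN; rewrite -[_ != _]/(tv N inp tb0 (rcons (rcons vs x) y) bO).
  by rewrite /bO tv_and tv_lt tv_get /= !clamp_id // ok_F.
rewrite run_seq run_tab; set tb2 := upd_tab tb1 _ _.
have okS x y : x < N -> y < N -> (tb2 tSIDE x y != 0) = sideN x.
  move=> xN yN; rewrite -[_ != _]/(tv N inp tb1 (rcons (rcons vs x) y) bSIDE).
  rewrite /bSIDE /eVz tv_and tv_and sel_ok // /sideN /vzN -!andbA [ev _ _ _ _ X]/=.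
  case: (boolP (sel x)) => // sx; have [sz zbN] := sel_z sx.
  have zN' := sel_ltN sz.
  rewrite !andTb tv_or dj_okk // /eNi tv_and !tv_not !ple_okk // tv_get.
  by rewrite [ev _ _ _ _ X]/= [ev _ _ _ _ vzb]/= [ev _ _ _ _ vz]/= !clamp_id // okO // -andbA.
have getS (tb : table) w a : tb tSIDE = tb2 tSIDE -> ev N inp tb w a < N ->
    tv N inp tb w (get1 tSIDE a) = sideN (ev N inp tb w a).
  by move=> e aN; rewrite tv_get /= !clamp_id // e okS.
have getO (tb : table) w a b : tb tO = tb1 tO -> ev N inp tb w a < N -> ev N inp tb w b < N ->
    tv N inp tb w (get tO a b) = oN (ev N inp tb w a) (ev N inp tb w b).
  by move=> e aN bN; rewrite tv_get !clamp_id // e okO.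
rewrite run_seq run_tab; set tb3 := upd_tab tb2 _ _.
have okL x : sel x -> tb3 tPL x 0 = leftN x.
  move=> sx; have xN := sel_ltN sx.
  rewrite -[LHS]/(ev N inp tb2 (rcons (rcons vs x) 0) bPL) /bPL ev_sum.
  apply: eq_bigr => k _; rewrite ev_if getS ?ltn_ord //; case: ifP => // sk; have s_k := side_sel sk.
  have -> : forall w a b, ev N inp tb2 w (eAdd a b) = ev N inp tb2 w a + ev N inp tb2 w b by [].
  rewrite !ev_B tv_or !tv_and dj_okk // ple_okk ?ltn_ord // !getO ?ltn_ord //.
  by rewrite tv_not tv_eq.
rewrite run_seq run_tab; set tb4 := upd_tab tb3 _ _.
have okR x : sel x -> tb4 tPR x 0 = rightN x.
  move=> sx; have xN := sel_ltN sx.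
  rewrite -[LHS]/(ev N inp tb3 (rcons (rcons vs x) 0) bPR) /bPR ev_sum.
  apply: eq_bigr => k _; rewrite ev_if getS ?ltn_ord //; case: ifP => // sk; have s_k := side_sel sk.
  have -> : forall w a b, ev N inp tb3 w (eAdd a b) = ev N inp tb3 w a + ev N inp tb3 w b by [].
  rewrite ev_B ev_not tv_or !tv_and dj_okk // ple_okk ?ltn_ord // !getO ?ltn_ord //.
  by rewrite tv_not tv_eq.
rewrite run_seq run_tab; set tb5 := upd_tab tb4 _ _.
have okB x : sel x -> tb5 tBAR x 0 = reprN x.
  move=> sx; have xN := sel_ltN sx; have bN := bar_ltN sx.
  rewrite -[LHS]/(ev N inp tb4 (rcons (rcons vs x) 0) bBAR) /bBAR ev_find.
  apply: eq_find_iota => k kN; rewrite !tv_and sel_ok // !ple_okk ?bar_ev //.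
have get1E (tb : table) w t a : ev N inp tb w a < N -> ev N inp tb w (get1 t a) = tb t (ev N inp tb w a) 0.
  by move=> aN; rewrite /= !clamp_id.
have okL5 : forall x, sel x -> tb5 tPL x 0 = leftN x := okL.
have okR5 : forall x, sel x -> tb5 tPR x 0 = rightN x := okR.
rewrite run_seq run_tab; set tb6 := upd_tab tb5 _ _.
have okL6 : forall x, sel x -> tb6 tPL x 0 = leftN x := okL.
have okR6 : forall x, sel x -> tb6 tPR x 0 = rightN x := okR.
have okB6 : forall x, sel x -> tb6 tBAR x 0 = reprN x := okB.
have okAS x : sel x -> tb6 tARCS x 0 = arcsN x.
  move=> sx; have xN := sel_ltN sx; have rN := sel_ltN (repr_sel sx).
  rewrite -[LHS]/(ev N inp tb5 (rcons (rcons vs x) 0) bARCS) /bARCS ev_if getS // /arcsN.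
  have bE : ev N inp tb5 (rcons (rcons vs x) 0) (get1 tBAR X) = reprN x by rewrite get1E // okB.
  rewrite [ev _ _ _ _ X]/=; case: ifP => _.
    by rewrite -[LHS]/(2 * ev N inp tb5 (rcons (rcons vs x) 0) (get1 tPL X)) get1E // okL5.
  rewrite -[LHS]/(2 * ev N inp tb5 (rcons (rcons vs x) 0) (get1 tPR (get1 tBAR X)) + 1).
  by rewrite get1E bE // okR5 // repr_sel.
rewrite run_seq run_tab; set tb7 := upd_tab tb6 _ _.
have okAT x : sel x -> tb7 tARCT x 0 = arctN x.
  move=> sx; have xN := sel_ltN sx; have rN := sel_ltN (repr_sel sx).
  rewrite -[LHS]/(ev N inp tb6 (rcons (rcons vs x) 0) bARCT) /bARCT ev_if getS // /arctN.
  have bE : ev N inp tb6 (rcons (rcons vs x) 0) (get1 tBAR X) = reprN x by rewrite get1E // okB6.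
  rewrite [ev _ _ _ _ X]/=; case: ifP => _.
    by rewrite -[LHS]/(2 * ev N inp tb6 (rcons (rcons vs x) 0) (get1 tPR X)) get1E // okR6.
  rewrite -[LHS]/(2 * ev N inp tb6 (rcons (rcons vs x) 0) (get1 tPL (get1 tBAR X)) + 4 * N - 1).
  by rewrite get1E bE // okL6 // repr_sel.
rewrite run_seq (run_tab N inp tCNT); set tb8 := upd_tab tb7 _ _.
have okC x : x < N -> tb8 tCNT x 0 = cntN x.
  move=> xN; rewrite -[LHS]/(ev N inp tb7 (rcons (rcons vs x) 0) bCNT) /bCNT ev_sum.
  apply: eq_bigr => k _; rewrite ev_B tv_and sel_ok ?ltn_ord // tv_lt //.
rewrite run_tab; set tb9 := upd_tab tb8 _ _.
have okT x : x < N -> tb9 tREPOF x 0 = twinN x.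
  move=> xN; rewrite -[LHS]/(ev N inp tb8 (rcons (rcons vs x) 0) bREPOF) /bREPOF ev_find.
  apply: eq_find_iota => k kN; rewrite tv_and !tv_get /= !clamp_id //.
  by rewrite -[tb8 tREP k 0]/(tb0 tREP k 0) -[tb8 tTW k x]/(tb0 tTW k x) !ok_pre.
exists tb9, ca, cb; split=> //; split; last by split.
by do 12?[case=> //].
Qed.

Hypothesis inp_adj : forall i j, i < n -> j < n -> GN n inp i j = (inp (1 + (i * n + j)) != 0).

Definition nonuniv x := has (fun k => (k < n) && ~~ GN n inp x k) (iota 0 N).
Definition arc_out_s u := if nonuniv u then arcsN (twinN u) else 0.
Definition arc_out_t u := if nonuniv u then arctN (twinN u) else 4 * N - 1.

Hypothesis twin_sel : forall u, u < n -> nonuniv u -> sel (twinN u).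

Lemma iota_cat_filter (A : Type) (f : nat -> A) (P : pred nat) m : 
  flatten [seq (if P k then [:: f k] else [::]) | k <- iota 0 m] = [seq f k | k <- iota 0 m & P k].
Proof. by elim: (iota 0 m) => //= k l ->; case: (P k). Qed.

Lemma filter_ltn_iota m : m <= N -> [seq k <- iota 0 N | k < m] = iota 0 m.
Proof.
move=> mN; rewrite -(subnKC mN) iotaD filter_cat add0n.
have -> : [seq k <- iota 0 m | k < m] = iota 0 m.
  by apply/all_filterP/allP => k; rewrite mem_iota.
have -> : [seq k <- iota m (N - m) | k < m] = [::].
  apply/eqP; rewrite -(negbK (_ == _)) -has_filter; apply/negP => /hasP[k].
  by rewrite mem_iota leqNgt => /andP[/negP].
by rewrite cats0.
Qed.

Lemma run_arcs tb ca cb cx cy rt rx ry : post_ok tb ->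
  outs (run N inp c_arcs (HState tb [:: n; z; zb; cx; cy; rt; rx; ry; ca; cb; 0] [::])) =
  [:: 1; 4 * N] ++ [seq arc_out_s u | u <- iota 0 n] ++ [seq arc_out_t u | u <- iota 0 n].
Proof.
move=> [okt [okS okT okC okR]]; have N0 : 0 < N by lia.
have nN : n <= N by lia.
have okA : tab_ok n inp tb tADJ by move=> x y; rewrite okt //; apply: ok_pre.
rewrite /c_arcs run_seq run_out run_seq run_out run_seq; set vs := [:: n; z; zb; cx; cy; rt; rx; ry; ca; cb; 0].
have nu k : k < N -> tv N inp tb (rcons vs k) eNonuniv = nonuniv k.
  move=> kN; rewrite /eNonuniv tv_ex; apply: eq_has_iota => j jN.
  by rewrite tv_and tv_lt tv_not tv_get /= !clamp_id // okA.
have get1E w t a : ev N inp tb w a < N -> ev N inp tb w (get1 t a) = tb t (ev N inp tb w a) 0.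
  by move=> aN; rewrite /= !clamp_id.
have twN' k : k < n -> nonuniv k -> sel (twinN k) by exact: twin_sel.
rewrite (@run_for_out _ _ _ _ _ _ (fun u => if u < n then [:: arc_out_s u] else [::])); last first.
  move=> k o kN; rewrite run_if tv_lt [ev _ _ _ _ X]/= [ev _ _ _ _ vn]/=; case: ifP => kn; last by rewrite cats0.
  rewrite run_out -(cats1 o) ev_if nu // /arc_out_s.
  case: ifP => nk; last by [].
  have s_k := twN' k kn nk; have tk := sel_ltN s_k.
  have -> // : ev N inp tb (rcons vs k) (get1 tARCS (get1 tREPOF X)) = arcsN (twinN k).
  by rewrite get1E get1E // okR // okS.
rewrite (@run_for_out _ _ _ _ _ _ (fun u => if u < n then [:: arc_out_t u] else [::])); last first.
  move=> k o kN; rewrite run_if tv_lt [ev _ _ _ _ X]/= [ev _ _ _ _ vn]/=; case: ifP => kn; last by rewrite cats0.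
  rewrite run_out -(cats1 o) ev_if nu // /arc_out_t.
  case: ifP => nk; last by [].
  have s_k := twN' k kn nk; have tk := sel_ltN s_k.
  have -> // : ev N inp tb (rcons vs k) (get1 tARCT (get1 tREPOF X)) = arctN (twinN k).
  by rewrite get1E get1E // okR // okT.
by rewrite /= !iota_cat_filter !filter_ltn_iota.
Qed.

Definition repsN := [seq k <- iota 0 N | repN n inp k].
Definition selsN := [seq k <- iota 0 N | sel k].
(* Roots are their own parents, so the walk waits once it has reached one. *)
Definition walkN (c : nat * nat) i := iter i (parent (search_of n tb0)) c.

Lemma iota_cat_filter_seq (f : nat -> seq nat) (P : pred nat) m : 
  flatten [seq (if P k then f k else [::]) | k <- iota 0 m] = flatten [seq f k | k <- iota 0 m & P k].
Proof. by elim: (iota 0 m) => //= k l ->; case: (P k). Qed.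

Lemma run_walk tb ca cb cx cy rt rx ry cur o (first : bool) : post_ok tb ->
  (forall i, in_range N (walkN (cb, ca) i)) ->
  exists cur', run N inp (c_walk first) (HState tb [:: n; z; zb; cx; cy; rt; rx; ry; ca; cb; cur] o) =
  HState tb [:: n; z; zb; cx; cy; rt; rx; ry; ca; cb; cur']
    (o ++ [seq cntN ((if first then fst else snd) (walkN (cb, ca) i)) | i <- iota 0 (N * N + 1)]).
Proof.
move=> [okt [_ _ okC _]] wR; have N0 : 0 < N by lia.
pose w i := walkN (cb, ca) i; pose code (p : nat * nat) := p.1 * N + p.2.
pose pr (p : nat * nat) := (if first then fst else snd) p.
have wS i : w i.+1 = parent (search_of n tb0) (w i) by [].
have codeS i : code (w i.+1) = tb0 tPAR (w i).1 (w i).2.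
  by rewrite wS /code /=; have := leq_divM (tb0 tPAR (w i).1 (w i).2) N; clear; lia.
have evQ v i : nth 0 v 10 = code (w i) -> ev N inp tb v eQ = (w i).1.
  have [h1 h2] := andP (wR i) => e.
  by rewrite -[LHS]/(nth 0 v 10 %/ N) e /code divnMDl // divn_small // addn0.
have evR v i : nth 0 v 10 = code (w i) -> ev N inp tb v eR = (w i).2.
  move=> e; rewrite -[LHS]/(nth 0 v 10 - ev N inp tb v eQ * N) (evQ v i e) e /code.
  by rewrite addKn.
have evP v i : nth 0 v 10 = code (w i) -> 
    ev N inp tb v (get1 tCNT (if first then eQ else eR)) = cntN (pr (w i)).
  have [h1 h2] := andP (wR i) => e.
  have e0 : ev N inp tb v (if first then eQ else eR) = pr (w i).
    by rewrite /pr; case: (first); [apply: evQ|apply: evR].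
  have hN : pr (w i) < N by rewrite /pr; case: (first).
  by rewrite -[LHS]/(tb tCNT (clamp N (ev N inp tb v (if first then eQ else eR))) (clamp N 0)) e0 !clamp_id // okC.
have evN v i : nth 0 v 10 = code (w i) -> ev N inp tb v (get tPAR eQ eR) = code (w i.+1).
  have [h1 h2] := andP (wR i) => e.
  rewrite -[LHS]/(tb tPAR (clamp N (ev N inp tb v eQ)) (clamp N (ev N inp tb v eR))).
  by rewrite (evQ v i e) (evR v i e) !clamp_id // okt // codeS.
pose vs c := [:: n; z; zb; cx; cy; rt; rx; ry; ca; cb; c].
pose out_to k := o ++ [seq cntN (pr (w i)) | i <- iota 0 k].
have outS k : out_to k.+1 = rcons (out_to k) (cntN (pr (w k))).
  by rewrite /out_to -addn1 iotaD map_cat catA cats1 add0n.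
pose Inv k (tb' : table) (v o' : seq nat) := [/\ tb' = tb, v = vs (code (w k)) & o' = out_to k].
pose Inv2 i k (tb' : table) (v o' : seq nat) := [/\ tb' = tb, v = rcons (vs (code (w (i * N + k)))) i & o' = out_to (i * N + k)].
rewrite /c_walk run_seq run_set run_seq.
have -> : set_nth 0 (vs cur) 10 (ev N inp tb (vs cur) (eCode vcb vca)) = vs (code (w 0)) by [].
have [||tb1 [v1 [o1 [-> _ [-> -> ->]]]]] := @run_for N inp
   (HFor (HSeq (HOut (get1 tCNT (if first then eQ else eR))) (HSet 10 (get tPAR eQ eR))))
   tb (vs (code (w 0))) o (fun i => Inv (i * N)).
- move=> i tb1 v1 o1 iN [-> -> ->].
  have [||tb2 [v2 [o2 [e2 _ [h1 h2 h3]]]]] := @run_for N inp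
    (HSeq (HOut (get1 tCNT (if first then eQ else eR))) (HSet 10 (get tPAR eQ eR)))
    tb (rcons (vs (code (w (i * N)))) i) (out_to (i * N)) (Inv2 i).
  + move=> k tb2 v2 o2 kN [-> -> ->].
    exists tb, (rcons (vs (code (w (i * N + k.+1)))) i), (out_to (i * N + k.+1)).
    split; last by split.
    rewrite run_seq run_out run_set (evP _ (i * N + k)) // (evN _ (i * N + k)) //.
    by rewrite (addnS (i * N)) outS.
  + by split=> //; rewrite addn0.
  exists tb, (vs (code (w (i.+1 * N)))), (out_to (i.+1 * N)); rewrite e2 h1 h2 h3 (mulSnr i).
  by split.
- by split=> //; rewrite /out_to /= cats0.
exists (code (w (N * N))); rewrite run_out (evP _ (N * N)) //.
by rewrite -[out_to _]/(out_to (N * N)) -outS addn1.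
Qed.

Lemma run_obstruction tb ca cb cx cy rt rx ry : post_ok tb -> sel z -> ca < N -> cb < N ->
  (forall i, in_range N (walkN (cb, ca) i)) ->
  outs (run N inp c_obstruction (HState tb [:: n; z; zb; cx; cy; rt; rx; ry; ca; cb; 0] [::])) =
  [:: 0; \sum_(k < N) repN n inp k; \sum_(k < N) sel k] ++
  repsN ++ [seq cntN k | k <- repsN] ++
  flatten [seq [seq nat_of_bool (~~ dj a b) | b <- selsN] | a <- selsN] ++
  [:: cntN z; cntN cb; cntN ca; N * N + 1; N * N + 1] ++
  [seq cntN (walkN (cb, ca) i).1 | i <- iota 0 (N * N + 1)] ++
  [seq cntN (walkN (cb, ca) i).2 | i <- iota 0 (N * N + 1)].
Proof.
move=> pok sz caN cbN wR; have [okt [_ _ okC _]] := pok; have N0 : 0 < N by lia.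
have okr (v : seq nat) a : ev N inp tb v a < N -> tv N inp tb v (get1 tREP a) = repN n inp (ev N inp tb v a).
  by move=> aN; rewrite tv_get /= !clamp_id // okt // ok_pre.
have oks (v : seq nat) a : ev N inp tb v a < N -> tv N inp tb v (get1 tSEL a) = sel (ev N inp tb v a).
  by move=> aN; rewrite tv_get /= !clamp_id // okt // ok_pre.
have get1E w t a : ev N inp tb w a < N -> ev N inp tb w (get1 t a) = tb t (ev N inp tb w a) 0.
  by move=> aN; rewrite /= !clamp_id.
rewrite /c_obstruction; set vs := [:: n; z; zb; cx; cy; rt; rx; ry; ca; cb; 0].
do 3!rewrite run_seq run_out.
have -> : ev N inp tb vs (eSum (eB (get1 tREP X))) = \sum_(k < N) repN n inp k.
  by rewrite ev_sum; apply: eq_bigr => k _; rewrite ev_B okr ?ltn_ord.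
have -> : ev N inp tb vs (eSum (eB (get1 tSEL X))) = \sum_(k < N) sel k.
  by rewrite ev_sum; apply: eq_bigr => k _; rewrite ev_B oks ?ltn_ord.
rewrite run_seq (@run_for_out _ _ _ _ _ _ (fun u => if repN n inp u then [:: u] else [::])); last first.
  move=> k o kN; rewrite run_if okr // [ev _ _ _ _ X]/=; case: ifP => _; last by rewrite cats0.
  by rewrite run_out -(cats1 o).
rewrite run_seq (@run_for_out _ _ _ _ _ _ (fun u => if repN n inp u then [:: cntN u] else [::])); last first.
  move=> k o kN; rewrite run_if okr // [ev _ _ _ _ X]/=; case: ifP => _; last by rewrite cats0.
  by rewrite run_out -(cats1 o) get1E // okC.
rewrite run_seq (@run_for_out _ _ _ _ _ _ (fun a => if sel a then
    [seq nat_of_bool (~~ dj a b) | b <- selsN] else [::])); last first.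
  move=> k o kN; rewrite run_if oks // [ev _ _ _ _ X]/=; case: (boolP (sel k)) => sk; last by rewrite cats0.
  rewrite (@run_for_out _ _ _ _ _ _ (fun b => if sel b then [:: nat_of_bool (~~ dj k b)] else [::])).
    by rewrite iota_cat_filter.
  move=> j o1 jN; rewrite run_if oks // [ev _ _ _ _ Y]/=; case: (boolP (sel j)) => sj; last by rewrite cats0.
  rewrite run_out -(cats1 o1) ev_not; have bj := bar_ltN sj.
  have -> // : tv N inp tb (rcons (rcons vs k) j) (eDj X Y) = dj k j.
  rewrite /eDj ple_tv ?bar_ev // => x y xN yN.
  by rewrite okt // ok_pre.
do 5!rewrite run_seq run_out.
have zN' := sel_ltN sz.
have -> : ev N inp tb vs (get1 tCNT vz) = cntN z by rewrite get1E // okC.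
have -> : ev N inp tb vs (get1 tCNT vca) = cntN ca by rewrite get1E // okC.
have -> : ev N inp tb vs (get1 tCNT vcb) = cntN cb by rewrite get1E // okC.
rewrite run_seq.
set o := (X in HState _ _ X).
have [c1 ->] := @run_walk tb ca cb cx cy rt rx ry 0 o true pok wR.
set o2 := (X in HState _ _ X).
have [c2 ->] := @run_walk tb ca cb cx cy rt rx ry c1 o2 false pok wR.
rewrite /= /o2 /o !iota_cat_filter iota_cat_filter_seq map_id -/repsN -/selsN.
by rewrite -!cats1 /= -!catA.
Qed.

End Post.

(** * The vertices of the completion as numbers *)

Lemma nth_allpairs_ord n (f : 'I_n -> 'I_n -> nat) (i j : 'I_n) :
  nth 0 [seq f i j | i <- enum 'I_n, j <- enum 'I_n] (i * n + j) = f i j.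
Proof.
have gen (A B : Type) (a0 : A) (b0 : B) (h : A -> B -> nat) s t a b : a < size s -> b < size t ->
    nth 0 [seq h x y | x <- s, y <- t] (a * size t + b) = h (nth a0 s a) (nth b0 t b).
  elim: s a => // x s IH [|a] /= ha hb; rewrite nth_cat size_map.
    by rewrite mul0n add0n hb (nth_map b0).
  by rewrite mulSn -addnA ltnNge leq_addr /= addKn IH.
have := @gen _ _ i j f (enum 'I_n) (enum 'I_n) i j.
by rewrite !size_enum_ord !nth_ord_enum => ->.
Qed.

Lemma big_filter_iota N (P : pred nat) (f : nat -> nat) :
  \sum_(k < N) (if P k then f k else 0) = \sum_(i < size [seq k <- iota 0 N | P k]) f (nth 0 [seq k <- iota 0 N | P k] i).
Proof.
rewrite -(big_mkord predT (fun i => f (nth 0 [seq k <- iota 0 N | P k] i))) -(big_nth 0 predT f) big_filter.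
rewrite -big_mkcond /= -(big_mkord P f) /index_iota subn0 //.
Qed.

Lemma sum_filter_iota N (P : pred nat) : \sum_(k < N) P k = size [seq k <- iota 0 N | P k].
Proof.
have -> : \sum_(k < N) P k = \sum_(k < N) (if P k then (fun=> 1) (val k) else 0).
  by apply: eq_bigr => k _; case: (P k).
by rewrite (big_filter_iota N P (fun=> 1)) sum_nat_const card_ord muln1.
Qed.

Section Input.

Variables (n : nat) (G : rel 'I_n).
Hypothesis gG : graph G.
Local Notation N := (2 * n + 2).
Definition inpG := nth 0 (n :: adjacency_matrix G).

Lemma inpG0 : inpG 0 = n. Proof. by []. Qed.

(** [2 * n + 2] bounds the stored vertex count and the bits of the matrix, and stays above 1 for the
    empty graph. *)
Lemma inpG_lt a : inpG a < N.
Proof.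
rewrite /inpG; case: a => [|a] /=; first by lia.
case: (ltnP a (size (adjacency_matrix G))) => h; last by rewrite nth_default //; lia.
by have /allpairsP[p [_ _ ->]] := mem_nth 0 h; case: (G _ _); lia.
Qed.

Lemma GNE (i j : 'I_n) : GN n inpG i j = G i j.
Proof.
by rewrite /GN !ltn_ord /inpG /= nth_allpairs_ord; case: (G i j).
Qed.

Lemma mem_iota_ord (k : 'I_n) : val k \in iota 0 N.
Proof. by rewrite mem_iota add0n (leq_trans (ltn_ord k)) //; clear; lia. Qed.

Lemma all_ordP (P : pred nat) : all (fun k => (k < n) ==> P k) (iota 0 N) = [forall k : 'I_n, P k].
Proof.
apply/allP/forallP => [h k|h k].
  by have := h (val k) (mem_iota_ord k); rewrite ltn_ord.
by rewrite mem_iota add0n => /andP[_ _]; apply/implyP => kn; apply: (h (Ordinal kn)).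
Qed.

Lemma twNE (i j : 'I_n) : twN n inpG i j = true_twins G i j.
Proof.
rewrite /twN all_ordP; apply/forallP/eqP => [h|e k].
  by apply/setP => k; rewrite !inE; have /eqP := h k; rewrite !GNE.
by rewrite !GNE; move/setP: e => /(_ k); rewrite !inE => ->.
Qed.

Lemma nonunivE (i : 'I_n) : has (fun k => (k < n) && ~~ GN n inpG i k) (iota 0 N) = ~~ universal G i.
Proof.
rewrite -[LHS]negbK -all_predC; congr negb; rewrite /universal.
have -> : all (predC (fun k => (k < n) && ~~ GN n inpG i k)) (iota 0 N) =
    all (fun k => (k < n) ==> GN n inpG i k) (iota 0 N).
  by apply: eq_all => k /=; rewrite negb_and negbK implybE.
by rewrite all_ordP; apply: eq_forallb => k; rewrite GNE.
Qed.

Lemma repNE (i : 'I_n) : repN n inpG i = ~~ universal G i &&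
  [forall j : 'I_n, (j < i) ==> ~~ true_twins G j i].
Proof.
rewrite /repN ltn_ord nonunivE /=; congr andb; apply/hasPn/forallP => [h j|h k].
  apply/implyP => ji; by have := h (val j) (mem_iota_ord j); rewrite -twNE ji.
rewrite mem_iota => _; apply/negP => /andP[ki]; have kn := ltn_trans ki (ltn_ord i).
by have := h (Ordinal kn); rewrite ki /= -twNE => /negP.
Qed.

Lemma repN_lt x : repN n inpG x -> x < n.
Proof. by case/and3P. Qed.

Local Notation reps := (repsN n inpG).
Local Notation rep := (repN n inpG).

Lemma mem_reps x : (x \in reps) = rep x.
Proof.
rewrite mem_filter mem_iota add0n; case: (boolP (rep x)) => //= /repN_lt xn.
by move: xn; clear; lia.
Qed.

Lemma nth_reps_lt (i : 'I_(size reps)) : nth 0 reps i < n.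
Proof. by apply: repN_lt; rewrite -mem_reps mem_nth. Qed.

Lemma kN_ex (i : 'I_(size reps)) : exists j : 'I_n, val j == nth 0 reps i.
Proof. by exists (Ordinal (nth_reps_lt i)). Qed.

Definition kN (i : 'I_(size reps)) : 'I_n := xchoose (kN_ex i).

Lemma val_kN i : kN i = nth 0 reps i :> nat.
Proof. exact/eqP/(xchooseP (kN_ex i)). Qed.

Lemma kN_rep i : rep (kN i).
Proof. by rewrite -mem_reps val_kN mem_nth. Qed.

Lemma kN_inj : injective kN.
Proof.
move=> i j /(congr1 val); rewrite /= !val_kN => /eqP.
by rewrite nth_uniq ?filter_uniq ?iota_uniq // => /eqP/val_inj.
Qed.

Lemma kN_onto x : rep x -> exists i, val (kN i) = x.
Proof.
rewrite -mem_reps => h; have hi : index x reps < size reps by rewrite index_mem.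
by exists (Ordinal hi); rewrite /= val_kN nth_index.
Qed.

Lemma universal_twin u v : true_twins G u v -> universal G u = universal G v.
Proof.
move=> /eqP/setP e; apply: eq_forallb => w; have := e w.
by rewrite !inE.
Qed.

Lemma kN_reduction : reduction G kN.
Proof.
split=> [i|i j tij|u nu].
- by have := kN_rep i; rewrite repNE => /andP[].
- have h a b : true_twins G (kN a) (kN b) -> ~~ (kN a < kN b).
    move=> t; apply/negP => lt; have := kN_rep b; rewrite repNE => /andP[_ /forallP/(_ (kN a))].
    by rewrite lt t.
  have tji : true_twins G (kN j) (kN i) by rewrite /true_twins eq_sym.
  by apply: kN_inj; apply: ord_inj; have := h _ _ tij; have := h _ _ tji; case: ltngtP.
- have t0 : true_twins G u u by exact: eqxx.
  case: (arg_minnP (fun j : 'I_n => val j) t0) => j tj jmin.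
  have [|i e] := @kN_onto j; last by exists i; rewrite (_ : kN i = j) //; apply: val_inj.
  rewrite repNE -(universal_twin tj) nu; apply/forallP => w; apply/implyP => wj.
  apply/negP => tw; have := jmin w; rewrite leqNgt wj => /(_ _)/negP; apply => //.
  by rewrite /true_twins (eqP tw) -/(true_twins G u j).
Qed.

Definition gN : rel 'I_(size reps) := relpre kN G.

Lemma gN_graph : graph gN.
Proof. by case: gG => h1 h2; split=> [i|i j]; rewrite /gN /=. Qed.

(** Every vertex of [G] is universal or has a surviving twin, so adjacency to all survivors means
    adjacency to all vertices. The same remark shows that deletion creates no new twins. *)
Lemma gN_no_universal u : ~~ universal gN u.
Proof.
case: gG => _ gs; case: kN_reduction => h1 _ h3.
apply/negP => /forallP hu; case/negP: (h1 u); apply/forallP => v.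
have [/forallP hv|nv] := boolP (universal G v); first by rewrite gs.
have [w /eqP/setP/(_ (kN u))] := h3 v nv; rewrite !inE gs => ->.
by rewrite gs; apply: hu.
Qed.

Lemma gN_twin_free u v : true_twins gN u v -> u = v.
Proof.
case: gG => _ gs; case: kN_reduction => h1 h2 h3 /eqP/setP t; apply: h2.
apply/eqP/setP => x; rewrite !inE.
have [/forallP hx|nx] := boolP (universal G x); first by rewrite gs hx gs hx.
have [w /eqP/setP tw] := h3 x nx; have := tw (kN u); have := tw (kN v).
rewrite !inE ![G x _]gs => -> ->; have := t w; by rewrite !inE /gN /= ![G (kN w) _]gs.
Qed.

Local Notation g := gN.

Lemma all_repP (P : pred nat) : all (fun k => rep k ==> P k) (iota 0 N) = [forall i, P (kN i)].
Proof.
apply/allP/forallP => [h i|h k _].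
  by have := h (kN i) (mem_iota_ord (kN i)); rewrite kN_rep.
by apply/implyP => /kN_onto[i <-]; exact: h i.
Qed.

Lemma has_repP (P : pred nat) : has (fun k => rep k && P k) (iota 0 N) = [exists i, P (kN i)].
Proof.
apply/hasP/existsP => [[k _ /andP[/kN_onto[i <-] h]]|[i h]]; first by exists i.
by exists (val (kN i)); rewrite ?kN_rep ?mem_iota_ord.
Qed.

Lemma subNE u v : subN n inpG (kN u) (kN v) = (nbhd g u \subset nbhd g v).
Proof.
rewrite /subN; transitivity [forall i, GN n inpG (kN u) (kN i) ==> GN n inpG (kN v) (kN i)].
  rewrite -(all_repP (fun k => GN n inpG (kN u) k ==> GN n inpG (kN v) k)).
  by apply: eq_all => k; case: (rep k).
apply/forallP/subsetP => [h i|h i]; first by have := h i; rewrite !GNE !inE => /implyP.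
by have := h i; rewrite !GNE !inE => ?; apply/implyP.
Qed.

Lemma spanNE u v : spanN n inpG (kN u) (kN v) = spanning_pair g u v.
Proof.
rewrite /spanN (all_repP (fun k => (GN n inpG (kN v) k || subN n inpG k (kN u)) && (GN n inpG (kN u) k || subN n inpG k (kN v)))).
apply/forallP/andP => [h|[/forallP h1 /forallP h2] i].
  split; apply/forallP => i; have := h i; rewrite !GNE !subNE !inE /gN /= => /andP[].
    by case: (G (kN v) _).
  by case: (G (kN u) _).
have := h1 i; have := h2 i; rewrite !GNE !subNE !inE /gN /=.
by case: (G (kN v) _); case: (G (kN u) _) => //= h3 h4; apply/andP; split.
Qed.

Definition enc (p : 'I_(size reps) * bool) : nat := if p.2 then kN p.1 + n else kN p.1.

Lemma enc_inj : injective enc.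
Proof.
move=> [u b] [v b'] /=; rewrite /enc /=; have := ltn_ord (kN u); have := ltn_ord (kN v).
case: b; case: b' => h1 h2 e.
- by congr pair; apply: kN_inj; apply: ord_inj; apply: addIn e.
- by move: h1 => /=; rewrite -e ltnNge leq_addl.
- by move: h2 => /=; rewrite e ltnNge leq_addl.
- by congr pair; apply: kN_inj; apply: ord_inj.
Qed.

Lemma pleNE p q : pleN n inpG (enc p) (enc q) = ple g p q.
Proof.
case: p q => [u b] [v b']; rewrite /pleN /enc /ple /=.
have eu : (kN u + n < n) = false by rewrite ltnNge leq_addl.
have ew : (kN v + n < n) = false by rewrite ltnNge leq_addl.
by case: b; case: b'; rewrite ?eu ?ew ?addnK ?ltn_ord ?subNE ?spanNE ?GNE.
Qed.

Lemma barNE p : barN n (enc p) = enc (pbar p).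
Proof.
case: p => u []; rewrite /barN /enc /pbar /= ?ltn_ord //.
by rewrite ltnNge leq_addl addnK.
Qed.

Definition kept (p : 'I_(size reps) * bool) := p.2 ==> ~~ [exists v, circular_pair g p.1 v].

Lemma selN_enc p : selN n inpG (enc p) = kept p.
Proof.
case: p => u b; rewrite /selN /enc /kept /=; case: b => /=; last by rewrite ltn_ord kN_rep.
have -> : (kN u + n < n) = false by rewrite ltnNge leq_addl.
rewrite addnK kN_rep ltn_add2r ltn_ord /= (has_repP (fun k => ~~ GN n inpG (kN u) k && spanN n inpG (kN u) k)).
by congr negb; apply: eq_existsb => v; rewrite GNE spanNE.
Qed.

Lemma selN_ex a : selN n inpG a -> exists p, enc p = a.
Proof.
rewrite /selN; case: ltnP => [_ /kN_onto[u e]|na /andP[/andP[_ /kN_onto[u e]] _]].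
  by exists (u, false).
by exists (u, true); rewrite /enc /= e subnK.
Qed.

Local Notation sels := (selsN n inpG).
Local Notation sel := (selN n inpG).

Lemma mem_sels x : (x \in sels) = sel x.
Proof.
rewrite mem_filter mem_iota add0n; case: (boolP (sel x)) => //= /(sel_lt inpG0) xn.
by move: xn; clear; lia.
Qed.

Local Notation U := 'I_(size sels).
Definition idN (i : U) : nat := nth 0 sels i.

Lemma idN_sel i : sel (idN i).
Proof. by rewrite -mem_sels mem_nth. Qed.

Lemma idN_inj : injective idN.
Proof.
move=> i j /eqP; rewrite nth_uniq ?filter_uniq ?iota_uniq //.
by move/eqP/val_inj.
Qed.

Lemma idN_onto x : sel x -> exists i, idN i = x.
Proof.
rewrite -mem_sels => h; have hi : index x sels < size sels by rewrite index_mem.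
by exists (Ordinal hi); rewrite /idN /= nth_index.
Qed.

Lemma idN_lt i : idN i < N.
Proof. by have := sel_lt inpG0 (idN_sel i); clear; lia. Qed.

Lemma cN_ex i : exists p, enc p == idN i.
Proof. by have [p /eqP] := selN_ex (idN_sel i); exists p. Qed.

Definition cN (i : U) := xchoose (cN_ex i).

Lemma enc_cN i : enc (cN i) = idN i.
Proof. exact/eqP/(xchooseP (cN_ex i)). Qed.

Lemma cN_eq i p : enc p = idN i -> cN i = p.
Proof. by move=> e; apply: enc_inj; rewrite enc_cN. Qed.

Lemma cN_inj : injective cN.
Proof. by move=> i j e; apply: idN_inj; rewrite -!enc_cN e. Qed.

Lemma cN_onto p : kept p -> exists i, cN i = p.
Proof. by rewrite -selN_enc => /idN_onto[i /esym/cN_eq]; exists i. Qed.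

Lemma cN_false u : exists i, cN i = (u, false).
Proof. exact: cN_onto. Qed.

Lemma cN_true u : (exists i, cN i = (u, true)) <-> ~ exists v, circular_pair g u v.
Proof.
split=> [[i e] [v h]|h]; last by apply: cN_onto; apply/existsP.
by have := idN_sel i; rewrite -enc_cN e selN_enc => /existsP; apply; exists v.
Qed.

Definition leN : rel U := leU gN cN.
Definition barUN : U -> U := barU gN_graph cN_false cN_true.

Lemma leNE i j : pleN n inpG (idN i) (idN j) = leN i j.
Proof. by rewrite -!enc_cN pleNE. Qed.

Lemma djNE i j : djN n inpG (idN i) (idN j) = apart leN barUN i j.
Proof. by rewrite /djN -!enc_cN barNE pleNE /apart /leN /barUN leU_barr. Qed.

Lemma leN_refl : reflexive leN.
Proof. exact: leU_refl. Qed.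

Lemma leN_trans x y w : leN x y -> leN y w -> leN x w.
Proof. exact: (leU_trans gN_graph). Qed.

Lemma leN_anti x y : leN x y -> leN y x -> x = y.
Proof. exact: (leU_anti gN_graph gN_twin_free cN_inj cN_true). Qed.

Lemma barNK : involutive barUN.
Proof. exact: (barUK gN_graph gN_twin_free cN_inj). Qed.

Lemma leN_bar x y : leN (barUN x) (barUN y) = leN y x.
Proof. exact: leU_bar. Qed.

Lemma leN_barF x : leN x (barUN x) = false.
Proof. exact: (leU_barF gN_graph gN_no_universal). Qed.

End Input.

Lemma find_iota_unique N (P : pred nat) k : k < N -> P k -> (forall j, j < N -> P j -> j = k) ->
  find P (iota 0 N) = k.
Proof.
move=> kN Pk h; have lt := find_lt_ex kN Pk; have [h1 _] := find_iotaP lt.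
exact: h.
Qed.

(** * Search results read in the completion *)

Section Link.

Variables (n : nat) (G : rel 'I_n).
Hypothesis gG : graph G.
Local Notation N := (2 * n + 2).
Local Notation inp := (inpG G).
Local Notation sel := (selN n inp).
Local Notation U := 'I_(size (selsN n inp)).
Local Notation le := (@leN n G).
Local Notation bar := (barUN gG).
Local Notation id := (@idN n G).

Lemma repr_pred x y : sel (id y) && (pleN n inp (id y) (barN n (id x)) && pleN n inp (barN n (id x)) (id y)) =
  (y == bar x).
Proof.
rewrite idN_sel -!enc_cN barNE !pleNE //=; apply/andP/eqP => [[h1 h2]|->]; last first.
  by split; have [] := barUP (gN_graph gG) (@cN_false n G) (@cN_true n G) x.
by apply: (leN_anti gG); rewrite /barUN /leN ?leU_barr ?leU_barl.
Qed.

Lemma reprNE x : reprN n inp (id x) = id (bar x).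
Proof.
apply: find_iota_unique; first exact: idN_lt; first by rewrite repr_pred.
move=> j _; case: (boolP (sel j)) => // /idN_onto[y <-] h; congr id; apply/eqP.
by rewrite -repr_pred idN_sel.
Qed.

Lemma niNE x y : niN n inp (id x) (id y) = incomparable le x y.
Proof. by rewrite /niN !leNE. Qed.

Lemma min_pred x : sel (id x) && ~~ has (fun y => selN n inp y && (~~ (y == id x) && pleN n inp y (id x))) (iota 0 N) =
  [forall y, le y x ==> (y == x)].
Proof.
rewrite idN_sel -all_predC; apply/allP/forallP => [h y|h j _].
  have := h (id y); rewrite mem_iota idN_lt /= idN_sel leNE // (inj_eq (@idN_inj n G)).
  by case: (y == x) => /= [_|/(_ isT) /negbTE ->] //; rewrite implybT.
apply/negP => /andP[/idN_onto[y <-]]; rewrite leNE // (inj_eq (@idN_inj n G)) => /andP[n1 l].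
by have := h y; rewrite l (negbTE n1).
Qed.

Lemma zN_ex a : sel a -> exists2 z : U, id z = zN n inp & forall x, le x z -> x = z.
Proof.
move=> /idN_onto[x0 _].
(* A vertex with the fewest vertices below it is minimal. *)
case: (@arg_minnP _ x0 predT (fun x => #|[pred y | le y x]|) isT) => x _ xmin.
have Px : [forall y, le y x ==> (y == x)].
  apply/forallP => y; apply/implyP => yx; apply/negPn/negP => ne.
  have := xmin y isT; rewrite leqNgt => /negP; apply; apply: proper_card; apply/properP; split.
    by apply/subsetP => w; rewrite !inE => wy; apply: (leN_trans gG) wy yx.
  exists x; rewrite !inE ?leN_refl //; apply: contra ne => xy; apply/eqP.
  exact: leN_anti xy.
have lt : zN n inp < N by apply: (find_lt_ex (idN_lt x)); rewrite min_pred.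
have [P _] := find_iotaP lt; have [z e] := idN_onto (zN_sel lt).
exists z => // w wz; have := min_pred z; rewrite e P => /esym/forallP/(_ w).
by rewrite wz => /eqP.
Qed.

Variable z : U.
Hypothesis idz : id z = zN n inp.
Hypothesis z_min : forall x, le x z -> x = z.

Lemma zbNE : zbN n inp = id (bar z).
Proof. by rewrite -reprNE idz. Qed.

Lemma vzNE x : vzN n inp (id x) = incomparable le z x.
Proof. by rewrite /vzN idN_sel -idz niNE. Qed.

Lemma fpNE x y : fpN n inp (id x) (id y) = free_pair le z x y.
Proof. by rewrite /fpN !vzNE niNE. Qed.

Lemma fpN_onto a b : fpN n inp a b -> exists x y, id x = a /\ id y = b.
Proof.
case/and3P=> /andP[/idN_onto[x <-] _] /andP[/idN_onto[y <-] _] _.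
by exists x, y.
Qed.

Definition idp (p : U * U) := (id p.1, id p.2).

Lemma idp_inj p q : idp p = idp q -> p = q.
Proof. by case: p q => [x y] [x' y'] [/idN_inj -> /idN_inj ->]. Qed.

Local Notation F := (fpN n inp).
Local Notation mv := (moveN n inp (zN n inp) F).
Local Notation MV := (fun p q => mv p q : Prop).

Lemma fpairNE p : fpairN n F (idp p) = free_pair le z p.1 p.2.
Proof. by rewrite /fpairN /in_range !idN_lt fpNE. Qed.

Lemma fpairN_onto p : fpairN n F p -> exists q, idp q = p.
Proof. by case: p => a b /andP[_ /fpN_onto[x [y [/= <- <-]]]]; exists (x, y). Qed.

Lemma moveNE p q : mv (idp p) (idp q) <-> moveZ le bar z p q.
Proof.
case: p q => [x y] [x' y']; rewrite /moveN !fpairNE /moveZ /half_move /= -idz !djNE !niNE.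
rewrite !(inj_eq (@idN_inj n G)); split.
  case/and3P=> f1 f2 /orP h; split=> //; split=> //.
  by case: h => /andP[/eqP -> /andP[d /implyP h]]; [left|right].
move=> [f1 [f2 h]]; apply/and3P; split=> //; apply/orP.
by case: h => -[-> [d /implyP h]]; [left|right]; rewrite eqxx d h.
Qed.

Lemma star_nat p q : star MV (idp p) q -> exists2 q', idp q' = q & star (moveZ le bar z) p q'.
Proof.
move e: (idp p) => p1 st; elim: st e => [p2 <-|p2 q1 q2 st IH m e].
  by exists p => //; apply: star_refl.
have [q' e' s'] := IH e; have [_ f _] := and3P m; have [q3 e3] := fpairN_onto f.
by exists q3 => //; apply: star_step s' _; apply/moveNE; rewrite e' e3.
Qed.

Lemma star_U p q : star (moveZ le bar z) p q -> star MV (idp p) (idp q).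
Proof.
elim=> [*|{}p q1 q2 _ st m]; first exact: star_refl.
by apply: star_step st _; apply/moveNE.
Qed.

Lemma zN_link : sel (zN n inp) /\ zbN n inp < N.
Proof. by rewrite zbNE idN_lt -idz idN_sel. Qed.

Lemma F_sel a b : F a b -> [/\ sel a, sel b, sel (zN n inp) & zbN n inp < N].
Proof. by case: zN_link => h1 h2 /and3P[/andP[? _] /andP[? _] _]. Qed.

Lemma pleN_refl a : sel a -> pleN n inp a a.
Proof. by move/idN_onto => [x <-]; rewrite leNE // leN_refl. Qed.

Lemma djN_irr a : sel a -> ~~ djN n inp a a.
Proof. by move/idN_onto => [x <-]; rewrite djNE /apart leN_barF. Qed.

Lemma djN_sym a b : sel a -> sel b -> djN n inp a b = djN n inp b a.
Proof.
move=> /idN_onto[x <-] /idN_onto[y <-]; rewrite !djNE.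
exact: (dj_sym (barNK gG) (leN_bar gG)).
Qed.

Variable tb : table.
Local Notation S := (search_of n tb).
Hypothesis inv : search_inv N (fpairN n F) mv (keyN n (zbN n inp)) (N * N) S.

Definition rkN x := swN (zbN n inp) (id x).
Definition leadN x y := tb tROOT (id x) (id y).
Local Notation rk := rkN.
Local Notation lead := leadN.

Lemma mvN_sym p q : mv p q -> mv q p.
Proof. exact: (moveN_sym F_sel djN_sym). Qed.

Lemma searched p : free_pair le z p.1 p.2 -> exists rho,
  [/\ iter (N * N) (parent S) (idp p) = idp rho, parent S (idp rho) = idp rho,
      lead p.1 p.2 = rk rho.1 * N + rk rho.2 /\ lead rho.1 rho.2 = rk rho.1 * N + rk rho.2,
      star (moveZ le bar z) p rho &
      forall q, star (moveZ le bar z) p q -> rk rho.1 * N + rk rho.2 <= rk q.1 * N + rk q.2].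
Proof.
rewrite -fpairNE => f.
have [_ [r [h1 h2 [h3 h4] [h5 _] h6]] _] := search_complete (@fpairN_range n F) (@moveN_fp n inp _ F) mvN_sym inv f.
have [rho e s] := star_nat h5; rewrite -e in h1 h2 h3 h4 h6; exists rho; split=> // q pq.
exact: (h6 (idp q) (star_U pq)).
Qed.

Lemma parent_move p : free_pair le z p.1 p.2 -> exists2 q, idp q = parent S (idp p) & moveZ le bar z p q.
Proof.
rewrite -fpairNE => f.
have [m _ _] := search_complete (@fpairN_range n F) (@moveN_fp n inp _ F) mvN_sym inv f.
have [_ fq _] := and3P m; have [q e] := fpairN_onto fq.
by exists q => //; apply/moveNE; rewrite e.
Qed.

Lemma lead_move p q : moveZ le bar z p q -> lead p.1 p.2 = lead q.1 q.2.
Proof.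
move=> m; have [f _] := m; rewrite -fpairNE in f.
have [_ _ h] := search_complete (@fpairN_range n F) (@moveN_fp n inp _ F) mvN_sym inv f.
by apply: (h (idp q)); apply: star_U; apply: star_step m; apply: star_refl.
Qed.

Lemma lead_ex x y : free_pair le z x y -> exists i j,
  star (moveZ le bar z) (x, y) (i, j) /\ lead x y = rk i * N + rk j.
Proof.
by move=> /(@searched (x, y))[[i j] [_ _ [h _] s _]]; exists i, j.
Qed.

Lemma lead_le x y : free_pair le z x y -> lead x y <= rk x * N + rk y.
Proof.
move=> /(@searched (x, y))[rho [_ _ [-> _] _ h]].
by apply: (h (x, y)); apply: star_refl.
Qed.

Lemma rk_lt x : rk x < N.
Proof. by case: zN_link => _ h; exact: (swN_lt (inpG0 G) h (idN_lt x)). Qed.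

Lemma rk_inj : injective rk.
Proof. by move=> x y e; apply: idN_inj; rewrite -(swNK (zbN n inp) (id x)) -/(rk x) e /rk swNK. Qed.

Lemma rk_zb : rk (bar z) = 0.
Proof. by rewrite /rk /swN -zbNE eqxx; case: eqP. Qed.

Lemma star_swap p q : star (moveZ le bar z) p q -> star (moveZ le bar z) (p.2, p.1) (q.2, q.1).
Proof.
elim=> [*|{}p [a b] [c d] _ st m]; first exact: star_refl.
by apply: star_step st _; apply: moveZ_swap m.
Qed.

Lemma leadN_star p q : star (moveZ le bar z) p q -> lead p.1 p.2 = lead q.1 q.2.
Proof. by elim=> // {}p q1 q2 _ -> /lead_move. Qed.

Lemma star_free p q : star (moveZ le bar z) p q -> free_pair le z p.1 p.2 -> free_pair le z q.1 q.2.
Proof. by elim=> [p0 f0|{}p q1 q2 _ _ [_ [h _]] _]; [exact: f0|exact: h]. Qed.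

Local Notation confl := (conf n inp tb).

(** If [(x, y)] and [(y, x)] shared a label, so would the root of [(x, y)] and the reversal of that
    root; it therefore suffices to test roots. *)
Lemma lead_neq : (forall a b, a < N -> b < N -> ~~ confl a b) ->
  forall x y, free_pair le z x y -> lead x y != lead y x.
Proof.
move=> nc x y f; apply/negP => /eqP e.
have [[i j] [h1 h2 [h3 h4] h5 _]] := @searched (x, y) f.
have fij := star_free h5 f; have := nc _ _ (idN_lt i) (idN_lt j); case/negP.
rewrite /conf fpNE fij /=; apply/andP; split.
  move: h2; rewrite /idp /=; move: (tb _ _ _) => c [<- <-].
  by rewrite subnKC // leq_divM.
have := leadN_star (star_swap h5); rewrite /= -[tb _ _ _]/(lead i j) -[tb _ (id j) _]/(lead j i).
by rewrite -e h3 h4 => ->.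
Qed.

(** The shared label is the key of the root [(x, y)] and also the key of the root above [(y, x)]; as
    keys are injective, [(y, x)] climbs to [(x, y)]. *)
Lemma conf_link a b : confl a b -> exists x y, [/\ id x = a, id y = b, free_pair le z x y,
   iter (N * N) (parent S) (idp (y, x)) = idp (x, y) & star (moveZ le bar z) (y, x) (x, y)].
Proof.
case/and3P=> f /eqP ep /eqP el; have [x [y [ex ey]]] := fpN_onto f.
subst a b; rewrite fpNE in f.
have f' : free_pair le z y x by rewrite free_pair_sym.
have [rho [h1 h2 [h3 h4] h5 _]] := @searched (y, x) f'.
have [sg [g1 g2 [g3 g4] g5 _]] := @searched (x, y) f.
have pxy : parent S (idp (x, y)) = idp (x, y).
  have N0 : 0 < N by lia.
  by rewrite /idp /= ep divnMDl // divn_small ?idN_lt // addn0 addKn.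
have esg : sg = (x, y).
  apply: idp_inj; rewrite -g1; elim: (N * N) => //= k ->; exact: pxy.
have erho : rho = (x, y).
  have [_ zbN] := zN_link; apply: idp_inj.
  apply: (keyN_inj (inpG0 G) zbN); rewrite /in_range ?idN_lt //.
  rewrite esg /= in g3; rewrite -[keyN _ _ (idp rho)]/(rk rho.1 * N + rk rho.2) -h3.
  by rewrite -[keyN _ _ _]/(rk x * N + rk y) -g3.
exists x, y; split=> //; first by rewrite h1 erho.
by rewrite erho in h5.
Qed.

End Link.

(** * Correctness of the answers *)

Section SideBar.

Variables (U : finType) (le : rel U) (bar : U -> U) (z : U).
Hypothesis lexx : reflexive le.
Hypothesis le_trans : forall x y w, le x y -> le y w -> le x w.
Hypothesis barK : involutive bar.
Hypothesis le_bar : forall x y, le (bar x) (bar y) = le y x.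
Hypothesis le_barF : forall x, le x (bar x) = false.
Hypothesis z_min : forall x, le x z -> x = z.
Variables (rk : U -> nat) (lead : U -> U -> nat).
Hypothesis rk_zb : rk (bar z) = 0.
Hypothesis lead_move : forall p q, moveZ le bar z p q -> lead p.1 p.2 = lead q.1 q.2.
Hypothesis lead_neq : forall x y, free_pair le z x y -> lead x y != lead y x.

(** The complement of a vertex above [z] is disjoint from [z], and of a crossing vertex and its
    complement exactly one comes after [bar z]. *)
Lemma side_bar x : ~~ side le bar z lead x -> side le bar z lead (bar x).
Proof.
have inside : le z x -> side le bar z lead (bar x).
  move=> zx; have d : apart le bar z (bar x) by rewrite dj_barr.
  by apply: side_disjoint => //; apply: (dj_ni le_trans barK le_bar le_barF) d.
move=> nx; have [//|nzx] := boolP (le z x).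
have [/z_min e|nxz] := boolP (le x z); first by rewrite e lexx in nzx.
have zx : incomparable le z x by rewrite /incomparable nzx nxz.
move: nx; rewrite /side zx /= negb_or => /andP[nd nb].
have cx : crossing le bar z x by rewrite /crossing zx nd.
have /andP[zbx _] := crossing_bar lexx barK z_min cx.
rewrite zbx (before_crossing_bar lexx barK le_bar le_barF z_min rk_zb lead_move lead_neq cx).
by rewrite nb orbT.
Qed.

End SideBar.

(** * Arcs for graphs without a self-reversed component *)

Section YesInstance.

Variables (n : nat) (G : rel 'I_n).
Hypothesis gG : graph G.
Local Notation N := (2 * n + 2).
Local Notation inp := (inpG G).
Local Notation sel := (selN n inp).
Local Notation U := 'I_(size (selsN n inp)).
Local Notation le := (@leN n G).
Local Notation bar := (barUN gG).
Local Notation id := (@idN n G).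

Lemma size_sels : size (selsN n inp) <= n + n.
Proof.
rewrite -(size_iota 0 (n + n)); apply: uniq_leq_size; first by rewrite filter_uniq ?iota_uniq.
by move=> x; rewrite mem_sels => /(sel_lt (inpG0 G)); rewrite mem_iota.
Qed.

Section Positions.

Variable z : U.
Hypothesis idz : id z = zN n inp.
Hypothesis z_min : forall x, le x z -> x = z.
Variable tb : table.
Hypothesis inv : search_inv N (fpairN n (fpN n inp)) (moveN n inp (zN n inp) (fpN n inp))
  (keyN n (zbN n inp)) (N * N) (search_of n tb).
Hypothesis no_conf : forall a b, a < N -> b < N -> ~~ conf n inp tb a b.
Local Notation lead := (@leadN n G tb).
Local Notation bef := (before le z lead).
Local Notation sd := (side le bar z lead).

Lemma oNE x y : oN n inp tb (id x) (id y) = bef x y.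
Proof. by rewrite /oN (fpNE idz). Qed.

Lemma sideNE x : sideN n inp tb (id x) = sd x.
Proof. by rewrite /sideN (vzNE idz) (zbNE gG idz) -idz djNE oNE. Qed.

Lemma sum_side (f : nat -> nat) : \sum_(k < N) (if sideN n inp tb k then f k else 0) =
  \sum_(y | sd y) f (id y).
Proof.
have -> : \sum_(k < N) (if sideN n inp tb k then f k else 0) =
    \sum_(k < N) (if sel (val k) then (fun k => if sideN n inp tb k then f k else 0) (val k) else 0).
  by apply: eq_bigr => k _; case: ifP => [/side_sel ->|] //; case: (sel _).
rewrite (big_filter_iota N sel (fun k => if sideN n inp tb k then f k else 0)) -/(selsN n inp) [RHS]big_mkcond /=.
by apply: eq_bigr => i _; rewrite -/(id i) sideNE.
Qed.

Local Notation lpos := (left_pos sd le (apart le bar) bef).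
Local Notation rpos := (right_pos sd le (apart le bar) bef).

Lemma leftNE x : leftN n inp tb (id x) = lpos x.
Proof.
rewrite /leftN (sum_side (fun k => (oN n inp tb k (id x) || (pleN n inp (id x) k && ~~ (k == id x))) +
  (oN n inp tb k (id x) && djN n inp k (id x)))).
apply: eq_bigr => y _; rewrite !oNE leNE // djNE.
by rewrite (inj_eq (@idN_inj n G)).
Qed.

Lemma rightNE x : rightN n inp tb (id x) = rpos x.
Proof.
rewrite /rightN (sum_side (fun k => (oN n inp tb k (id x) || (pleN n inp k (id x) && ~~ (k == id x))) +
  ~~ (oN n inp tb (id x) k && djN n inp (id x) k))).
apply: eq_bigr => y _; rewrite !oNE leNE // djNE.
by rewrite (inj_eq (@idN_inj n G)).
Qed.

Definition vertex_arc := flipped_arc bar sd lpos rpos (4 * N).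

Lemma arcsNE x : arcsN n inp tb (id x) = (vertex_arc x).1.
Proof.
rewrite /arcsN sideNE /vertex_arc /flipped_arc; case: ifP => _ /=; first by rewrite leftNE.
by rewrite (reprNE gG) rightNE.
Qed.

Lemma arctNE x : arctN n inp tb (id x) = (vertex_arc x).2.
Proof.
rewrite /arctN sideNE /vertex_arc /flipped_arc; case: ifP => _ /=; first by rewrite rightNE.
by rewrite (reprNE gG) leftNE.
Qed.

Let lexx := @leN_refl n G.
Let le_trans := @leN_trans n G gG.
Let le_anti := @leN_anti n G gG.
Let barK := barNK gG.
Let le_bar := leN_bar gG.
Let le_barF := leN_barF gG.
Let rk_zb := rk_zb gG idz.
Let lead_move := lead_move (gG:=gG) idz inv.
Let neq := lead_neq gG idz inv no_conf.

Lemma vertex_order x y : sd x -> sd y ->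
  [/\ lpos x < rpos x,
      le x y -> x != y -> lpos y < lpos x /\ rpos x < rpos y,
      apart le bar x y -> rpos x < lpos y \/ rpos y < lpos x
    & incomparable le x y -> ~~ apart le bar x y ->
      [/\ lpos x < lpos y, lpos y < rpos x & rpos x < rpos y] \/
      [/\ lpos y < lpos x, lpos x < rpos y & rpos y < rpos x]].
Proof.
have bef_ni a b : bef a b -> incomparable le a b by case/andP=> /and3P[].
exact: (interval_order lexx le_anti le_trans (dj_sym barK le_bar) (dj_le le_trans)
  (dj_ni le_trans barK le_bar le_barF) bef_ni
  (side_oriented lexx le_trans barK le_bar le_barF z_min rk_zb lead_move neq)
  (before_trans lexx le_trans barK le_bar le_barF z_min (@rk_inj n G) (rk_lt gG idz) rk_zb
     lead_move (lead_ex gG idz inv) (lead_le gG idz inv) neq)).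
Qed.

Lemma vertex_bound x : 2 * rpos x + 2 < 4 * N.
Proof.
have [_ h] := pos_bound sd le (apart le bar) bef x.
have := max_card sd; rewrite card_ord; have := size_sels; move: h; clear; lia.
Qed.

Let W_bar := side_bar lexx le_trans barK le_bar le_barF z_min rk_zb lead_move neq.

Lemma vertex_arc_len x : (vertex_arc x).1 < (vertex_arc x).2 < (vertex_arc x).1 + 4 * N /\
  (vertex_arc x).2 < 2 * (4 * N).
Proof. exact: (flipped_arc_len W_bar vertex_bound vertex_order). Qed.

Lemma vertex_arc_meets x y : meets le bar x y = arcs_meet (4 * N) (vertex_arc x) (vertex_arc y).
Proof.
apply: (flipped_arc_meets lexx barK le_bar le_barF W_bar _ vertex_bound vertex_order).
exact: (side_cover lexx le_trans barK le_bar le_barF z_min rk_zb lead_move neq).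
Qed.

End Positions.

Lemma twinNE u : ~~ universal G u -> exists x i,
  [/\ id x = twinN n inp u, cN x = (i, false) & true_twins G u (kN i)].
Proof.
move=> nu; have [_ h2 h3] := kN_reduction G; have [i ti] := h3 u nu.
have [x cx] := cN_false i; exists x, i; split=> //; apply/esym.
have ex : id x = kN i by rewrite -enc_cN cx.
apply: find_iota_unique; first exact: idN_lt.
  by rewrite ex kN_rep twNE /true_twins eq_sym.
move=> j _ /andP[/kN_onto[j' <-]]; rewrite twNE ex => t; congr (nat_of_ord (kN _)).
by apply: h2; rewrite /true_twins (eqP t) -/(true_twins G u (kN i)).
Qed.

Lemma meets_twins u v x y i j : cN x = (i, false) -> cN y = (j, false) ->
  true_twins G u (kN i) -> true_twins G v (kN j) -> G u v = meets le bar x y.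
Proof.
have [_ gs] := gG; move=> ex ey /eqP/setP ti /eqP/setP tj.
rewrite /meets /apart /leN /barUN leU_barr ex ey /ple /= negbK.
have := ti v; have := tj (kN i); rewrite !inE => e1 e2.
by rewrite e2 gs e1 gs.
Qed.

Lemma nonuniv_twin u : u < n -> nonuniv n inp u -> sel (twinN n inp u).
Proof.
move=> un; rewrite /nonuniv -[u]/(val (Ordinal un)) nonunivE => /twinNE[x [i [<- _ _]]].
exact: idN_sel.
Qed.

Section Arcs.

Variables (R : realType) (tb : table) (p : U -> nat * nat).
Hypothesis p_len : forall x, (p x).1 < (p x).2 < (p x).1 + 4 * N /\ (p x).2 < 2 * (4 * N).
Hypothesis p_meets : forall x y, meets le bar x y = arcs_meet (4 * N) (p x) (p y).
Hypothesis p_s : forall x, arcsN n inp tb (id x) = (p x).1.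
Hypothesis p_t : forall x, arctN n inp tb (id x) = (p x).2.

Lemma arcs_represent :
  represents G (fun u => (arc_out_s n inp tb u)%:R / (4 * N)%:R : R)%R
    (fun u => (arc_out_t n inp tb u)%:R / (4 * N)%:R : R)%R.
Proof.
have nonE (u : 'I_n) : nonuniv n inp u = ~~ universal G u by exact: nonunivE.
have univ (u : 'I_n) : universal G u ->
    (arc_out_s n inp tb u, arc_out_t n inp tb u) = (0, 4 * N - 1).
  by move=> h; rewrite /arc_out_s /arc_out_t nonE h.
have nuniv (u : 'I_n) : ~~ universal G u -> exists x i, [/\ cN x = (i, false), true_twins G u (kN i) &
    (arc_out_s n inp tb u, arc_out_t n inp tb u) = p x].
  move=> h; have [x [i [e1 e2 e3]]] := twinNE h; exists x, i; split=> //.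
  by rewrite /arc_out_s /arc_out_t nonE h -e1 p_s p_t -surjective_pairing.
have len (u : 'I_n) : arc_out_s n inp tb u < arc_out_t n inp tb u < arc_out_s n inp tb u + 4 * N /\
    arc_out_t n inp tb u < 2 * (4 * N).
  have [/univ[-> ->]|/nuniv[x [i [_ _ e]]]] := boolP (universal G u); first by clear; lia.
  by have := p_len x; rewrite -e.
(* The arc of a universal vertex leaves out only the open gap from [4 * N - 1] to [4 * N], which
   contains no integer, while the ends of every arc are integers. *)
have full q r : q < r -> q < 2 * (4 * N) -> arcs_meet (4 * N) (0, 4 * N - 1) (q, r) && arcs_meet (4 * N) (q, r) (0, 4 * N - 1).
  by rewrite /arcs_meet /=; clear; lia.
apply: discrete_represents.
- by clear; lia.
- by move=> u; case: (len u).
- by move=> u; case: (len u).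
move=> u v; have [_ gs] := gG.
have [[/andP[lu _] bu] [/andP[lv _] bv]] := (len u, len v).
have [uu|/nuniv[x [i [cx tx ex]]]] := boolP (universal G u).
  have [-> ->] := univ u uu; rewrite (forallP uu).
  by have /andP[->] := full _ _ lv (ltn_trans lv bv).
have [uv|/nuniv[y [j [cy ty ey]]]] := boolP (universal G v).
  have [-> ->] := univ v uv; rewrite gs (forallP uv).
  by have /andP[_ ->] := full _ _ lu (ltn_trans lu bu).
rewrite (meets_twins cx cy tx ty) p_meets.
exact: (f_equal2 (arcs_meet (4 * N)) (esym ex) (esym ey)).
Qed.

End Arcs.

End YesInstance.

Section CleBar.

Import Order.TTheory GRing.Theory Num.Theory.

Local Open Scope ring_scope.

Lemma cle_barr (R : realType) (S : finType) (beta rho : S -> R) (x y : S * bool) :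
  cle beta rho x (pbar y) <-> exists k : int,
    rend beta rho y <= lend beta rho x + k%:~R /\ rend beta rho x + k%:~R <= lend beta rho y + 1.
Proof.
case: y => v []; rewrite /cle /pbar /= /lend /rend /=; last by split=> -[k h]; exists k.
move: (if x.2 then _ else _) (if x.2 then _ else _) => l r.
split=> -[k [h1 h2]]; [exists (k + 1)|exists (k - 1)].
  by rewrite intrD; split; lra.
by rewrite intrB; split; lra.
Qed.

End CleBar.

Lemma map_nth_enum (s : seq nat) : [seq nth 0 s (nat_of_ord i) | i <- enum 'I_(size s)] = s.
Proof. by rewrite (map_comp (nth 0 s) (@nat_of_ord _)) val_enum_ord map_nth_iota0 // take_size. Qed.

(** * Obstructions from a self-reversed component *)

Section NoInstance.

Variables (n : nat) (G : rel 'I_n).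
Hypothesis gG : graph G.
Local Notation N := (2 * n + 2).
Local Notation inp := (inpG G).
Local Notation sel := (selN n inp).
Local Notation reps := (repsN n inp).
Local Notation sels := (selsN n inp).
Local Notation U := 'I_(size sels).
Local Notation le := (@leN n G).
Local Notation bar := (barUN gG).
Local Notation id := (@idN n G).
Local Notation H := (completion (@gN n G) (@cN n G)).

Lemma reduction_represents (R : realType) : circular_arc_graph R G -> exists a b : 'I_(size reps) -> R,
  represents (@gN n G) a b.
Proof.
by move=> [a [b [h1 h2]]]; exists (a \o @kN n G), (b \o @kN n G); split=> *; [apply: h1|apply: h2].
Qed.

(** In a tight representation the order of the completion is containment of arcs, formal partners
    receiving complementary arcs, so [no_invertible] applies. *)
Lemma invertible_not_arc (R : realType) z x y : star (moveZ le bar z) (x, y) (y, x) ->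
  free_pair le z x y -> ~ circular_arc_graph R G.
Proof.
move=> st f /reduction_represents[a [b rep]].
have [beta [rho t]] := represents_tight (gN_graph gG) (@gN_no_universal n G gG) rep.
have P := cleP (gN_graph gG) t.
apply: (@no_invertible R U le bar z (fun u => lend beta rho (cN u)) (fun u => rend beta rho (cN u))) st f.
- by move=> u; apply: ends_len t _.
- by move=> u v; apply: P.
- by move=> u v; rewrite /apart /leN /barUN leU_barr -cle_barr; apply: P.
- exact: barNK.
- exact: leN_bar.
Qed.

Lemma HE : H = meets le bar.
Proof. exact: completion_rel. Qed.

Lemma f_ex : exists f : 'I_(size reps) -> U, forall u, cN (f u) = (u, false).
Proof. by have [f h] := choice (@cN_false n G); exists f. Qed.

(** Selected numbers are listed in increasing order, so counting the smaller ones returns the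
    index. *)
Lemma cntNE x : cntN n inp (id x) = x.
Proof.
rewrite /cntN (sum_filter_iota N (fun k => (k < id x) && sel k)).
transitivity (size [seq k <- sels | k < id x]); first by rewrite /selsN -filter_predI.
rewrite size_filter; apply: (@Order.POrderTheory.count_lt_nth _ nat 0 sels) => //.
by apply: sorted_filter; [exact: ltn_trans|exact: iota_ltn_sorted].
Qed.

Lemma map_kN : [seq nat_of_ord (kN i) | i <- enum 'I_(size reps)] = reps.
Proof. by under eq_map => i do rewrite val_kN; apply: map_nth_enum. Qed.

Lemma map_id_enum : [seq id i | i <- enum U] = sels.
Proof. exact: map_nth_enum. Qed.

Lemma map_sels (B : Type) (h : nat -> B) : [seq h a | a <- sels] = [seq h (id i) | i <- enum U].
Proof. by have := map_comp h id (enum U); rewrite map_id_enum. Qed.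

Lemma id_f f : (forall u, cN (f u) = (u, false)) -> forall u, id (f u) = kN u.
Proof. by move=> cf u; rewrite -enc_cN cf. Qed.

Lemma adjacency_outs : flatten [seq [seq nat_of_bool (~~ djN n inp a b) | b <- sels] | a <- sels] =
  adjacency_matrix H.
Proof.
rewrite map_sels; congr flatten; apply: eq_map => i /=.
by rewrite map_sels; apply: eq_map => j; rewrite (djNE gG) HE.
Qed.

Variable z : U.
Hypothesis idz : id z = zN n inp.
Hypothesis z_min : forall x, le x z -> x = z.
Variable tb : table.
Hypothesis inv : search_inv N (fpairN n (fpN n inp)) (moveN n inp (zN n inp) (fpN n inp))
  (keyN n (zbN n inp)) (N * N) (search_of n tb).

Lemma walk_moves p : free_pair le z p.1 p.2 -> exists s : nat -> U * U,
  [/\ s 0 = p, forall i, idp (s i) = walkN n tb (idp p) i & forall i, moveZ le bar z (s i) (s i.+1)].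
Proof.
move=> f; have ex i : exists q : U * U, idp q = walkN n tb (idp p) i /\ free_pair le z q.1 q.2.
  elim: i => [|i [q [e fq]]]; first by exists p.
  have [q' e' [_ [f' _]]] := parent_move gG idz inv fq; exists q'; split=> //.
  by rewrite e' e.
have [s sP] := choice ex; exists s; split=> [|i|i].
- by have [/idp_inj] := sP 0.
- by have [] := sP i.
have [e f1] := sP i; have [e' _] := sP i.+1; have [q eq m] := parent_move gG idz inv f1.
have -> // : s i.+1 = q.
by apply: idp_inj; rewrite e' eq e.
Qed.

Lemma obstruction_certificate (R : realType) a b : conf n inp tb a b -> exists w : certificate n,
  [/\ answer w = false, ~ circular_arc_graph R G, valid R G w,
    (forall i, in_range N (walkN n tb (b, a) i)) &
    encode w = [:: 0; \sum_(k < N) repN n inp k; \sum_(k < N) sel k] ++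
      reps ++ [seq cntN n inp k | k <- reps] ++
      flatten [seq [seq nat_of_bool (~~ djN n inp a b) | b <- sels] | a <- sels] ++
      [:: cntN n inp (zN n inp); cntN n inp b; cntN n inp a; N * N + 1; N * N + 1] ++
      [seq cntN n inp (walkN n tb (b, a) i).1 | i <- iota 0 (N * N + 1)] ++
      [seq cntN n inp (walkN n tb (b, a) i).2 | i <- iota 0 (N * N + 1)]].
Proof.
move=> c; have [x [y [ex ey f it st]]] := conf_link gG idz inv c.
have f' : free_pair le z y x by rewrite free_pair_sym.
have [s [s0 sw sm]] := @walk_moves (y, x) f'.
have [f_ cf] := f_ex; rewrite -[(b, a)]/(b, a).
have eba : (b, a) = idp (y, x) by rewrite /idp /= ex ey.
pose P := [seq (s i).1 | i <- iota 0 (N * N).+1]; pose Q := [seq (s i).2 | i <- iota 0 (N * N).+1].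
exists (Obstruction (@kN n G) f_ H z y x P Q); split=> //.
- exact: (invertible_not_arc st f').
- split; first exact: kN_reduction.
    exact: (completion_circular (gN_graph gG) (@gN_no_universal n G gG) (@gN_twin_free n G gG)
       (@cN_inj n G) (@cN_false n G) (@cN_true n G) cf).
  rewrite HE; have := @invertible_of_moves U le bar (@leN_refl n G) (@leN_trans n G gG) (barNK gG)
    (leN_bar gG) (leN_barF gG) z s (N * N); rewrite s0; apply.
  + by move=> i _; left; apply: sm.
  + by clear; lia.
  + by apply: idp_inj; rewrite sw.
- by move=> i; rewrite eba -sw /in_range !idN_lt.
rewrite /encode -/(adjacency_matrix H) -adjacency_outs map_kN !sum_filter_iota -/reps -/sels.
have szP : size P = N * N + 1 by rewrite size_map size_iota addn1.
have szQ : size Q = N * N + 1 by rewrite size_map size_iota addn1.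
rewrite szP szQ -idz -ex -ey !cntNE.
have -> : [seq nat_of_ord (f_ i) | i <- enum 'I_(size reps)] = [seq cntN n inp k | k <- reps].
  by rewrite -[in RHS]map_kN -map_comp; apply: eq_map => i /=; rewrite -(id_f cf) cntNE.
have wE i : walkN n tb (id y, id x) i = idp (s i) by rewrite sw.
have -> : [seq nat_of_ord v | v <- P] = [seq cntN n inp (walkN n tb (id y, id x) i).1 | i <- iota 0 (N * N + 1)].
  by rewrite /P -map_comp -addn1; apply: eq_map => i; rewrite wE /= cntNE.
have -> : [seq nat_of_ord v | v <- Q] = [seq cntN n inp (walkN n tb (id y, id x) i).2 | i <- iota 0 (N * N + 1)].
  by rewrite /Q -map_comp -addn1; apply: eq_map => i; rewrite wE /= cntNE.
by [].
Qed.

End NoInstance.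

(** * Correctness of the output *)

Section Correctness.

Variables (R : realType) (n : nat) (G : rel 'I_n).
Hypothesis gG : graph G.
Local Notation N := (2 * n + 2).
Local Notation inp := (inpG G).
Local Notation sel := (selN n inp).
Local Notation F := (fpN n inp).
Local Notation mv := (moveN n inp (zN n inp) F).
Local Notation key := (keyN n (zbN n inp)).

Lemma sel_z a : sel a -> sel (zN n inp) /\ zbN n inp < N.
Proof. by move/(zN_ex gG) => [z e _]; apply: zN_link e. Qed.

Lemma repr_sel x : sel x -> sel (reprN n inp x).
Proof. by move/idN_onto => [i <-]; rewrite (reprNE gG) idN_sel. Qed.

Lemma fp_sel a b : F a b -> [/\ sel a, sel b, sel (zN n inp) & zbN n inp < N].
Proof. by case/and3P=> /andP[sa _] /andP[sb _] _; have [h1 h2] := sel_z sa. Qed.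

Lemma run_prefix : exists tb0 tb cx cy rt rx ry ca cb,
  [/\ forall t, t < 7 -> tab_ok n inp tb0 t,
      search_inv N (fpairN n F) mv key (N * N) (search_of n tb0),
      post_ok n inp tb0 tb,
      ca = (find_pair N (conf n inp tb0)).1 /\ (ca < N -> cb = (find_pair N (conf n inp tb0)).2)
    & outs (run N inp recognizer (HState (fun _ _ _ => 0) (nseq 11 0) [::])) =
      outs (run N inp (if ca < N then c_obstruction else c_arcs)
        (HState tb [:: n; zN n inp; zbN n inp; cx; cy; rt; rx; ry; ca; cb; 0] [::]))].
Proof.
have [tb1 [p1 p2 p3 p4] e1] := run_pre (inpG0 G).
have okF x y : x < N -> y < N -> (tb1 tFP x y != 0) = F x y.
  move=> xN yN; have [h|h] := boolP (has sel (iota 0 N)).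
    have [a _ sa] := hasP h; have [sz _] := sel_z sa.
    by apply: p2 => //; have := sel_lt (inpG0 G) sz; clear; lia.
  have ns k : k < N -> ~~ sel k by move=> kN; apply: (hasPn h); rewrite mem_iota.
  by rewrite p3 // /fpN /vzN (negbTE (ns x xN)).
have irr a : sel a -> ~~ djN n inp a a by exact: djN_irr.
have mark0 x y : tb1 tMARK x y = 0 by apply: p4.
have [tb2 [cx [cy [rt [rx [ry [us inv e2]]]]]]] := run_search (inpG0 G) fp_sel
  (@pleN_refl n G) irr (djN_sym gG) (p1 tPLE isT) okF mark0 [::].
have ok2 t : t < 7 -> tab_ok n inp tb2 t.
  move=> t7; have e : tb2 t = tb1 t.
    by apply: us; rewrite !inE; move: t7; rewrite /tMARK /tPAR /tROOT /tNEW; clear; lia.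
  by move=> x y; rewrite e; apply: p1.
have okF2 x y : x < N -> y < N -> (tb2 tFP x y != 0) = F x y by rewrite (us tFP) //; apply: okF.
have [tb3 [ca [cb [pok eca ecb e3]]]] := run_post (inpG0 G) sel_z ok2 okF2 repr_sel cx cy rt rx ry [::].
exists tb2, tb3, cx, cy, rt, rx, ry, ca, cb; split=> //.
rewrite /recognizer run_seq e1 run_seq e2 run_seq e3 run_if tv_lt.
rewrite [ev _ _ _ _ vca]/= [ev _ _ _ _ HN]/=.
by case: ifP.
Qed.

Lemma recognizer_correct : exists w : certificate n,
  [/\ outs (run N inp recognizer (HState (fun _ _ _ => 0) (nseq 11 0) [::])) = encode w,
      answer w <-> circular_arc_graph R G & valid R G w].
Proof.
have [tb0 [tb [cx [cy [rt [rx [ry [ca [cb [ok inv pok [eca ecb] ->]]]]]]]]]] := run_prefix.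
have nosel (x : 'I_(size (selsN n inp))) : ~~ has sel (iota 0 N) -> False.
  by move/hasPn/(_ (idN x)); rewrite idN_sel mem_iota idN_lt => /(_ isT).
case: ifP => [h|/negbT h].
  rewrite eca in h; have [h2 hc _] := find_pairP h; rewrite -eca in h hc; rewrite -(ecb h) in h2 hc.
  have [sa _ sz _] : [/\ sel ca, sel cb, sel (zN n inp) & zbN n inp < N].
    by case/and3P: hc => /fp_sel.
  have [z idz z_min] := zN_ex gG sa.
  have [w [w1 w2 w3 w4 w5]] := obstruction_certificate gG idz inv R hc.
  exists w; split=> //; last by rewrite w1; split.
  by rewrite w5; apply: (run_obstruction (inpG0 G) sel_z ok).
have nc a b : a < N -> b < N -> ~~ conf n inp tb0 a b by apply: find_pair_none; rewrite -eca.
have twin_sel : forall u, u < n -> nonuniv n inp u -> sel (twinN n inp u) by exact: nonuniv_twin.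
pose s (u : 'I_n) := arc_out_s n inp tb0 u; pose t (u : 'I_n) := arc_out_t n inp tb0 u.
have rep : represents G (fun u => (s u)%:R / (4 * N)%:R : R)%R (fun u => (t u)%:R / (4 * N)%:R : R)%R.
  have [hs|hs] := boolP (has sel (iota 0 N)).
    have [a _ sa] := hasP hs; have [z idz z_min] := zN_ex gG sa.
    exact: (arcs_represent R (vertex_arc_len gG idz z_min inv nc) (vertex_arc_meets gG idz z_min inv nc)
      (arcsNE gG idz tb0) (arctNE gG idz tb0)).
  (* Without selected numbers the completion has no vertices, and any assignment of arcs to them
     will do. *)
  by apply: (@arcs_represent _ _ gG R tb0 (fun _ => (0, 0))) => x; case: (nosel x hs).
exists (Arcs (4 * N) s t); split=> //.
- rewrite (run_arcs (inpG0 G) ok twin_sel) // /encode.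
  by rewrite -val_enum_ord -!map_comp.
- by split=> // _; exists (fun u => (s u)%:R / (4 * N)%:R : R)%R, (fun u => (t u)%:R / (4 * N)%:R : R)%R.
- by split=> //; clear; lia.
Qed.

End Correctness.

(** * The machine program and its time bound *)

Definition load_size := Assign 0 (Bin Add (Bin Mul (Lit 2) (Fetch (Lit 0))) (Lit 2)).

Definition loaded n (G : rel 'I_n) : state :=
  State [eta (fun=> 0) with 0 |-> 2 * n + 2] (inpG G) [::].

Lemma exec_load_size W n (G : rel 'I_n) : 2 * n + 2 < W -> exec W load_size (input G) 7 (loaded G).
Proof.
move=> hW; apply: exec_assign.
have w v : v <= 2 * n + 2 -> word W v = Some v.
  by move=> h; rewrite /word (leq_ltn_trans h hW).
have h2 : 2 <= 2 * n + 2 by exact: leq_addl.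
have h3 : 2 * n <= 2 * n + 2 by exact: leq_addr.
have h1 : n <= 2 * n + 2 by apply: leq_trans h3; rewrite mul2n -addnn leq_addl.
by rewrite /= (w 2) // (w 0) //= (w n) //= (w (2 * n)) //= (w (2 * n + 2)).
Qed.

(** Tables start at cell [2 * N * N], beyond the adjacency matrix, where the initial memory reads
    0. *)
Lemma loaded_corr n (G : rel 'I_n) :
  corrS (2 * n + 2) (inpG G) (HState (fun _ _ _ => 0) (nseq 11 0) [::]) (loaded G).
Proof.
split=> //; split=> //.
- move=> i _; rewrite nth_nseq if_same -[LHS]/(if vr i == 0 then 2 * n + 2 else 0).
  by [].
- move=> t x y _ _; rewrite -[LHS]/(nth 0 (n :: adjacency_matrix G) ((t.+2 * (2 * n + 2) + x) * (2 * n + 2) + y)).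
  rewrite nth_default //= size_allpairs size_enum_ord.
  have h1 : 2 * (2 * n + 2) <= t.+2 * (2 * n + 2) + x by rewrite (leq_trans _ (leq_addr _ _)) // leq_mul2r orbT.
  have h2 : 2 * (2 * n + 2) * (2 * n + 2) <= (t.+2 * (2 * n + 2) + x) * (2 * n + 2) by rewrite leq_mul2r h1 orbT.
  apply: leq_trans (leq_addr y _); apply: leq_trans h2; clear; nia.
Qed.

Lemma quartic_big_O K c : big_O (fun n => K * (2 * n + 2) ^ 4 + c) (fun n => n ^ 4).
Proof.
(* For [n >= 1] one has [2 * n + 2 <= 4 * n]. *)
exists (K * 4 ^ 4 + c), 1 => n n1; rewrite mulnDl; apply: leq_add.
  rewrite -mulnA -expnMn leq_mul2l leq_exp2r //.
  by apply/orP; right; move: n1; clear; lia.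
by apply: leq_pmulr; rewrite expn_gt0 n1.
Qed.

(** As [2 * n + 2 < (n + 2) ^ 2], a power of [N] is bounded by the power of [n + 2] with twice the
    exponent. *)
Lemma word_size n D : 2 * n + 2 < n.+2 ^ (2 * D + 2) /\ (2 * n + 2) ^ D <= n.+2 ^ (2 * D + 2).
Proof.
have sq : 2 * n + 2 < n.+2 ^ 2 by rewrite expnS expn1; clear; nia.
split; first by apply: leq_trans sq _; rewrite leq_exp2l // leq_addl.
apply: (@leq_trans ((n.+2 ^ 2) ^ D)); last by rewrite -expnM leq_exp2l // leq_addr.
by case: D => // D; rewrite leq_exp2r // ltnW.
Qed.

Lemma blank_fits N : 1 < N ->
  fits N tab_degrees var_degrees (HState (fun _ _ _ => 0) (nseq 11 0) [::]).
Proof.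
move=> /ltnW N0; split; first by [].
  by move=> i _; rewrite nth_nseq if_same expn_gt0 N0.
by move=> t x y _ _; rewrite expn_gt0 N0.
Qed.

Theorem theorem2 (R : realType) :
  exists (A : program) (time : nat -> nat),
    big_O time (fun n : nat => n ^ 4) /\ certifying_recognition R A time.
Proof.
(* 11 is the number of global variables; loading the size costs 7 and the sequencing 1. *)
exists (Seq load_size (compS 11 recognizer)), (fun n => costS recognizer * (2 * n + 2) ^ 4 + 8).
split; first exact: quartic_big_O.
exists (2 * needS tab_degrees var_degrees recognizer + 2) => n G gG.
have [W2 WD] := word_size n (needS tab_degrees var_degrees recognizer).
have N1 : 1 < 2 * n + 2 by clear; lia.
have fit := blank_fits N1.
have [T [s [ex cost [_ os]]]] := compS_correct N1 (fun a _ => inpG_lt G a) fit recognizer_ok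
  (leqnn _) WD (loaded_corr G).
have [w [ow aw vw]] := recognizer_correct R gG.
exists (7 + T).+1, s, w; split.
- exact: exec_seq (exec_load_size G W2) ex.
- by move: cost; rewrite recognizer_depth; move: (_ * _) => M; clear; lia.
- exact: etrans os ow.
- exact: aw.
- exact: vw.
Qed.
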